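(* Let $G$ be a discrete submonoid, $R$ a commutative unital $(2\mathbb{Z}\oplus 0)$-graded real algebra, and $(C,d)$ a dg $R$-module with $HC=H(C,d)$. (a) Let $(\mathcal{B}(C^G),m,\lozenge)$ be a cyclic twisted $A_\infty$ algebra such that $(\mathcal{B}(C^G),m)$ is a perturbation of $(C,d)$. Let $(\Pi_{1,\mathbf 0},I_{1,\mathbf 0},h_{1,\mathbf 0})$ be a cyclic unital retraction of $(C,d)$ to $HC$. Let $I$, $\Pi$ and $m^{can}$ be given by the perturbation formulas recalled in the context. Then $m^{can}$ is cyclic with respect to the induced pairing on $HC$, and the morphism $I$ is cyclic. (b) Let $(\mathcal{B}(C^G),m)$ be a twisted $A_\infty$ algebra with unit $\mathbf e$, which is a perturbation of $(C,d)$, and let $(\Pi_{1,\mathbf 0},I_{1,\mathbf 0},h_{1,\mathbf 0})$ be a retraction of $(C,d)$ to $HC$. If $\mathbf e$ is a unit for the retraction, then $\Pi_{1,\mathbf 0}\mathbf e$ is a unit for $m^{can}$, and the morphisms $I,\Pi$ given by the perturbation formulas are unital.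
   Context: Gradings. ''Graded'' means $(\mathbb{Z}\oplus\mathbb{Z}/2)$-graded; for homogeneous $x$ of degree $(a,b)$ write $\mathrm{cd}\,x=a$, $\mathrm{ls}\,x=b$. Shifts: $(C[p,q])^{a,b}=C^{a+p,b+q}$, $C[p]=C[p,0]$. Maps preserve gradings unless stated otherwise. For objects $A,B$ of a category $\mathcal{C}$, $\mathcal{C}(A,B)$ denotes the internal hom object; $\mathbf{Mod}_R$ is the category of graded $R$-modules. $(2\mathbb{Z}\oplus 0)$-graded means $R^{a,b}=0$ unless $a$ is even and $b=0$. Discrete submonoid. A submonoid $G\subset\mathbb{R}_{\ge 0}\times\mathbb{Z}$ (containing $\mathbf 0=(0,0)$, closed under addition) with projections $E,\mu$ to the two factors, such that $E(G)$ is discrete and each $E^{-1}(\lambda)$ is finite. Novikov ring and bar coalgebra. $\Lambda=\{\sum_{\beta\in G}a_\beta\epsilon^{\mu(\beta)}T^{E(\beta)}:a_\beta\in R\}$ (possibly infinite formal sums; product from addition in $G$), $\mathbb{Z}\oplus 0$-graded by $\deg\epsilon=(1,0)$, $\deg T=(0,0)$, with $\mathcal{F}^{E_0}\Lambda$ the sums over $\beta$ with $E(\beta)\ge E_0$. $\widehat{\mathbf{BiMod}}_\Lambda$ is the category of $\Lambda$-bimodules in complete filtered graded real vector spaces (morphisms preserve filtration and grading), with completed tensor product $\hat\otimes_\Lambda$. With $C$ discretely filtered ($\mathcal{F}^{>0}C=0$, where $\mathcal{F}^{>0}=\bigcup_{E>0}\mathcal{F}^E$), $C^G=\Lambda\hat\otimes_R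 C$ has bimodule structure $\epsilon^{r_1}T^{E_1}\otimes(c\,\epsilon^rT^E)\otimes\epsilon^{r_2}T^{E_2}\mapsto(-1)^{(\mathrm{cd}\,c+\mathrm{ls}\,c+1)r_1}c\,\epsilon^{r_1+r+r_2}T^{E_1+E+E_2}$. The bar coalgebra is $\mathcal{B}(C^G)=\widehat{\bigoplus}_{k\ge 0}(C^G[1])^{\hat\otimes_\Lambda k}$ (sequences $(x_k)$ with $x_k\in\mathcal{F}^{E_k}$ for some $E_k\to\infty$), with inclusions $i_k$, projections $\pi_k$, deconcatenation comultiplication $\Delta$ and counit $\eta=\pi_0$. A coderivation of degree $d$ is a map $h:\mathcal{B}[-d]\to\mathcal{B}$ with $\eta h=0$ and $\Delta h=(h\otimes\mathrm{id}\pm\mathrm{id}\otimes h)\Delta$, where $(h\otimes\mathrm{id}\pm\mathrm{id}\otimes h)(x\otimes y)=hx\otimes y+(-1)^{d\cdot\mathrm{cd}\,x}x\otimes hy$. A differential is a degree $1$ coderivation of square zero. A differential or (counital) coalgebra morphism $f$ is tame if $(\pi_1 f i_0)(1_\Lambda)\in\mathcal{F}^{>0}$. Twisted $A_\infty$ algebras and morphisms. A twisted $A_\infty$ algebra is a pair $(\mathcal{B}(C^G),m)$ with $m$ a tame differential. Its components $m_{k,\beta}\in\mathbf{Mod}_R(C^{\otimes_R k},C[2-k-\mu(\beta)])$ are given by $\pi_1 m(x_1\otimes\cdots\otimes x_k)=\sum_\beta\epsilon^{\mu(\beta)}T^{E(\beta)}m_{k,\beta}(x_1,\dots,x_k)$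 for $x_i\in C$; a degree $1$ coderivation is determined by its components. A twisted $A_\infty$ morphism $f:(\mathcal{B},m)\to(\mathcal{B}',m')$ is a tame coalgebra morphism with $fm=m'f$. dg modules and retractions. A dg $R$-module $(C,d)$ is a graded $R$-module with an $R$-linear $d:C\to C[1]$, $d^2=0$; put $d'x=(-1)^{\mathrm{cd}\,x}dx$. A twisted $A_\infty$ algebra on $C$ is a perturbation of $(C,d)$ if $m_{1,\mathbf 0}=d'$. A retraction of $(C,d)$ to $HC$ is a triple of $R$-module maps $\Pi_{1,\mathbf 0}:C\to HC$, $I_{1,\mathbf 0}:HC\to C$, $h_{1,\mathbf 0}:C\to C[-1]$ with $\Pi_{1,\mathbf 0}d'=0$, $d'I_{1,\mathbf 0}=0$, $\Pi_{1,\mathbf 0}I_{1,\mathbf 0}=\mathrm{id}_{HC}$, $d'h_{1,\mathbf 0}+h_{1,\mathbf 0}d'=I_{1,\mathbf 0}\Pi_{1,\mathbf 0}-\mathrm{id}_C$, and side conditions $h_{1,\mathbf 0}^2=0$, $\Pi_{1,\mathbf 0}h_{1,\mathbf 0}=0$, $h_{1,\mathbf 0}I_{1,\mathbf 0}=0$. Given a pairing $C\otimes_R C\to R[-p,q]$, the retraction is cyclic if $\langle h_{1,\mathbf 0}x,y\rangle+(-1)^{\mathrm{cd}\,x}\langle x,h_{1,\mathbf 0}y\rangle=0$ for all $x,y\in C$. An element $e\in C^{0,0}$ is a unit for the retraction if $h_{1,\mathbf 0}e=0$; a unital retraction is one with a unit. Perturbation formulas. Let $\hat m_{1,\mathbf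 0}$ be the coderivation of $\mathcal{B}(C^G)$ corresponding to $m_{1,\mathbf 0}$, $\partial'=m-\hat m_{1,\mathbf 0}$, $\mathcal{P}=I_{1,\mathbf 0}\Pi_{1,\mathbf 0}$. With $\Pi_{1,\mathbf 0},I_{1,\mathbf 0},h_{1,\mathbf 0}$ extended by scalars to $C^G$ and $(HC)^G$, for $x_i\in C^G$, $y_i\in(HC)^G$ put $\hat\Pi_{1,\mathbf 0}(x_1,\dots,x_k)=\Pi_{1,\mathbf 0}x_1\otimes\cdots\otimes\Pi_{1,\mathbf 0}x_k$, $\hat I_{1,\mathbf 0}(y_1,\dots,y_k)=I_{1,\mathbf 0}y_1\otimes\cdots\otimes I_{1,\mathbf 0}y_k$, $$\hat h_{1,\mathbf 0}(x_1,\dots,x_k)=\sum_{i=1}^k(-1)^{\sum_{j=1}^{i-1}(\mathrm{cd}\,x_j-1)}x_1\otimes\cdots\otimes x_{i-1}\otimes h_{1,\mathbf 0}x_i\otimes\mathcal{P}x_{i+1}\otimes\cdots\otimes\mathcal{P}x_k.$$ Then $$m^{can}=\sum_{a\ge 0}\hat\Pi_{1,\mathbf 0}\partial'(\hat h_{1,\mathbf 0}\partial')^a\hat I_{1,\mathbf 0},\quad \Pi=\sum_{a\ge 0}\hat\Pi_{1,\mathbf 0}(\partial'\hat h_{1,\mathbf 0})^a,\quad I=\sum_{a\ge 0}(\hat h_{1,\mathbf 0}\partial')^a\hat I_{1,\mathbf 0}.$$ (By the homological perturbation lemma these converge pointwise, $(\mathcal{B}((HC)^G),m^{can})$ is a twisted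 $A_\infty$ algebra, a perturbation of $(HC,0)$, and $\Pi:(\mathcal{B}(C^G),m)\to(\mathcal{B}((HC)^G),m^{can})$ and $I$ in the opposite direction are twisted $A_\infty$ morphisms.) Cyclic structures. A pairing $\langle\cdot\rangle:C\otimes_R C\to R[-p,q\bmod 2]$ is antisymmetric if $\langle u\otimes v\rangle=(-1)^{1+(\mathrm{cd}\,u-1)(\mathrm{cd}\,v-1)}\langle v\otimes u\rangle$, and non-degenerate if for any $u\ne 0$ there is $v$ with $\langle u,v\rangle\ne 0$. It defines an element $\lozenge=\langle\cdot\rangle\otimes\mathrm{id}_\Lambda$ of $\widehat{\mathbf{BiMod}}_\Lambda(\mathcal{B}(C^G),\Lambda)$, of degree $(-p,q)$, with $\lozenge(x_1\otimes x_2)=\langle x_1,x_2\rangle$ for $x_i\in C$ and $\lozenge=0$ on $(C^G[1])^{\hat\otimes_\Lambda k}$ for $k\ne 2$. A cyclic twisted $A_\infty$ algebra is a triple $(\mathcal{B}(C^G),m,\lozenge)$ with $(\mathcal{B}(C^G),m)$ a twisted $A_\infty$ algebra and $\lozenge$ obtained in this way from an antisymmetric, non-degenerate pairing which induces a perfect pairing on $H=H(C,m_{1,\mathbf 0})$ (i.e. $H\to\mathbf{Mod}_R(H,R[-p,q])$ is an isomorphism), such that $m^*\lozenge:=\lozenge\circ m=0$; one then says $m$ is cyclic with respect to the pairing. A cyclic morphism $f:(\mathcal{B},m,\lozenge)\to(\mathcal{B}',m',\lozenge')$ is a twisted $A_\infty$ morphism with $f^*\lozenge':=\lozenge'\circ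 f=\lozenge$. Units. $\mathbf e\in C^{0,0}$ is a (strict) unit for $m$ if $m_{2,\mathbf 0}(\mathbf e,x)=(-1)^{\mathrm{cd}\,x}m_{2,\mathbf 0}(x,\mathbf e)=x$ and $m_{k,\beta}(\cdots,\mathbf e,\cdots)=0$ for all $(k,\beta)\ne(2,\mathbf 0)$. If $\mathbf e\in C^{0,0}\subset C^G\subset\mathcal{B}$ is a unit for $(\mathcal{B},m)$ and $\mathbf e'\in C'^{0,0}\subset\mathcal{B}'$ is a unit for $(\mathcal{B}',m')$, a morphism $f:(\mathcal{B},m)\to(\mathcal{B}',m')$ is unital if $f\mathbf e=\mathbf e'$.
   Formalization: ''Unital'' (fe = e', false for I with curvature) is read as π₁fe = e', with fe = e' in B' when π₁f(1) = 0; the induced pairing on HC is transported by y ↦ [I y], since a retraction need not satisfy [I y] = y; ''E(G) discrete'' means no accumulation point in the reals. *)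

(* Defs.v *)
From HB Require Import structures.
From mathcomp Require Import all_boot all_order all_algebra ring_quotient.
From mathcomp Require Import all_classical all_reals.

Set Implicit Arguments.
Unset Strict Implicit.
Unset Printing Implicit Defensive.

Import Order.TTheory GRing.Theory Num.Theory.

Local Open Scope quotient_scope.
Local Open Scope classical_set_scope.
Local Open Scope ring_scope.

(* A degree is a pair (cd, ls). *)
Notation deg := (int * 'Z_2)%type (only parsing).

Definition oddz (n : int) : bool := odd `|n|%N.

(* A grading is given by its family of homogeneous projections; the piece of
   degree i is the set of fixed points of the i-th projection. *)
Record gring (K : realType) := GRingPack {
  gr_alg :> comAlgType K;
  rproj : deg -> {linear gr_alg -> gr_alg};
  rproj_proj : forall i j a,
    rproj i (rproj j a) = if i == j then rproj j a else 0;
  rproj_fin : forall a, finite_set [set i | rproj i a != 0];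
  rproj_sum : forall a, a = \sum_(i \in [set: deg]) rproj i a;
  rproj1 : rproj 0 1 = 1;
  rprojM : forall i j a b, rproj i a = a -> rproj j b = b ->
    rproj (i + j) (a * b) = a * b;
  rproj_even : forall i a, rproj i a != 0 -> ~~ oddz i.1 /\ i.2 = 0 }.

Definition homogR (K : realType) (R : gring K) (i : deg) (a : R) : Prop :=
  rproj R i a = a.

Record gmod (K : realType) (R : gring K) := GMod {
  gm_mod :> lmodType R;
  gproj : deg -> {additive gm_mod -> gm_mod};
  gproj_proj : forall i j x,
    gproj i (gproj j x) = if i == j then gproj j x else 0;
  gproj_fin : forall x, finite_set [set i | gproj i x != 0];
  gproj_sum : forall x, x = \sum_(i \in [set: deg]) gproj i x;
  gprojZ : forall i j a x, rproj R i a = a -> gproj j x = x ->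
    gproj (i + j) (a *: x) = a *: x }.

Definition homog (K : realType) (R : gring K) (C : gmod R) (i : deg) (x : C) :
  Prop := gproj C i x = x.

(* x |-> (-1)^(s i) x on the piece of degree i. *)
Definition sgop (K : realType) (R : gring K) (C : gmod R) (s : deg -> bool)
    (x : C) : C :=
  \sum_(i \in [set: deg]) (-1) ^+ s i *: gproj C i x.

(* The signs (-1)^(cd x), (-1)^(cd x - 1) and (-1)^(cd x + ls x + 1). *)
Definition cdsgn (K : realType) (R : gring K) (C : gmod R) : C -> C :=
  sgop (fun i => oddz i.1).
Definition shsgn (K : realType) (R : gring K) (C : gmod R) : C -> C :=
  sgop (fun i => ~~ oddz i.1).
Definition parsgn (K : realType) (R : gring K) (C : gmod R) : C -> C :=
  sgop (fun i => oddz i.1 (+) (i.2 != 0) (+) true).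

(* h : C -> C'[k] preserves degrees. *)
Definition has_deg (K : realType) (R : gring K) (C C' : gmod R) (k : deg)
    (h : C -> C') : Prop :=
  forall i x, homog i x -> homog (i + k) (h x).

Record dgmod (K : realType) (R : gring K) := DGMod {
  dg_mod :> gmod R;
  dg_d : {linear dg_mod -> dg_mod};
  dg_deg : has_deg ((1, 0) : deg) dg_d;
  dg_sq : forall x, dg_d (dg_d x) = 0 }.

Definition dprime (K : realType) (R : gring K) (C : dgmod R) (x : C) : C :=
  dg_d C (cdsgn x).

Section Homology.
Variables (R : nzRingType) (C : lmodType R) (d : {linear C -> C}).

Definition cyc_pred : {pred C} := fun x => d x == 0.

Lemma cyc_pred_closed : submod_closed cyc_pred.
Proof.
split=> [|a x y]; rewrite /cyc_pred !unfold_in ?linear0 //.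
by move=> /eqP dx /eqP dy; rewrite linearP dx dy scaler0 addr0.
Qed.
HB.instance Definition _ := GRing.isSubmodClosed.Build R C cyc_pred
  cyc_pred_closed.

Record cycles := Cycle { cyc_val : C; _ : cyc_val \in cyc_pred }.
HB.instance Definition _ := [isSub for cyc_val].
HB.instance Definition _ := [Choice of cycles by <:].
HB.instance Definition _ := [SubChoice_isSubLmodule of cycles by <:].

(* For d not known to square to zero this is the set of cycles in im d. *)
Definition bnd_pred : {pred cycles} :=
  fun z => `[< exists y, cyc_val z = d y >].

Lemma bnd_pred_closed : zmod_closed bnd_pred.
Proof.
split=> [|x y]; rewrite /bnd_pred !unfold_in.
  by apply/asboolP; exists 0; rewrite linear0.
move=> /asboolP[u xu] /asboolP[v yv]; apply/asboolP; exists (u - v).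
by rewrite linearB -xu -yv.
Qed.
HB.instance Definition _ := GRing.isZmodClosed.Build cycles bnd_pred
  bnd_pred_closed.

Definition homology := {ideal_quot bnd_pred}.
HB.instance Definition _ := GRing.Zmodule.on homology.
HB.instance Definition _ := EqQuotient.on homology.

Definition hcl (z : cycles) : homology := \pi_homology z.

Lemma hcl_repr a : hcl (repr a) = a.
Proof. exact: reprK. Qed.

Lemma hclB x y : hcl (x - y) = hcl x - hcl y.
Proof. exact: raddfB. Qed.

Lemma hclD x y : hcl (x + y) = hcl x + hcl y.
Proof. exact: raddfD. Qed.

Lemma hcl_eq x y : hcl x = hcl y <-> exists u, cyc_val x - cyc_val y = d u.
Proof.
split=> [/eqP|[u xyu]].
  rewrite /hcl -Quotient.idealrBE => /asboolP[u].
  by move=> xyu; exists u; rewrite -xyu.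
by apply/eqP; rewrite /hcl -Quotient.idealrBE; apply/asboolP; exists u.
Qed.

Definition hscale (a : R) (x : homology) : homology := hcl (a *: repr x).

Lemma hscale_cl a z : hscale a (hcl z) = hcl (a *: z).
Proof.
have /hcl_eq[u zu] : hcl (repr (hcl z)) = hcl z by rewrite hcl_repr.
apply/hcl_eq; exists (a *: u).
by rewrite [RHS]linearZ -zu [RHS]scalerBr.
Qed.

Lemma hscaleA a b x : hscale a (hscale b x) = hscale (a * b) x.
Proof. by rewrite -(hcl_repr x) !hscale_cl scalerA. Qed.
Lemma hscale1 : left_id 1 hscale.
Proof. by move=> x; rewrite -(hcl_repr x) !hscale_cl scale1r. Qed.
Lemma hscaleDr : right_distributive hscale +%R.
Proof.
move=> a x y; rewrite -(hcl_repr x) -(hcl_repr y) -hclD !hscale_cl.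
by rewrite scalerDr hclD.
Qed.
Lemma hscaleDl x : {morph hscale^~ x : a b / a + b}.
Proof.
by move=> a b; rewrite -(hcl_repr x) !hscale_cl scalerDl hclD.
Qed.
HB.instance Definition _ := GRing.Zmodule_isLmodule.Build R homology
  hscaleA hscale1 hscaleDr hscaleDl.

(* The class of x if x is a cycle, and 0 otherwise. *)
Definition hclass (x : C) : homology := oapp hcl 0 (insub x).

(* The pairing on homology, computed on representatives; it is independent of
   them as soon as d is skew-adjoint for P. *)
Definition hpair (P : C -> C -> R) (a b : homology) : R :=
  P (cyc_val (repr a)) (cyc_val (repr b)).
End Homology.

Section GradedHomology.
Variables (K : realType) (R : gring K) (C : dgmod R).
Local Notation d := (dg_d C).

Lemma fsum_additive (I : choiceType) (U V : zmodType) (f : {additive U -> V})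
    (A : set I) (F : I -> U) : finite_set A ->
  f (\sum_(i \in A) F i) = \sum_(i \in A) f (F i).
Proof. by move=> Af; rewrite !fsbig_finite //= raddf_sum. Qed.

Lemma gproj_supp (V : gmod R) (x : V) (A : set deg) :
  [set i | gproj V i x != 0] `<=` A -> finite_set A ->
  x = \sum_(i \in A) gproj V i x.
Proof.
move=> xA Af; rewrite {1}(gproj_sum x); apply/esym/fsbig_widen => // i [_ Ai].
by apply: contrapT => /= /eqP xi; apply: Ai; exact: xA.
Qed.

Lemma gproj_id (V : gmod R) (x : V) i : gproj V i (gproj V i x) = gproj V i x.
Proof. by rewrite gproj_proj eqxx. Qed.

Lemma gproj_d i x : d (gproj C i x) = gproj C (i + (1, 0)) (d x).
Proof.
have dg j : gproj C (j + (1, 0)) (d (gproj C j x)) = d (gproj C j x).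
  by apply: (@dg_deg _ _ C j (gproj C j x)); rewrite /homog gproj_id.
set A := [set j | gproj C j x != 0] `|` [set i].
have Af : finite_set A.
  by rewrite /A finite_setU; split; [exact: gproj_fin | exact: finite_set1].
rewrite {2}(@gproj_supp C x A) //; last by move=> j; left.
rewrite !fsum_additive // (fsbigD1 i) //=; last by right.
rewrite dg fsbig1 ?addr0 // => j [_ /= /eqP ji].
rewrite -dg gproj_proj (inj_eq (addIr _)) eq_sym.
by rewrite (negbTE ji).
Qed.

Lemma cproj_subproof i (z : cycles d) : gproj C i (cyc_val z) \in cyc_pred d.
Proof.
case: z => z /= dz; move: dz; rewrite /cyc_pred !unfold_in => /eqP dz.
by rewrite gproj_d dz raddf0.
Qed.

Definition cproj i (z : cycles d) : cycles d := Cycle (cproj_subproof i z).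

Definition hproj (i : deg) (a : homology d) : homology d :=
  hcl (cproj i (repr a)).

Lemma hproj_cl i z : hproj i (hcl z) = hcl (cproj i z).
Proof.
have /hcl_eq[u zu] : hcl (repr (hcl z)) = hcl z by rewrite hcl_repr.
apply/hcl_eq; exists (gproj C (i - (1, 0)) u).
by rewrite /= -raddfB zu gproj_d subrK.
Qed.

Lemma hproj_zmod i : zmod_morphism (hproj i).
Proof.
move=> a b; rewrite -(hcl_repr a) -(hcl_repr b) -hclB !hproj_cl -hclB.
by congr hcl; apply: val_inj; rewrite /= raddfB.
Qed.
HB.instance Definition _ i :=
  GRing.isZmodMorphism.Build (homology d) (homology d) (hproj i)
    (hproj_zmod i).

Lemma hproj_proj i j a :
  hproj i (hproj j a) = if i == j then hproj j a else 0.
Proof.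
rewrite -(hcl_repr a) !hproj_cl.
have -> : cproj i (cproj j (repr a)) =
    if i == j then cproj j (repr a) else 0.
  by apply: val_inj; rewrite /= gproj_proj; case: ifP.
by case: ifP => // _; rewrite -(subrr 0) hclB subrr.
Qed.

Lemma hcl_zmod : zmod_morphism (@hcl _ _ d). Proof. exact: hclB. Qed.
HB.instance Definition _ :=
  GRing.isZmodMorphism.Build (cycles d) (homology d) (@hcl _ _ d) hcl_zmod.

Lemma hproj_sub a :
  [set i | hproj i a != 0] `<=` [set i | gproj C i (cyc_val (repr a)) != 0].
Proof.
move=> i /=; apply: contraNN => /eqP ai; apply/eqP.
rewrite /hproj (_ : cproj i _ = 0) ?raddf0 //.
exact: val_inj.
Qed.

Lemma hproj_fin a : finite_set [set i | hproj i a != 0].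
Proof. exact: sub_finite_set (@hproj_sub a) (gproj_fin _). Qed.

Lemma hproj_sum a : a = \sum_(i \in [set: deg]) hproj i a.
Proof.
set A := [set i | gproj C i (cyc_val (repr a)) != 0].
have Af : finite_set A by exact: gproj_fin.
rewrite -(@fsbig_widen _ _ _ _ A) //; last first.
  by move=> i [_ Ai]; apply: contrapT => ai; apply/Ai/hproj_sub/eqP.
rewrite -fsum_additive // -{1}(hcl_repr a); congr hcl; apply: val_inj.
by rewrite fsum_additive //=; exact: gproj_supp.
Qed.

Lemma hprojZ i j r a : rproj R i r = r -> hproj j a = a ->
  hproj (i + j) (r *: a) = r *: a.
Proof.
move=> ri <-; rewrite /hproj -[r *: _]/(hscale _ _) hscale_cl.
rewrite -/(hproj _ _) hproj_cl; congr hcl; apply: val_inj => /=.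
by rewrite gprojZ // gproj_id.
Qed.

Definition HC : gmod R :=
  @GMod K R (homology d) (fun i => hproj i) hproj_proj hproj_fin hproj_sum
    hprojZ.
End GradedHomology.

(* The R-module generated by W and universal for a class lin of maps from W to
   R-modules: formal sums, identified when all maps of the class agree on
   them. *)
Section Universal.
Variables (R : nzRingType) (W : choiceType).
Variable lin : forall M : lmodType R, (W -> M) -> Prop.

Definition fev (M : lmodType R) (f : W -> M) (u : seq (R * W)) : M :=
  \sum_(p <- u) p.1 *: f p.2.

Definition feq (u v : seq (R * W)) : bool :=
  `[< forall (M : lmodType R) (f : W -> M), lin f -> fev f u = fev f v >].

Lemma feq_equiv : equiv_class_of feq.
Proof.
split=> [u|u v|v u w]; first exact/asboolP.
  by apply/asboolP/asboolP => uv M f lf; rewrite uv.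
by move=> /asboolP uv /asboolP vw; apply/asboolP => M f lf; rewrite uv // vw.
Qed.
Canonical feq_rel := EquivRelPack feq_equiv.
Canonical feq_encModRel := defaultEncModRel feq.

Definition umod := {eq_quot feq}.
HB.instance Definition _ : EqQuotient _ feq umod := EqQuotient.on umod.
HB.instance Definition _ := Choice.on umod.

Definition ucl (u : seq (R * W)) : umod := \pi_umod u.

Definition uscaleseq (a : R) (u : seq (R * W)) := [seq (a * p.1, p.2) | p <- u].

Definition uadd (s t : umod) : umod := ucl (repr s ++ repr t).
Definition uscale (a : R) (s : umod) : umod := ucl (uscaleseq a (repr s)).

Lemma ucl_repr s : ucl (repr s) = s. Proof. exact: reprK. Qed.

Lemma ucl_eq u v : ucl u = ucl v <->
  forall (M : lmodType R) (f : W -> M), lin f -> fev f u = fev f v.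
Proof.
split=> [/eqP|uv]; first by rewrite eqmodE => /asboolP.
by apply/eqP; rewrite eqmodE; exact/asboolP.
Qed.

Lemma fev_cat (M : lmodType R) (f : W -> M) u v :
  fev f (u ++ v) = fev f u + fev f v.
Proof. by rewrite /fev big_cat. Qed.

Lemma fev_scale (M : lmodType R) (f : W -> M) a u :
  fev f (uscaleseq a u) = a *: fev f u.
Proof.
by rewrite /fev big_map scaler_sumr; apply: eq_bigr => p _; rewrite scalerA.
Qed.

Lemma fev_repr (M : lmodType R) (f : W -> M) u : lin f ->
  fev f (repr (ucl u)) = fev f u.
Proof. by have /ucl_eq := ucl_repr (ucl u); apply. Qed.

Lemma uadd_cl u v : uadd (ucl u) (ucl v) = ucl (u ++ v).
Proof. by apply/ucl_eq => M f lf; rewrite !fev_cat !fev_repr. Qed.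

Lemma uscale_cl a u : uscale a (ucl u) = ucl (uscaleseq a u).
Proof. by apply/ucl_eq => M f lf; rewrite !fev_scale fev_repr. Qed.

Lemma uaddA : associative uadd.
Proof.
move=> s t r; rewrite -(ucl_repr s) -(ucl_repr t) -(ucl_repr r).
by rewrite !uadd_cl catA.
Qed.

Lemma uaddC : commutative uadd.
Proof.
move=> s t; rewrite -(ucl_repr s) -(ucl_repr t) !uadd_cl.
by apply/ucl_eq => M f lf; rewrite !fev_cat addrC.
Qed.

Lemma uadd0 : left_id (ucl [::]) uadd.
Proof. by move=> s; rewrite -(ucl_repr s) uadd_cl. Qed.

Lemma uaddN : left_inverse (ucl [::]) (uscale (-1)) uadd.
Proof.
move=> s; rewrite -(ucl_repr s) uscale_cl uadd_cl.
apply/ucl_eq => M f lf.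
by rewrite fev_cat fev_scale scaleN1r addNr /fev big_nil.
Qed.
HB.instance Definition _ := GRing.isZmodule.Build umod uaddA uaddC uadd0 uaddN.

Lemma uclD u v : ucl (u ++ v) = ucl u + ucl v.
Proof. by rewrite -uadd_cl. Qed.

Lemma uscaleA a b s : uscale a (uscale b s) = uscale (a * b) s.
Proof.
rewrite -(ucl_repr s) !uscale_cl; apply/ucl_eq => M f lf.
by rewrite !fev_scale scalerA.
Qed.
Lemma uscale1 : left_id 1 uscale.
Proof.
move=> s; rewrite -(ucl_repr s) uscale_cl; apply/ucl_eq => M f lf.
by rewrite fev_scale scale1r.
Qed.
Lemma uscaleDr : right_distributive uscale +%R.
Proof.
move=> a s t; rewrite -(ucl_repr s) -(ucl_repr t) -uclD !uscale_cl -uclD.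
by apply/ucl_eq => M f lf; rewrite fev_cat !fev_scale !fev_cat scalerDr.
Qed.
Lemma uscaleDl s : {morph uscale^~ s : a b / a + b}.
Proof.
move=> a b; rewrite -(ucl_repr s) !uscale_cl -uclD.
by apply/ucl_eq => M f lf; rewrite fev_cat !fev_scale scalerDl.
Qed.
HB.instance Definition _ := GRing.Zmodule_isLmodule.Build R umod
  uscaleA uscale1 uscaleDr uscaleDl.

Definition ugen (w : W) : umod := ucl [:: (1, w)].

(* The linear map extending f, for f in the class. *)
Definition ulift (M : lmodType R) (f : W -> M) (t : umod) : M :=
  fev f (repr t).

Lemma ulift_linear (M : lmodType R) (f : W -> M) : lin f -> linear (ulift f).
Proof.
move=> lf a s t; rewrite /ulift -{1}(ucl_repr s) -{1}(ucl_repr t).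
rewrite -[a *: _]/(uscale a _) uscale_cl -uclD fev_repr //.
by rewrite fev_cat fev_scale.
Qed.

Lemma ulift_gen (M : lmodType R) (f : W -> M) w : lin f -> ulift f (ugen w) = f w.
Proof. by move=> lf; rewrite /ulift fev_repr // /fev big_seq1 scale1r. Qed.
End Universal.

Section Tensors.
Variable R : comNzRingType.

Definition multilinear (C M : lmodType R) (f : seq C -> M) : Prop :=
  forall s1 s2 a x y,
    f (s1 ++ (a *: x + y) :: s2) = a *: f (s1 ++ x :: s2) + f (s1 ++ y :: s2).

(* The direct sum over k of the tensor powers of C over R; word [:: x1; ..; xk]
   is x1 (x) .. (x) xk. *)
Definition tensalg (C : lmodType R) : lmodType R :=
  umod (fun M : lmodType R => @multilinear C M).
Definition word (C : lmodType R) (s : seq C) : tensalg C := ugen _ s.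

Lemma word_multilinear (C : lmodType R) : multilinear (@word C).
Proof.
move=> s1 s2 a x y.
rewrite -[X in _ = X + _]/(uscale a (word (s1 ++ x :: s2))) /word /ugen uscale_cl -uclD.
apply/ucl_eq => M f lf.
by rewrite fev_cat fev_scale /fev !big_seq1 /= !scale1r.
Qed.

Definition bilinear2 (U V M : lmodType R) (f : U * V -> M) : Prop :=
  (forall a x x' y, f (a *: x + x', y) = a *: f (x, y) + f (x', y)) /\
  (forall a x y y', f (x, a *: y + y') = a *: f (x, y) + f (x, y')).

Definition tens (U V : lmodType R) : lmodType R :=
  umod (fun M : lmodType R => @bilinear2 U V M).
Definition ten (U V : lmodType R) (x : U) (y : V) : tens U V := ugen _ (x, y).

Definition tlift (C M : lmodType R) (f : seq C -> M) : tensalg C -> M :=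
  @ulift _ _ (fun M : lmodType R => @multilinear C M) M f.
Definition blift (U V M : lmodType R) (f : U * V -> M) : tens U V -> M :=
  @ulift _ _ (fun M : lmodType R => @bilinear2 U V M) M f.

Definition tmap (C C' : lmodType R) (f : C -> C') : tensalg C -> tensalg C' :=
  tlift (fun s => word [seq f x | x <- s]).

(* Projections to the tensor powers of exponents 0 and 1. *)
Definition pr0 (C : lmodType R) : tensalg C -> R^o :=
  tlift (fun s : seq C => if s is [::] then 1 : R^o else 0).
Definition len1 (C : lmodType R) (s : seq C) : C :=
  if s is [:: x] then x else 0.
Definition pr1 (C : lmodType R) : tensalg C -> C := tlift (@len1 C).

Lemma len1_multilinear (C : lmodType R) : multilinear (@len1 C).
Proof.
by move=> [|z [|z' s1]] [|y s2] a x x' //=; rewrite ?scaler0 ?addr0.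
Qed.
Lemma pr1_linear (C : lmodType R) : linear (@pr1 C).
Proof. exact/ulift_linear/len1_multilinear. Qed.
HB.instance Definition _ (C : lmodType R) :=
  GRing.isLinear.Build R (tensalg C) C _ (@pr1 C) (@pr1_linear C).

Definition deconc (C : lmodType R) : tensalg C -> tens (tensalg C) (tensalg C) :=
  tlift (fun s : seq C =>
    \sum_(i < (size s).+1) ten (word (take i s)) (word (drop i s))).

(* x1 .. xk |-> sum_i f x1 .. f x(i-1) (h xi) (g x(i+1)) .. (g xk). *)
Definition insert (C : lmodType R) (f h g : C -> C) : tensalg C -> tensalg C :=
  tlift (fun s : seq C => \sum_(i < size s)
    word ([seq f x | x <- take i s] ++
          h (nth 0 s i) :: [seq g x | x <- drop i.+1 s])).
End Tensors.

Record dmonoid (K : realType) := DMonoid {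
  dm_set : {pred (K * int)%type};
  dm_closed : addr_closed dm_set;
  dm_pos : forall b, b \in dm_set -> 0 <= b.1;
  (* The set of energies has no accumulation point in the real line. *)
  dm_discrete : forall l : K, exists2 e : K, 0 < e &
    forall b, b \in dm_set -> `|b.1 - l| < e -> b.1 = l;
  dm_finite : forall l : K, finite_set [set b | b \in dm_set /\ b.1 = l] }.

Section MonoidElements.
Variables (K : realType) (G : dmonoid K).
Record gelt := GElt { gval : K * int; _ : gval \in dm_set G }.
HB.instance Definition _ := [isSub for gval].
HB.instance Definition _ := [Choice of gelt by <:].
HB.instance Definition _ := 
  GRing.SubChoice_isSubNmodule.Build _ _ gelt (dm_closed G).
Definition en (b : gelt) : K := (gval b).1.
Definition mu (b : gelt) : int := (gval b).2.
End MonoidElements.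

(* For an R-module M, M^G is the module of families (x_b) indexed by G; x
   stands for the possibly infinite sum of the terms x_b eps^(mu b) T^(E b).
   Since every energy interval contains finitely many elements of G, this is
   the completed tensor product of the Novikov ring and M, and
   - R^G is the Novikov ring,
   - C^G is its completed tensor product with C,
   - the bar coalgebra of C^G is (tensalg C)^G: moving powers of eps to the
     right identifies the k-th tensor power over the Novikov ring of C^G[1]
     with (C^{(x) k})^G, and sequences (x_k) with x_k in F^{E_k}, E_k -> oo,
     are those with finitely many non-zero components at each b; homogeneity
     is the predicate homogB below,
   - the completed tensor product over the Novikov ring of the bar coalgebra
     with itself is (tens (tensalg C) (tensalg C))^G.
   As R is concentrated in even degrees, the shift [1] does not affect the
   R-module structure; it only enters degrees and signs. *)
Section Families.
Variables (K : realType) (R : comNzRingType) (G : dmonoid K).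

Definition fam (M : lmodType R) : lmodType R := gelt G -> M.

Definition mono (M : lmodType R) (b : gelt G) (w : M) : fam M :=
  fun g => if g == b then w else 0.

Definition fil (M : lmodType R) (e : K) (x : fam M) : Prop :=
  forall b, en b < e -> x b = 0.
Definition fil_pos (M : lmodType R) (x : fam M) : Prop :=
  exists2 e : K, 0 < e & fil e x.

(* Extension of F : M -> N^G to M^G by linearity and continuity for the right
   action of the Novikov ring; the sum is finite. *)
Definition extr (M N : lmodType R) (F : M -> fam N) (z : fam M) : fam N :=
  fun g => \sum_(q \in [set q : gelt G * gelt G | q.1 + q.2 = g])
    F (z q.2) q.1.

(* The same for F : M -> N, which needs no convolution. *)
Definition ext (M N : lmodType R) (F : M -> N) (z : fam M) : fam N :=
  fun g => F (z g).
End Families.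

Section Bar.
Variables (K : realType) (R : gring K) (G : dmonoid K).

Definition bar (C : gmod R) : lmodType R := fam G (tensalg C).

Definition barw (C : gmod R) (s : seq C) : bar C := mono 0 (word s).

(* Degrees in the tensor algebra of C[1]. *)
Fixpoint homogw (C : gmod R) (i : deg) (s : seq C) : Prop :=
  if s is x :: s' then
    exists2 j : deg, homog j x & homogw (i - (j - (1, 0))) s'
  else i = 0.
Definition homogT (C : gmod R) (i : deg) (t : tensalg C) : Prop :=
  exists2 u : seq (R * seq C),
    (forall p, p \in u -> exists2 j, homogR j p.1 & homogw (i - j) p.2) &
    t = \sum_(p <- u) p.1 *: word p.2.
Definition homogB (C : gmod R) (i : deg) (x : bar C) : Prop :=
  forall b, homogT (i - (mu b, 0)) (x b).

(* (-1)^(cd x) and the sign produced by moving eps across x. *)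
Definition tcdsgn (C : gmod R) : tensalg C -> tensalg C := tmap (@shsgn _ _ C).
Definition tparsgn (C : gmod R) : tensalg C -> tensalg C :=
  tmap (@parsgn _ _ C).
Definition epssgn (M : lmodType R) (s : M -> M) (n : int) (x : M) : M :=
  if oddz n then s x else x.

(* The right and left actions of eps^(mu b) T^(E b). *)
Definition ract (C : gmod R) (b : gelt G) (x : bar C) : bar C :=
  fun g => \sum_(a \in [set a | a + b = g]) x a.
Definition lact (C : gmod R) (b : gelt G) (x : bar C) : bar C :=
  fun g => \sum_(a \in [set a | b + a = g])
    epssgn (@tparsgn C) (mu b) (x a).

(* Morphisms of bimodules h : B(C^G)[-k] -> B(C'^G). Linearity and continuity
   reduce compatibility with the Novikov ring to monomials. The sign on the
   left is the one for which id (x) h, (id (x) h)(x (x) y) = (-1)^(k cd x) x (x)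
   h y, is well defined on the tensor product over the Novikov ring. *)
Record bimod_map (C C' : gmod R) (k : nat) (h : bar C -> bar C') : Prop :=
  BimodMap {
    bm_fil : forall e x, fil e x -> fil e (h x);
    bm_deg : forall i x, homogB i x -> homogB (i + (k%:Z, 0)) (h x);
    bm_ract : forall b x, h (ract b x) = ract b (h x);
    bm_lact : forall b x,
      h (lact b x) = (-1) ^+ (k * oddz (mu b)) *: lact b (h x) }.

(* x (x) y over the Novikov ring. *)
Definition tenB (C : gmod R) (x y : bar C) : fam G (tens (tensalg C) (tensalg C))
  := fun g => \sum_(q \in [set q : gelt G * gelt G | q.1 + q.2 = g])
       ten (x q.1) (epssgn (@tparsgn C) (mu q.1) (y q.2)).

Definition deltaB (C : gmod R) :
    bar C -> fam G (tens (tensalg C) (tensalg C)) := ext (@deconc R C).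
Definition etaB (C : gmod R) : bar C -> fam G R^o := ext (@pr0 R C).
Definition pi1B (C : gmod R) : bar C -> fam G C := ext (@pr1 R C).

(* The bimodule map sending the elements x (x) y, for x and y in the tensor
   algebra of C, to F x y. *)
Definition on_tens (C : gmod R) (M : lmodType R)
    (F : tensalg C -> tensalg C -> fam G M) :
    fam G (tens (tensalg C) (tensalg C)) -> fam G M :=
  extr (blift (fun p => F p.1 p.2)).

Definition coderivation (C : gmod R) (k : nat) (h : bar C -> bar C) : Prop :=
  [/\ bimod_map k h,
      forall x, etaB (h x) = 0 &
      forall x, deltaB (h x) =
        on_tens (fun u v => tenB (h (mono 0 u)) (mono 0 v) +
                   tenB (mono 0 (iter k (@tcdsgn C) u)) (h (mono 0 v)))
          (deltaB x)].

Definition coalg_mor (C C' : gmod R) (f : bar C -> bar C') : Prop :=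
  [/\ bimod_map 0 f,
      forall x, etaB (f x) = etaB x &
      forall x, deltaB (f x) =
        on_tens (fun u v => tenB (f (mono 0 u)) (f (mono 0 v))) (deltaB x)].

Definition tame (C C' : gmod R) (h : bar C -> bar C') : Prop :=
  fil_pos (pi1B (h (barw [::]))).

Definition twisted_Ainf (C : gmod R) (m : {linear bar C -> bar C}) : Prop :=
  [/\ coderivation 1 m, forall x, m (m x) = 0 & tame m].

Definition twisted_mor (C C' : gmod R) (m : {linear bar C -> bar C})
    (m' : {linear bar C' -> bar C'}) (f : {linear bar C -> bar C'}) : Prop :=
  [/\ coalg_mor f, tame f & forall x, f (m x) = m' (f x)].

(* m_{k,b}(x1, .., xk) for s = [:: x1; ..; xk]. The sign turns
   c eps^(mu b) T^(E b) into eps^(mu b) T^(E b) c. *)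
Definition comp (C : gmod R) (m : bar C -> bar C) (s : seq C) (b : gelt G) : C :=
  epssgn (@parsgn _ _ C) (mu b) (pi1B (m (barw s)) b).

Definition comp10 (C : gmod R) (m : bar C -> bar C) (x : C) : C :=
  comp m [:: x] 0.

Lemma mono_word1_linear (C : gmod R) : linear (fun x : C => barw [:: x]).
Proof.
move=> a x y; apply/funext => g; rewrite /barw /mono.
rewrite -[RHS]/(a *: (if g == 0 then word [:: x] else 0) +
  (if g == 0 then word [:: y] else 0)).
case: eqP => _; last by rewrite scaler0 addr0.
exact: (word_multilinear [::] [::]).
Qed.

Lemma comp10_linear (C : gmod R) (m : {linear bar C -> bar C}) :
  linear (comp10 m).
Proof.
move=> a x y; rewrite /comp10 /comp /epssgn /= /pi1B /ext mono_word1_linear.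
by rewrite linearP -[X in pr1 X]/(a *: _ + _) linearP.
Qed.
HB.instance Definition _ (C : gmod R) (m : {linear bar C -> bar C}) :=
  GRing.isLinear.Build R C C _ (comp10 m) (comp10_linear m).

Definition is_perturbation (C : dgmod R) (m : {linear bar C -> bar C}) : Prop :=
  forall x : C, comp10 m x = dprime x.

Definition is_pairing (C : gmod R) (p : int) (q : 'Z_2) (P : C -> C -> R) :
    Prop :=
  [/\ forall a x x' y, P (a *: x + x') y = a * P x y + P x' y,
      forall a x y y', P x (a *: y + y') = a * P x y + P x y' &
      forall i j x y, homog i x -> homog j y ->
        homogR (i + j + (- p, q)) (P x y)].

Definition antisym (C : gmod R) (P : C -> C -> R) : Prop :=
  forall (i j : deg) x y, homog i x -> homog j y ->
    P x y = (-1) ^+ (1 + oddz ((i.1 - 1) * (j.1 - 1))) * P y x.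

Definition nondeg (C : gmod R) (P : C -> C -> R) : Prop :=
  forall x, x <> 0 -> exists y, P x y <> 0.

Definition homogH (C : gmod R) (d : {linear C -> C}) (i : deg)
    (a : homology d) : Prop :=
  exists2 z : cycles d, homog i (cyc_val z) & a = hcl z.

(* The map H -> Mod_R(H, R[-p, q]) into the graded internal Hom module, for
   H = H(C, d), is an isomorphism; in each degree k the target consists of the
   R-linear maps which raise degrees by k + (- p, q). *)
Definition perfect (C : gmod R) (d : {linear C -> C}) (p : int) (q : 'Z_2)
    (P : C -> C -> R) : Prop :=
  (forall a : homology d, (forall b, hpair P a b = 0) -> a = 0) /\
  (forall (k : deg) (phi : {linear homology d -> R^o}),
     (forall i b, homogH i b -> homogR (i + k + (- p, q)) (phi b : R)) ->
     exists2 a, homogH k a & forall b, phi b = hpair P a b).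

Definition lozenge (C : gmod R) (P : C -> C -> R) : bar C -> fam G R^o :=
  ext (tlift (fun s : seq C => if s is [:: x; y] then P x y : R^o else 0)).

Definition cyclic_Ainf (C : gmod R) (p : int) (q : 'Z_2)
    (m : {linear bar C -> bar C}) (P : C -> C -> R) : Prop :=
  [/\ twisted_Ainf m,
      is_pairing p q P,
      antisym P /\ nondeg P,
      perfect (comp10 m) p q P &
      forall x, lozenge P (m x) = 0].

Definition cyclic_mor (C C' : gmod R) (m : {linear bar C -> bar C})
    (P : C -> C -> R) (m' : {linear bar C' -> bar C'}) (P' : C' -> C' -> R)
    (f : {linear bar C -> bar C'}) : Prop :=
  twisted_mor m m' f /\ forall x, lozenge P' (f x) = lozenge P x.

Definition is_unit (C : gmod R) (m : {linear bar C -> bar C}) (e : C) : Prop :=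
  [/\ homog 0 e,
      forall x, comp m [:: e; x] 0 = x,
      forall x, comp m [:: cdsgn x; e] 0 = x &
      forall s1 s2 b, ~ ((size s1 + size s2 = 1)%N /\ b = 0) ->
        comp m (s1 ++ e :: s2) b = 0].

(* f e = e', read in the cogenerators C'^G of the bar coalgebra. If f(1) has a
   component f_0 in C'^G, then f e is the sum of the f_0^i (x) e' (x) f_0^j;
   when it has none, the equation holds in the bar coalgebra itself. *)
Definition unital_mor (C C' : gmod R) (m : {linear bar C -> bar C})
    (m' : {linear bar C' -> bar C'}) (f : {linear bar C -> bar C'})
    (e : C) (e' : C') : Prop :=
  [/\ twisted_mor m m' f,
      pi1B (f (barw [:: e])) = mono 0 e' &
      pi1B (f (barw [::])) = 0 -> f (barw [:: e]) = barw [:: e']].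

(* The sum of the F a over a >= 0 converges pointwise to f. *)
Definition psum (C C' : gmod R) (F : nat -> bar C -> bar C')
    (f : bar C -> bar C') : Prop :=
  forall x e, exists N : nat, forall n, (N <= n)%N ->
    fil e (f x - \sum_(a < n) F a x).
End Bar.

Record retraction (K : realType) (R : gring K) (C : dgmod R) := Retraction {
  rPi : {linear C -> HC C};
  rI : {linear HC C -> C};
  rh : {linear C -> C};
  rPi_deg : has_deg (0 : deg) rPi;
  rI_deg : has_deg (0 : deg) rI;
  rh_deg : has_deg ((-1, 0) : deg) rh;
  rPid : forall x, rPi (dprime x) = 0;
  rdI : forall y, dprime (rI y) = 0;
  rPiI : forall y, rPi (rI y) = y;
  rdh : forall x, dprime (rh x) + rh (dprime x) = rI (rPi x) - x;
  rhh : forall x, rh (rh x) = 0;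
  rPih : forall x, rPi (rh x) = 0;
  rhI : forall y, rh (rI y) = 0 }.

Section Perturbation.
Variables (K : realType) (R : gring K) (G : dmonoid K) (C : dgmod R).
Variable r : retraction C.

Definition cyclic_retraction (P : C -> C -> R) : Prop :=
  forall x y, P (rh r x) y + P (cdsgn x) (rh r y) = 0.

Definition retraction_unit (e : C) : Prop := homog 0 e /\ rh r e = 0.

Definition unital_retraction : Prop := exists e, retraction_unit e.

(* The retraction conditions make y |-> [I y] an isomorphism of HC with
   the homology of C, without forcing it to be the identity; the pairing induced
   on HC is the pairing of the homology classes [I y]. It is the pairing
   [u], [v] |-> P u v when I y represents y. *)
Definition induced_pairing (P : C -> C -> R) : HC C -> HC C -> R :=
  fun y y' => hpair P (hclass (dg_d C) (rI r y)) (hclass (dg_d C) (rI r y')).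

(* The formulas for the extensions to words in C^G, with signs involving the
   powers of eps, amount to extending the formulas for words in C linearly for
   the right action of the Novikov ring. *)
Definition hatPi : bar G C -> bar G (HC C) := ext (tmap (rPi r)).
Definition hatI : bar G (HC C) -> bar G C := ext (tmap (rI r)).
Definition hath : bar G C -> bar G C :=
  ext (insert (@shsgn _ _ C) (rh r) (fun x => rI r (rPi r x))).

(* The coderivation whose only component is m_{1,0}. *)
Definition hatm10 (m : {linear bar G C -> bar G C}) : bar G C -> bar G C :=
  ext (insert (@shsgn _ _ C) (comp10 m) id).
Definition partial (m : {linear bar G C -> bar G C}) (x : bar G C) : bar G C :=
  m x - hatm10 m x.

(* These conditions determine mcan, Pi and I. *)
Definition perturbation_formulas (m : {linear bar G C -> bar G C})
    (mcan : {linear bar G (HC C) -> bar G (HC C)})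
    (Pi : {linear bar G C -> bar G (HC C)})
    (I : {linear bar G (HC C) -> bar G C}) : Prop :=
  [/\ psum (fun a y =>
        hatPi (partial m (iter a (fun x => hath (partial m x)) (hatI y)))) mcan,
      psum (fun a x => hatPi (iter a (fun x => partial m (hath x)) x)) Pi &
      psum (fun a y => iter a (fun x => hath (partial m x)) (hatI y)) I].
End Perturbation.

(* Main.v *)
Require Import Defs.
From HB Require Import structures.
From mathcomp Require Import all_boot all_order all_algebra.
From mathcomp Require Import all_classical all_reals.
From mathcomp Require Import finmap zify lra.

(** Write m = d + dl, where d is the coderivation of the bar coalgebra of C whose
    only component is the differential of C. The maps hat-Pi, hat-I, hat-h of the
    perturbation formulas, called p, i, h below, contract the bar coalgebra of C
    with the differential d onto that of HC with zero differential
    (insert_contraction, insert_sq0), and the formulas are geometric series in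
    h dl and dl h. They converge because dl either shortens words, or raises the
    energy by at least the smallest positive energy c while making words longer
    by at most one letter: it lowers length - 2 energy / c by one, and h does
    not raise it (coder_lowers, lowers_topnil).

    A topologically nilpotent operator T has no nonzero fixed point, and every
    claim about the series reduces to this.
    - The difference X of m I and I mcan is killed by h and by p, whence
      X = h dl X (hplI_chain); dually for Pi (hplPi_chain).
    - With s the sign (-1)^cd on the bar coalgebra, both Delta I and (I (x) I) Delta solve
      Y = (i (x) i) Delta + (h (x) i p + s (x) h)(dl (x) 1 + s (x) dl) Y, because
      h I = 0 and p I = 1 (hplI_comor). For Pi one uses the equation
      Y = (p (x) p) Delta + Y dl h (hplPi_comor), and mcan = p dl I is then a
      coderivation because p I = 1 (hplm_coder).

    For the pairing, lozenge is the composite of Delta with the form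
    u (x) v |-> <u_1, v_1> on the parts of length one. Cyclicity of h and h hat-I = 0
    give lozenge h = form (h (x) 1) Delta = form (s (x) h) Delta. In
    (dl (x) 1 + s (x) dl)(I (x) I) Delta one factor of each term is of the form s I
    or I, killed by h, so that lozenge h dl I = 0 (lloz_h_dl_pert_I). Hence
    lozenge I = lozenge i is the induced lozenge, and
    lozenge mcan = lozenge I mcan = lozenge m I = 0.

    For units, let u e v be the concatenation of u, the letter e and v. In dl (u e v)
    the two ways to absorb e into a neighbour cancel, except at the ends:
    dl (u e v) = dl u e v - s u e dl v + eta(u) v - s u eta(v) (coder_unit). As
    h e = 0 and i p e = e, it follows that u, v |-> I u e I v solves the equation
    Y = i + h dl Y, that is I (u e' v) = I u e I v for e' = p e (hplI_sand), and
    then mcan satisfies the formula for dl with e' in place of e (hplm_sand), which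
    says that e' is a unit.

    All these maps are determined by their values on words of C, since they are
    continuous and linear for the right action of the Novikov ring; this is the
    notion lop. Compatibility with the left action forces their coefficients at
    odd powers of the formal variable to vanish (odd_coef0), so that tensor
    products can be taken without Koszul signs for that variable (lten). *)

Set Implicit Arguments.
Unset Strict Implicit.
Unset Printing Implicit Defensive.

Import Order.TTheory GRing.Theory Num.Theory.
Local Open Scope classical_set_scope.
Local Open Scope ring_scope.

(** * Discrete submonoids *)

Section Monoid.
Variables (K : realType) (G : dmonoid K).
Implicit Types a b g : gelt G.

Lemma gvalD a b : gval (a + b) = gval a + gval b.
Proof. by []. Qed.

Lemma enD a b : en (a + b) = en a + en b.
Proof. by []. Qed.

Lemma muD a b : mu (a + b) = mu a + mu b.
Proof. by []. Qed.

Lemma en0 : en (0 : gelt G) = 0. Proof. by []. Qed.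
Lemma mu0 : mu (0 : gelt G) = 0. Proof. by []. Qed.

Lemma gvalP a : gval a \in dm_set G. Proof. by case: a. Qed.

Lemma en_ge0 a : 0 <= en a.
Proof. exact: dm_pos (gvalP a). Qed.

Lemma gval_inj : injective (@gval K G).
Proof. exact: val_inj. Qed.

Lemma gaddIr b : injective (fun a => a + b).
Proof.
move=> a a' /(congr1 (@gval K G)); rewrite !gvalD => /addIr; exact: gval_inj.
Qed.

Lemma finite_en (l : K) : finite_set [set b : gelt G | en b = l].
Proof.
apply: (sub_finite_set _ (finite_preimage _ (dm_finite G l))).
  by move=> b /= bl; split; [exact: gvalP | exact: bl].
by move=> a b _ _; exact: gval_inj.
Qed.

(** The multiples of b all have energy zero, so that only finitely many of them
    are distinct; this forces mu b = 0. *)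
Lemma en_eq0 b : en b = 0 -> b = 0.
Proof.
move=> b0; apply: contrapT => bn0.
have inj : injective (fun n => b *+ n).
  move=> n n' /(congr1 (@mu K G)).
  have muMn k : mu (b *+ k) = mu b *+ k.
    by elim: k => [|k IH] //; rewrite !mulrS muD IH.
  rewrite !muMn; apply: mulrIn; apply/eqP => mb0; apply: bn0.
  by apply: gval_inj; rewrite [gval b]surjective_pairing -/(en b) -/(mu b) b0 mb0.
apply: infinite_nat.
rewrite (_ : setT = (fun n => b *+ n) @^-1` [set a : gelt G | en a = 0]).
  by apply: finite_preimage (finite_en 0) => n n' _ _; exact: inj.
rewrite eqEsubset; split=> // n _ /=; elim: n => [|n IH] //.
by rewrite mulrS enD b0 IH addr0.
Qed.

(** Bounded energies have no accumulation point, and each of them is attained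
    finitely often. *)
Lemma finite_below (e : K) : finite_set [set b : gelt G | en b < e].
Proof.
apply: contrapT => einf.
pose S := [set t : K | finite_set [set b : gelt G | en b < t]].
have S0 : S 0.
  by apply: (sub_finite_set _ (@finite_set0 (gelt G))) => b /=; rewrite ltNge en_ge0.
have Sub t : S t -> t <= e.
  move=> St; rewrite leNgt; apply/negP => et; apply: einf.
  by apply: (sub_finite_set _ St) => b /= /lt_trans; apply.
have supS : has_sup S by split; [exists 0 | exists e => t; exact: Sub].
have [d d0 dP] := dm_discrete G (sup S).
have [t St dt] := sup_adherent d0 supS.
have : S (sup S + d).
  have tfin : finite_set ([set b : gelt G | en b < t] `|`
      [set b : gelt G | en b = sup S]).
    by rewrite finite_setU; split; [exact: St | exact: finite_en].
  apply: (sub_finite_set _ tfin) => b /= bd.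
  have [bt|tb] := ltP (en b) t; [by left | right].
  apply: (dP _ (gvalP b)); rewrite -/(en b) ltr_norml; apply/andP; split; lra.
by move=> /(sup_upper_bound supS); lra.
Qed.

Lemma en_gap : exists2 c : K, 0 < c & forall b, en b < c -> b = 0.
Proof.
have [c c0 cP] := dm_discrete G 0; exists c => // b bc; apply: en_eq0.
by apply: (cP _ (gvalP b)); rewrite subr0 ger0_norm // en_ge0.
Qed.

Lemma finite_dec g : finite_set [set q : gelt G * gelt G | q.1 + q.2 = g].
Proof.
have F := finite_below (en g + 1).
apply: (sub_finite_set _ (finite_setX F F)) => q /= <-; rewrite enD.
by have := en_ge0 q.1; have := en_ge0 q.2; split=> /=; lra.
Qed.
End Monoid.

(** * Maps linear over the Novikov ring *)

Section Shift.
Variables (K : realType) (R : comNzRingType) (G : dmonoid K).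
Implicit Types M N : lmodType R.

(** Right multiplication by a monomial; for bar coalgebras this is ract. *)
Definition shift M (b : gelt G) (x : fam G M) : fam G M :=
  fun g => \sum_(a \in [set a | a + b = g]) x a.

Lemma shiftE M b (x : fam G M) a : shift b x (a + b) = x a.
Proof.
rewrite /shift (_ : [set _ | _] = [set a]) ?fsbig_set1 //.
by rewrite eqEsubset; split=> [a' /gaddIr|_ ->].
Qed.

Lemma shiftN M b (x : fam G M) g : (forall a, a + b <> g) -> shift b x g = 0.
Proof. by move=> ng; rewrite /shift fsbig1 // => a /ng. Qed.

Lemma shift_ind (b : gelt G) (P : gelt G -> Prop) :
  (forall a, P (a + b)) -> (forall g, (forall a, a + b <> g) -> P g) ->
  forall g, P g.
Proof.
move=> Pa Pn g; have [[a <-]|na] := pselect (exists a, a + b = g); first exact: Pa.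
by apply: Pn => a ag; apply: na; exists a.
Qed.

Lemma shift_linear M b : linear (@shift M b).
Proof.
move=> k x y; apply/funext; apply: (shift_ind (b := b)) => [a|g ng].
  by rewrite shiftE [RHS]/GRing.add /= [in RHS]/GRing.scale /= !shiftE.
rewrite [RHS]/GRing.add /= [in RHS]/GRing.scale /= !shiftN //.
by rewrite scaler0 addr0.
Qed.
HB.instance Definition _ M b := GRing.isLinear.Build R (fam G M) (fam G M) _
  (@shift M b) (shift_linear b).

Lemma shift_fil M b e (x : fam G M) : fil e x -> fil e (shift b x).
Proof.
move=> ex; apply: (shift_ind (b := b)) => [a|g ng _]; last exact: shiftN.
by rewrite shiftE enD => abe; apply: ex; have := en_ge0 b; lra.
Qed.

Lemma shift_mono M b b' (w : M) : shift b (mono b' w) = mono (b' + b) w.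
Proof.
apply/funext; apply: (shift_ind (b := b)) => [a|g ng].
  by rewrite shiftE /mono (inj_eq (@gaddIr _ _ b)).
by rewrite shiftN // /mono; case: eqP => // gb; case: (ng b').
Qed.

Lemma mono_linear M b : linear (@mono K R G M b).
Proof.
move=> k x y; apply/funext => g; rewrite [RHS]/GRing.add /= [in RHS]/GRing.scale /=.
by rewrite /mono; case: ifP => _ //; rewrite scaler0 addr0.
Qed.
HB.instance Definition _ M b := GRing.isLinear.Build R M (fam G M) _
  (@mono K R G M b) (mono_linear b).

Lemma famD M (x y : fam G M) g : (x + y) g = x g + y g. Proof. by []. Qed.
Lemma famN M (x : fam G M) g : (- x) g = - x g. Proof. by []. Qed.
Lemma famZ M k (x : fam G M) g : (k *: x) g = k *: x g. Proof. by []. Qed.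
Lemma fam0 M g : (0 : fam G M) g = 0. Proof. by []. Qed.

Lemma fam_sum M I (s : seq I) (P : pred I) (F : I -> fam G M) g :
  (\sum_(i <- s | P i) F i) g = \sum_(i <- s | P i) F i g.
Proof. by elim/big_rec2: _ => // i y x _ <-. Qed.

Lemma fil0 M e : fil e (0 : fam G M). Proof. by []. Qed.
Lemma filD M e (x y : fam G M) : fil e x -> fil e y -> fil e (x + y).
Proof. by move=> ex ey b be; rewrite famD ex ?ey ?addr0. Qed.
Lemma filN M e (x : fam G M) : fil e x -> fil e (- x).
Proof. by move=> ex b be; rewrite famN ex ?oppr0. Qed.
Lemma filZ M e k (x : fam G M) : fil e x -> fil e (k *: x).
Proof. by move=> ex b be; rewrite famZ ex ?scaler0. Qed.
Lemma fil_all M (x : fam G M) : (forall e, fil e x) -> x = 0.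
Proof. by move=> ex; apply/funext => g; apply: (ex (en g + 1)); lra. Qed.
(** Continuous maps which are linear for the right action of the Novikov ring.
    Such a map is determined by its values on constant families (lop_ext). *)
Record lop M N := Lop {
  lop_fun :> fam G M -> fam G N;
  lop_linear : linear lop_fun;
  lop_fil : forall e x, fil e x -> fil e (lop_fun x);
  lop_shift : forall b x, lop_fun (shift b x) = shift b (lop_fun x) }.
HB.instance Definition _ M N (f : lop M N) :=
  GRing.isLinear.Build R (fam G M) (fam G N) _ (lop_fun f) (lop_linear f).

Section LopMorphism.
Variables (M N : lmodType R) (f : lop M N).
Lemma lop0 : f 0 = 0. Proof. exact: linear0. Qed.
Lemma lopD x y : f (x + y) = f x + f y. Proof. exact: linearD. Qed.
Lemma lopB x y : f (x - y) = f x - f y. Proof. exact: linearB. Qed.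
Lemma lopN x : f (- x) = - f x. Proof. exact: linearN. Qed.
End LopMorphism.

(** Modulo any step of the filtration a family is a finite sum of monomials. *)
Lemma fam_trunc M e (x : fam G M) :
  exists s : seq (gelt G), fil e (x - \sum_(b <- s) shift b (mono 0 (x b))).
Proof.
have F := finite_below G e; exists (enum_fset (fset_set [set b : gelt G | en b < e])).
move=> g ge; rewrite famD famN fam_sum.
have gin : g \in fset_set [set b : gelt G | en b < e].
  by rewrite in_fset_set //; apply/mem_set.
rewrite (bigD1_seq g) ?fset_uniq //= shift_mono add0r /mono eqxx big1 ?addr0 ?subrr //.
move=> b bg; rewrite -/(mono 0 (x b)) shift_mono add0r /mono.
by rewrite eq_sym (negbTE bg).
Qed.

(** f x agrees, up to any given energy, with the image of a finite sum of
    monomials. *)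
Lemma lop_ext0 M N (f : lop M N) :
  (forall w, f (mono 0 w) = 0) -> forall x, f x = 0.
Proof.
move=> f0 x; apply: fil_all => e; have [s xs] := fam_trunc e x.
rewrite (_ : f x = f (x - \sum_(b <- s) shift b (mono 0 (x b)))).
  exact: lop_fil.
rewrite linearB linear_sum /= big1 ?subr0 // => b _.
by rewrite lop_shift f0 linear0.
Qed.

Lemma comp_lin (U V W : lmodType R) (f : {linear V -> W}) (g : {linear U -> V}) :
  linear (fun x => f (g x)).
Proof. by move=> a x y /=; rewrite !linearP. Qed.

Definition lcomp M N P (f : lop N P) (g : lop M N) : lop M P.
Proof.
exists (fun x => f (g x)).
- exact: comp_lin.
- by move=> e x ex; do 2 apply: lop_fil.
- by move=> b x; rewrite !lop_shift.
Defined.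

Definition lid M : lop M M.
Proof. by exists id. Defined.

Definition ladd M N (f g : lop M N) : lop M N.
Proof.
exists (fun x => f x + g x).
- by move=> a x y; rewrite !linearP scalerDr addrACA.
- by move=> e x ex; apply: filD; apply: lop_fil.
- by move=> b x; rewrite !lop_shift linearD.
Defined.

Definition lopp M N (f : lop M N) : lop M N.
Proof.
exists (fun x => - f x).
- by move=> a x y; rewrite !linearP.
- by move=> e x ex; apply: filN; apply: lop_fil.
- by move=> b x; rewrite !lop_shift linearN.
Defined.

Lemma lcompE M N P (f : lop N P) (g : lop M N) x : lcomp f g x = f (g x).
Proof. by []. Qed.
Lemma lidE M (x : fam G M) : lid M x = x. Proof. by []. Qed.
Lemma laddE M N (f g : lop M N) x : ladd f g x = f x + g x. Proof. by []. Qed.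
Lemma loppE M N (f : lop M N) x : lopp f x = - f x. Proof. by []. Qed.

Lemma lop_ext M N (f g : lop M N) :
  (forall w, f (mono 0 w) = g (mono 0 w)) -> forall x, f x = g x.
Proof.
move=> fg x; apply/eqP; rewrite -subr_eq0; apply/eqP.
apply: (lop_ext0 (f := ladd f (lopp g))) => w /=.
by rewrite fg subrr.
Qed.

Lemma extrE M N (F : M -> fam G N) z g : extr F z g =
  \sum_(q <- fset_set [set q : gelt G * gelt G | q.1 + q.2 = g]) F (z q.2) q.1.
Proof. by rewrite /extr fsbig_finite //=; apply: finite_dec. Qed.

Lemma extr_mono M N (F : {linear M -> fam G N}) w : extr F (mono 0 w) = F w.
Proof.
apply/funext => g; rewrite /extr (fsbigD1 (g, 0)) /=; first last.
- exact: addr0.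
- exact: sub_finite_set (finite_dec g).
rewrite /mono eqxx fsbig1 ?addr0 // => -[a b] [/= abg nab].
case: eqP => [b0|_]; last by rewrite linear0.
by case: nab; rewrite -abg b0 addr0.
Qed.

(** Every linear map on M to families extends: the defining sum over the
    decompositions of an exponent commutes with multiplication by a monomial by
    cancellation in the monoid. *)
Definition lextr M N (F : {linear M -> fam G N}) : lop M N.
Proof.
exists (extr F).
- move=> k x y; apply/funext => g; rewrite famD famZ !extrE scaler_sumr -big_split.
  by apply: eq_bigr => q _; rewrite famD famZ linearP.
- move=> e x ex g ge; rewrite /extr fsbig1 // => q qg.
  by rewrite ex ?linear0 //; move: ge; rewrite -qg enD; have := en_ge0 q.1; lra.
move=> c z; apply/funext; apply: (shift_ind (b := c)) => [g|g ng].
  rewrite shiftE /extr.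
  pose h (q : gelt G * gelt G) := (q.1, q.2 + c).
  rewrite -(fsbig_widen (h @` [set q : gelt G * gelt G | q.1 + q.2 = g])).
  - rewrite fsbig_image; first by apply: eq_fsbigr => q _; rewrite shiftE.
    move=> [a b] [a' b'] _ _ hq; have ea := congr1 fst hq.
    by have /gaddIr /= eb := congr1 snd hq; move: ea => /= ->; rewrite eb.
  - by move=> _ [q /= <- <-]; rewrite addrA.
  move=> [a b] [/= abg nab]; rewrite shiftN ?linear0 // => b' b'b.
  apply: nab; exists (a, b'); rewrite /h /= ?b'b //.
  by apply: (@gaddIr _ _ c); rewrite -addrA b'b.
rewrite shiftN // /extr fsbig1 // => -[a b] /= abg.
rewrite shiftN ?linear0 // => b' b'b; apply: (ng (a + b')).
by rewrite -addrA b'b.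
Defined.

Lemma ext_mono M N (F : {linear M -> N}) w : 
  ext F (mono 0 w) = mono (0 : gelt G) (F w).
Proof. by apply/funext => g; rewrite /ext /mono; case: ifP; rewrite ?linear0. Qed.

Definition lext M N (F : {linear M -> N}) : lop M N.
Proof.
exists (ext F).
- by move=> k x y; apply/funext => g; rewrite famD famZ /ext famD famZ linearP.
- by move=> e x ex g ge; rewrite /ext ex ?linear0.
move=> b x; apply/funext; apply: (shift_ind (b := b)) => [g|g ng].
  by rewrite shiftE /ext shiftE.
by rewrite shiftN // /ext shiftN ?linear0.
Defined.


Lemma lext_mono M N (F : {linear M -> N}) w : lext F (mono 0 w) = mono 0 (F w).
Proof. exact: ext_mono. Qed.

End Shift.

(** * The tensor algebra *)

Section TensorAlgebra.
Variable R : comNzRingType.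
Implicit Types C M N L : lmodType R.

Definition mk_linear (U V : lmodType R) (f : U -> V) (lf : linear f) :
  {linear U -> V} := HB.pack f (GRing.isLinear.Build R U V _ f lf).

(** The quotient is generated by the classes of generators, which makes linear
    maps on it determined by their values on these. *)
Lemma ucl_sum (W : choiceType) (lin : forall M : lmodType R, (W -> M) -> Prop)
    u : ucl lin u = \sum_(p <- u) p.1 *: ugen lin p.2.
Proof.
elim: u => [|[a w] u IH]; first by rewrite big_nil.
rewrite big_cons -IH -cat1s uclD; congr (_ + _).
rewrite -[RHS]/(uscale a _) uscale_cl; congr ucl.
by rewrite /uscaleseq /= mulr1.
Qed.

Lemma word_span C (t : tensalg C) :
  exists u : seq (R * seq C), t = \sum_(p <- u) p.1 *: word p.2.
Proof. by exists (repr t); rewrite -[LHS]ucl_repr ucl_sum. Qed.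

Lemma ten_span M N (t : tens M N) :
  exists u : seq (R * (M * N)), t = \sum_(p <- u) p.1 *: ten p.2.1 p.2.2.
Proof.
exists (repr t); rewrite -[LHS]ucl_repr ucl_sum.
by apply: eq_bigr => -[a [x y]].
Qed.

Lemma talg_ext C M (f g : {linear tensalg C -> M}) :
  (forall s, f (word s) = g (word s)) -> f =1 g.
Proof.
move=> fg t; have [u ->] := word_span t.
by rewrite !linear_sum; apply: eq_bigr => p _; rewrite !linearZ /= fg.
Qed.

Lemma talg_ind C M (f g : {linear tensalg C -> M}) :
  f (word [::]) = g (word [::]) ->
  (forall x s, f (word s) = g (word s) -> f (word (x :: s)) = g (word (x :: s))) ->
  f =1 g.
Proof. by move=> fg0 fgS; apply: talg_ext; elim=> [|x s IH]; [|exact: fgS]. Qed.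

Lemma tens_ext M N L (f g : {linear tens M N -> L}) :
  (forall x y, f (ten x y) = g (ten x y)) -> f =1 g.
Proof.
move=> fg t; have [u ->] := ten_span t.
by rewrite !linear_sum; apply: eq_bigr => p _; rewrite !linearZ /= fg.
Qed.

Lemma ten_bilinear M N : bilinear2 (fun p : M * N => ten p.1 p.2).
Proof.
split=> a x x' y /=.
  rewrite -[X in _ = X + _]/(uscale a _) /ten /ugen uscale_cl -uclD.
  by apply/ucl_eq => L f [lf _]; rewrite fev_cat fev_scale /fev !big_seq1 /= !scale1r.
rewrite -[X in _ = X + _]/(uscale a _) /ten /ugen uscale_cl -uclD.
by apply/ucl_eq => L f [_ lf]; rewrite fev_cat fev_scale /fev !big_seq1 /= !scale1r.
Qed.

Lemma ten_linearr M N (x : M) : linear (@ten R M N x).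
Proof. by move=> a y y'; have [_] := ten_bilinear M N; apply. Qed.
Lemma ten_linearl M N (y : N) : linear (fun x : M => ten x y).
Proof. by move=> a x x'; have [+ _] := ten_bilinear M N; apply. Qed.

Definition tenr M N (x : M) : {linear N -> tens M N} := mk_linear (ten_linearr x).
Definition tenl M N (y : N) : {linear M -> tens M N} := mk_linear (ten_linearl y).

Lemma ten0l M N (y : N) : ten (0 : M) y = 0. Proof. exact: (linear0 (tenl M y)). Qed.
Lemma ten0r M N (x : M) : ten x (0 : N) = 0. Proof. exact: (linear0 (tenr N x)). Qed.
Lemma tenDl M N (x x' : M) (y : N) : ten (x + x') y = ten x y + ten x' y.
Proof. exact: (linearD (tenl M y)). Qed.
Lemma tenDr M N (x : M) (y y' : N) : ten x (y + y') = ten x y + ten x y'.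
Proof. exact: (linearD (tenr N x)). Qed.

Lemma tens_word_ext C C' L (f g : {linear tens (tensalg C) (tensalg C') -> L}) :
  (forall s s', f (ten (word s) (word s')) = g (ten (word s) (word s'))) -> f =1 g.
Proof.
move=> fg; apply: tens_ext => u v.
pose fu := f \o tenl (tensalg C) v; pose gu := g \o tenl (tensalg C) v.
apply: (@talg_ext C L fu gu) => s.
pose fv := f \o tenr (tensalg C') (word s); pose gv := g \o tenr (tensalg C') (word s).
exact: (@talg_ext C' L fv gv (fg s) v).
Qed.

Lemma tlift_word C M (f : seq C -> M) (mf : multilinear f) s :
  tlift f (word s) = f s.
Proof. exact: ulift_gen. Qed.

Lemma blift_ten M N L (f : M * N -> L) (bf : bilinear2 f) x y :
  blift f (ten x y) = f (x, y).
Proof. exact: ulift_gen. Qed.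

Lemma tmap_multilinear C C' (f : {linear C -> C'}) :
  multilinear (fun s => word [seq f x | x <- s]).
Proof. by move=> s1 s2 a x y; rewrite !map_cat /= linearP word_multilinear. Qed.
HB.instance Definition _ C C' (f : {linear C -> C'}) :=
  GRing.isLinear.Build R _ _ _ (tmap f) (ulift_linear (tmap_multilinear f)).
Lemma tmap_word C C' (f : {linear C -> C'}) s :
  tmap f (word s) = word [seq f x | x <- s].
Proof. exact/tlift_word/tmap_multilinear. Qed.

Definition tensmap M N M' N' (f : M -> M') (g : N -> N') :
  tens M N -> tens M' N' := blift (fun p => ten (f p.1) (g p.2)).
Lemma tensmap_bilinear M N M' N' (f : {linear M -> M'}) (g : {linear N -> N'}) :
  bilinear2 (fun p : M * N => ten (f p.1) (g p.2)).
Proof.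
by split=> a x x' y /=; rewrite linearP ?(ten_linearl, ten_linearr).
Qed.
HB.instance Definition _ M N M' N' (f : {linear M -> M'}) (g : {linear N -> N'}) :=
  GRing.isLinear.Build R _ _ _ (tensmap f g) (ulift_linear (tensmap_bilinear f g)).
Lemma tensmap_ten M N M' N' (f : {linear M -> M'}) (g : {linear N -> N'}) x y :
  tensmap f g (ten x y) = ten (f x) (g y).
Proof. exact/blift_ten/tensmap_bilinear. Qed.

Lemma word_mulr C (s : seq C) : multilinear (fun s' => word (s ++ s')).
Proof. by move=> s1 s2 a x y; rewrite !catA word_multilinear. Qed.
Definition catw C (s : seq C) : tensalg C -> tensalg C :=
  tlift (fun s' => word (s ++ s')).
HB.instance Definition _ C (s : seq C) :=
  GRing.isLinear.Build R _ _ _ (catw s) (ulift_linear (word_mulr s)).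
Lemma catw_word C (s s' : seq C) : catw s (word s') = word (s ++ s').
Proof. exact/tlift_word/word_mulr. Qed.

Lemma tcat_multilinear C (v : tensalg C) : multilinear (fun s => catw s v).
Proof.
move=> s1 s2 a x y.
have E := @talg_ext C (tensalg C) (catw (s1 ++ (a *: x + y) :: s2))
  ((a \*: catw (s1 ++ x :: s2)) \+ catw (s1 ++ y :: s2)).
rewrite E // => s /=; rewrite !catw_word -!catA !cat_cons.
exact: word_multilinear.
Qed.

Definition tcat C (u v : tensalg C) : tensalg C := tlift (fun s => catw s v) u.
(** Right multiplication, as a function to which linearity can be attached. *)
Definition tcatl C (v u : tensalg C) := tcat u v.
HB.instance Definition _ C (v : tensalg C) :=
  GRing.isLinear.Build R _ _ _ (tcatl v) (ulift_linear (tcat_multilinear v)).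

Lemma tcat_wordl C s (v : tensalg C) : tcat (word s) v = catw s v.
Proof. exact/tlift_word/tcat_multilinear. Qed.

Lemma tcat_word C (s s' : seq C) : tcat (word s) (word s') = word (s ++ s').
Proof. by rewrite tcat_wordl catw_word. Qed.

Lemma tcat_linear C (u : tensalg C) : linear (tcat u).
Proof.
move=> a v v'; have [r ->] := word_span u.
have tcE w : tcat (\sum_(p <- r) p.1 *: word p.2) w =
    \sum_(p <- r) p.1 *: catw p.2 w.
  rewrite -[LHS]/(tcatl w _) linear_sum; apply: eq_bigr => p _.
  by rewrite linearZ /= /tcatl tcat_wordl.
rewrite !tcE scaler_sumr -big_split; apply: eq_bigr => p _ /=.
by rewrite linearP scalerDr !scalerA mulrC.
Qed.
HB.instance Definition _ C (u : tensalg C) :=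
  GRing.isLinear.Build R _ _ _ (tcat u) (tcat_linear u).

Lemma tcatDl C (u u' v : tensalg C) : tcat (u + u') v = tcat u v + tcat u' v.
Proof. exact: (linearD (tcatl v)). Qed.
Lemma tcatNl C (u v : tensalg C) : tcat (- u) v = - tcat u v.
Proof. exact: (linearN (tcatl v)). Qed.
Lemma tcatZl C a (u v : tensalg C) : tcat (a *: u) v = a *: tcat u v.
Proof. exact: (linearZ_LR (tcatl v)). Qed.
Lemma tcat0l C (v : tensalg C) : tcat 0 v = 0.
Proof. exact: (linear0 (tcatl v)). Qed.

(** The map u (x) v |-> u w v; for w a single letter its image consists of the
    words in which this letter is marked. *)
Definition sand C (w : tensalg C) : tens (tensalg C) (tensalg C) -> tensalg C :=
  blift (fun p => tcat p.1 (tcat w p.2)).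
Lemma sand_bilinear C (w : tensalg C) :
  bilinear2 (fun p => tcat p.1 (tcat w p.2)).
Proof.
split=> a x x' y /=; first by rewrite tcatDl tcatZl.
by rewrite !linearP.
Qed.
HB.instance Definition _ C (w : tensalg C) :=
  GRing.isLinear.Build R _ _ _ (sand w) (ulift_linear (sand_bilinear w)).
Lemma sand_ten C (w : tensalg C) u v : sand w (ten u v) = tcat u (tcat w v).
Proof. exact/blift_ten/sand_bilinear. Qed.

Lemma tcat1l C : @tcat C (word [::]) =1 id.
Proof.
apply: (@talg_ext C _ (tcat (word [::])) idfun) => s.
exact: tcat_word.
Qed.

Lemma tcatA C (u v w : tensalg C) : tcat u (tcat v w) = tcat (tcat u v) w.
Proof.
apply: (@talg_ext C _ (tcatl (tcat v w)) (tcatl w \o tcatl v)) => s /=.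
rewrite /tcatl; move: v.
apply: (@talg_ext C _ (tcat (word s) \o tcatl w) (tcatl w \o tcat (word s))) => s' /=.
rewrite /tcatl; move: w.
apply: (@talg_ext C _ (tcat (word s) \o tcat (word s'))
  (tcat (tcat (word s) (word s')))) => s'' /=.
by rewrite !tcat_word catA.
Qed.

Lemma word_cons C (x : C) s : word (x :: s) = tcat (word [:: x]) (word s).
Proof. by rewrite tcat_word. Qed.

Lemma tmap_cat C C' (f : {linear C -> C'}) u v :
  tmap f (tcat u v) = tcat (tmap f u) (tmap f v).
Proof.
apply: (@talg_ext C _ (tmap f \o tcatl v) (tcatl (tmap f v) \o tmap f)) => s /=.
rewrite /tcatl; move: v.
apply: (@talg_ext C _ (tmap f \o tcat (word s)) (tcat (tmap f (word s)) \o tmap f)) => s' /=.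
by rewrite tcat_word !tmap_word tcat_word map_cat.
Qed.

Lemma pr0_multilinear C :
  multilinear (fun s : seq C => if s is [::] then 1 : R^o else 0).
Proof. by move=> [|z s1] s2 a x y /=; rewrite scaler0 addr0. Qed.
HB.instance Definition _ C :=
  GRing.isLinear.Build R _ _ _ (@pr0 R C) (ulift_linear (@pr0_multilinear C)).
Lemma pr0_word C (s : seq C) : pr0 (word s) = (s == [::])%:R.
Proof.
rewrite [LHS]tlift_word; last exact: pr0_multilinear.
by case: s.
Qed.

Lemma pr1_word C (s : seq C) : pr1 (word s) = len1 s.
Proof. exact/tlift_word/len1_multilinear. Qed.

Definition cutw C (s : seq C) (i : nat) := ten (word (take i s)) (word (drop i s)).

Lemma deconc_multilinear C :
  multilinear (fun s : seq C => \sum_(i < (size s).+1) cutw s i).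
Proof.
move=> s1 s2 a x y.
have sz (z : C) : (size (s1 ++ z :: s2)).+1 = (size s1 + size s2).+2.
  by rewrite size_cat /= addnS.
rewrite !sz scaler_sumr -big_split; apply: eq_bigr => i _ /=.
rewrite /cutw !take_cat !drop_cat; case: ltnP => isz.
  by rewrite word_multilinear ten_linearr.
case E : (i - size s1)%N => [|k] /=; rewrite ?cats0.
  by rewrite (word_multilinear [::]) ten_linearr.
by rewrite word_multilinear ten_linearl.
Qed.
HB.instance Definition _ C :=
  GRing.isLinear.Build R _ _ _ (@deconc R C) (ulift_linear (@deconc_multilinear C)).
Lemma deconc_word C (s : seq C) :
  deconc (word s) = \sum_(i < (size s).+1) cutw s i.
Proof. exact/tlift_word/deconc_multilinear. Qed.
Lemma deconc_nil C : deconc (word [::]) = ten (word [::]) (word [::]) :> tens (tensalg C) _.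
Proof. by rewrite deconc_word big_ord1. Qed.
Lemma deconc_cons C x (s : seq C) : deconc (word (x :: s)) =
  ten (word [::]) (word (x :: s)) + tensmap (tcat (word [:: x])) idfun (deconc (word s)).
Proof.
rewrite !deconc_word big_ord_recl; congr (_ + _).
by rewrite linear_sum; apply: eq_bigr => i _; rewrite /cutw /= tensmap_ten /= tcat_word.
Qed.

Section Insert.
Variables (C : lmodType R) (f h g : {linear C -> C}).

Definition insw (s : seq C) := \sum_(i < size s)
    word ([seq f x | x <- take i s] ++ h (nth 0 s i) :: [seq g x | x <- drop i.+1 s]).

Lemma insw_cons x s : insw (x :: s) =
  word (h x :: [seq g y | y <- s]) + tcat (word [:: f x]) (insw s).
Proof.
rewrite /insw big_ord_recl /= ?take0 ?drop0; congr (_ + _).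
rewrite linear_sum; apply: eq_bigr => i _ /=.
by rewrite tcat_word.
Qed.

Lemma insw_multilinear : multilinear insw.
Proof.
elim=> [|z s1 IH] s2 a x y.
  rewrite !cat0s !insw_cons !linearP (word_multilinear [::]) /=.
  rewrite (word_multilinear [::]).
  by rewrite tcatDl tcatZl scalerDr addrACA.
rewrite !cat_cons !insw_cons IH !map_cat /= linearP.
rewrite -!cat_cons word_multilinear linearP /= scalerDr.
by rewrite addrACA.
Qed.
HB.instance Definition _ :=
  GRing.isLinear.Build R _ _ _ (insert f h g) (ulift_linear insw_multilinear).
Lemma ins_word s : insert f h g (word s) = insw s.
Proof. exact/tlift_word/insw_multilinear. Qed.
Lemma ins_nil : insert f h g (word [::]) = 0.
Proof. by rewrite ins_word /insw big_ord0. Qed.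
Lemma ins_cons x s : insert f h g (word (x :: s)) =
  tcat (word [:: h x]) (tmap g (word s)) + tcat (word [:: f x]) (insert f h g (word s)).
Proof. by rewrite !ins_word insw_cons tmap_word tcat_word. Qed.
End Insert.
End TensorAlgebra.

(** * Counit, comultiplication and insertions *)

Section TensorIdentities.
Variable R : comNzRingType.
Implicit Types C M N L : lmodType R.

Lemma tensmap_comp M N M' N' M'' N'' (f : {linear M' -> M''}) (g : {linear N' -> N''})
    (f' : {linear M -> M'}) (g' : {linear N -> N'}) z :
  tensmap f g (tensmap f' g' z) = tensmap (f \o f') (g \o g') z.
Proof.
move: z; apply: (@tens_ext _ _ _ _ (tensmap f g \o tensmap f' g')
  (tensmap (f \o f') (g \o g'))) => x y /=.
by rewrite !tensmap_ten.
Qed.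

Lemma tmap_cons C C' (f : {linear C -> C'}) x s :
  tmap f (word (x :: s)) = tcat (word [:: f x]) (tmap f (word s)).
Proof. by rewrite !tmap_word tcat_word. Qed.

Lemma tmap_comp C C' C'' (f : {linear C' -> C''}) (g : {linear C -> C'}) t :
  tmap f (tmap g t) = tmap (f \o g) t.
Proof.
move: t; apply: (@talg_ext _ _ _ (tmap f \o tmap g) (tmap (f \o g))) => s /=.
by rewrite !tmap_word -map_comp.
Qed.

Lemma eq_tmap C C' (f g : C -> C') : f =1 g -> tmap f =1 tmap g.
Proof. by move=> /funext ->. Qed.

Lemma tmap_id C t : tmap (@idfun C) t = t.
Proof.
move: t; apply: (@talg_ext _ _ _ (tmap (@idfun C)) idfun) => s.
by rewrite [LHS](tmap_word (idfun : {linear C -> C})) map_id.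
Qed.

Lemma pr0_tmap C C' (f : {linear C -> C'}) t : pr0 (tmap f t) = pr0 t.
Proof.
move: t; apply: (@talg_ext _ _ _ (@pr0 R C' \o tmap f) (@pr0 R C)) => s /=.
by rewrite tmap_word !pr0_word; case: s.
Qed.

Lemma pr0_cat C (u v : tensalg C) : pr0 (tcat u v) = pr0 u * pr0 v :> R.
Proof.
rewrite mulrC; move: u.
apply: (@talg_ext _ _ _ (@pr0 R C \o tcatl v) (pr0 v \*: @pr0 R C)) => s /=.
rewrite /tcatl -[_ *: _]/((_ : R) * _) mulrC; move: v.
apply: (@talg_ext _ _ _ (@pr0 R C \o tcat (word s)) (pr0 (word s) \*: @pr0 R C)) => s' /=.
rewrite tcat_word -[_ *: _]/((_ : R) * _) !pr0_word.
by case: s; case: s' => *; rewrite /= ?mulr1 ?mul0r ?mulr0.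
Qed.

Lemma pr1_tmap C C' (f : {linear C -> C'}) t : pr1 (tmap f t) = f (pr1 t).
Proof.
move: t; apply: (@talg_ext _ _ _ (@pr1 R C' \o tmap f) (f \o @pr1 R C)) => s /=.
by rewrite tmap_word !pr1_word; case: s => [|x [|y s]] /=; rewrite ?linear0.
Qed.

Lemma deconc_tmap C C' (f : {linear C -> C'}) t :
  deconc (tmap f t) = tensmap (tmap f) (tmap f) (deconc t).
Proof.
move: t; apply: (@talg_ind _ _ _ (@deconc R C' \o tmap f)
  (tensmap (tmap f) (tmap f) \o @deconc R C)) => [|x s] /=.
  by rewrite tmap_word !deconc_nil tensmap_ten /= !tmap_word.
rewrite !tmap_word /= !deconc_cons => -> /=.
rewrite linearD /= tensmap_ten /= !tmap_word; congr (_ + _).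
rewrite !tensmap_comp; congr (tensmap _ _ _); apply/funext => t /=.
by rewrite tmap_cat tmap_word.
Qed.

Definition headmul C (z : tens (tensalg C) (tensalg C)) : tensalg C :=
  blift (fun p => tcat (word [:: pr1 p.1]) p.2) z.
Lemma headmul_bilinear C :
  bilinear2 (fun p : tensalg C * tensalg C => tcat (word [:: pr1 p.1]) p.2).
Proof.
split=> a x x' y /=; last exact: linearP.
by rewrite linearP /= (word_multilinear [::]) tcatDl tcatZl.
Qed.
HB.instance Definition _ C :=
  GRing.isLinear.Build R _ _ _ (@headmul C) (ulift_linear (@headmul_bilinear C)).
Lemma headmul_ten C (u v : tensalg C) :
  headmul (ten u v) = tcat (word [:: pr1 u]) v.
Proof. exact/blift_ten/headmul_bilinear. Qed.

Lemma word0 C (s1 s2 : seq C) : word (s1 ++ 0 :: s2) = 0.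
Proof.
have := word_multilinear s1 s2 (-1) 0 0.
by rewrite scaler0 addr0 scaleN1r addNr.
Qed.

(** Only the cut after the first letter survives in the contraction, and gives the
    word back. *)
Lemma headmul_deconc C (t : tensalg C) :
  t = pr0 t *: word [::] + headmul (deconc t).
Proof.
have lin0 : linear (fun t : tensalg C => (pr0 t : R) *: (word [::] : tensalg C)).
  by move=> a x y; rewrite linearP scalerDl scalerA.
move: t; apply: (@talg_ext _ _ _ idfun (mk_linear lin0 \+ (@headmul C \o @deconc R C))).
case=> [|x s] /=.
  by rewrite pr0_word scale1r deconc_nil headmul_ten pr1_word (word0 [::]) tcat0l addr0.
rewrite pr0_word scale0r add0r deconc_word linear_sum big_ord_recl big_ord_recl /=.
rewrite /cutw !headmul_ten /= drop0 take0 !pr1_word (word0 [::]) tcat0l add0r /=.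
rewrite tcat_word big1 ?addr0 // => i _; rewrite headmul_ten pr1_word /=.
by case: s i => [[]|y s i] //=; rewrite (word0 [::]) tcat0l.
Qed.

Section InsertIdentities.
Variables (C : lmodType R) (f h g : {linear C -> C}).
Local Notation ins := (insert f h g).

Lemma pr0_ins t : pr0 (ins t) = 0.
Proof.
move: t; apply: (@talg_ind _ _ _ (@pr0 R C \o ins) \0) => [|x s _] /=.
  by rewrite ins_nil linear0.
by rewrite ins_cons linearD /= !pr0_cat !pr0_word !mul0r addr0.
Qed.

Lemma pr1_ins t : pr1 (ins t) = h (pr1 t).
Proof.
move: t; apply: (@talg_ext _ _ _ (@pr1 R C \o ins) (h \o @pr1 R C)).
case=> [|x [|y s]] /=; first by rewrite ins_nil pr1_word !linear0.
  by rewrite ins_cons ins_nil linear0 addr0 tmap_word tcat_word !pr1_word.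
rewrite ins_word /insw linear_sum pr1_word /= linear0 big1 // => i _ /=.
rewrite pr1_word; case: i => [[|[|i]] isz] //=.
Qed.

(** The letter on which h acts lies either in u, with g applied to all of v, or in
    v, with f applied to all of u. *)
Lemma ins_cat u v : ins (tcat u v) = tcat (ins u) (tmap g v) + tcat (tmap f u) (ins v).
Proof.
move: u; apply: (@talg_ind _ _ _ (ins \o tcatl v)
  ((tcatl (tmap g v) \o ins) \+ (tcatl (ins v) \o tmap f))) => [|x s] /=;
  rewrite /tcatl.
  by rewrite tcat1l ins_nil tcat0l tmap_word tcat1l add0r.
have insx : forall w, ins (tcat (word [:: x]) w) =
    tcat (word [:: h x]) (tmap g w) + tcat (word [:: f x]) (ins w).
  apply: (@talg_ext _ _ _ (ins \o tcat (word [:: x]))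
    ((tcat (word [:: h x]) \o tmap g) \+ (tcat (word [:: f x]) \o ins))) => s' /=.
  by rewrite tcat_word /= ins_cons.
move=> IH; rewrite ins_cons tmap_cons (word_cons x) -tcatA insx IH tmap_cat.
by rewrite linearD /= tcatDl !tcatA addrA.
Qed.

(** The cut of a word lies after or before the letter on which h acts. *)
Lemma deconc_ins t :
  deconc (ins t) = tensmap ins (tmap g) (deconc t) + tensmap (tmap f) ins (deconc t).
Proof.
move: t; apply: (@talg_ind _ _ _ (@deconc R C \o ins)
  ((tensmap ins (tmap g) \o @deconc R C) \+
   (tensmap (tmap f) ins \o @deconc R C))) => [|x s] /=.
  by rewrite ins_nil deconc_nil !tensmap_ten /= ins_nil linear0 ten0l ten0r addr0.
move=> IH.
have dcat y (w : tensalg C) : deconc (tcat (word [:: y]) w) =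
    ten (word [::]) (tcat (word [:: y]) w) + tensmap (tcat (word [:: y])) idfun (deconc w).
  move: w; apply: (@talg_ext _ _ _ (@deconc R C \o tcat (word [:: y]))
    ((tenr _ (word [::]) \o tcat (word [:: y])) \+
     (tensmap (tcat (word [:: y])) idfun \o @deconc R C))) => s' /=.
  by rewrite tcat_word deconc_cons.
rewrite ins_cons linearD /= !dcat IH deconc_tmap deconc_cons !linearD /=.
rewrite !tensmap_ten /= ins_nil ten0l add0r tmap_word /=.
rewrite ins_cons tenDr /= !tensmap_comp.
have -> : tensmap (ins \o tcat (word [:: x])) (tmap g \o idfun) (deconc (word s)) =
    tensmap (tcat (word [:: h x]) \o tmap g) (idfun \o tmap g) (deconc (word s)) +
    tensmap (tcat (word [:: f x]) \o ins) (idfun \o tmap g) (deconc (word s)).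
  move: (deconc (word s)).
  apply: (@tens_ext _ _ _ _ (tensmap (ins \o tcat _) (tmap g \o idfun))
    (tensmap (tcat (word [:: h x]) \o tmap g) (idfun \o tmap g) \+
     tensmap (tcat (word [:: f x]) \o ins) (idfun \o tmap g))) => u v /=.
  rewrite !tensmap_ten /= ins_cat ins_cons ins_nil linear0 addr0 !tmap_word tcat_word.
  by rewrite tenDl.
have -> : tmap f \o tcat (word [:: x]) = tcat (word [:: f x]) \o tmap f.
  by apply/funext => t /=; rewrite tmap_cat tmap_word.
by rewrite !tmap_word (AC (2*(1*2)) ((2*4)*(1*3*5))).
Qed.

End InsertIdentities.
End TensorIdentities.

(** * Contraction of the tensor algebra *)

Section Contraction.
Variable R : comNzRingType.
Implicit Types C H : lmodType R.

Lemma ins_tcat1 C (f h g : {linear C -> C}) y w :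
  insert f h g (tcat (word [:: y]) w) =
  tcat (word [:: h y]) (tmap g w) + tcat (word [:: f y]) (insert f h g w).
Proof. by rewrite ins_cat ins_cons ins_nil linear0 addr0 !tmap_word tcat_word. Qed.

(** In each term one letter is of the form k (h x). *)
Lemma tmap_ins0 C C' (k : {linear C -> C'}) (f h g : {linear C -> C}) t :
  (forall x, k (h x) = 0) -> tmap k (insert f h g t) = 0.
Proof.
move=> kh; move: t; apply: (@talg_ind _ _ _ (tmap k \o insert f h g) \0) => [|x s] /=.
  by rewrite ins_nil linear0.
move=> IH; rewrite ins_cons linearD /= !tmap_cat IH linear0 addr0.
by rewrite (tmap_word k [:: _]) /= kh (word0 [::]) tcat0l.
Qed.

(** In each term one letter is of the form h (k x). *)
Lemma ins_tmap0 C C' (k : {linear C' -> C}) (f h g : {linear C -> C}) t :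
  (forall x, h (k x) = 0) -> insert f h g (tmap k t) = 0.
Proof.
move=> hk; move: t; apply: (@talg_ind _ _ _ (insert f h g \o tmap k) \0) => [|x s] /=.
  by rewrite tmap_word ins_nil.
move=> IH; rewrite tmap_cons ins_tcat1 IH linear0 addr0.
by rewrite hk (word0 [::]) tcat0l.
Qed.

Lemma tmap_ins C C' (k : {linear C -> C'}) (f h g : {linear C -> C})
    (f' h' g' : {linear C' -> C'}) t :
  (forall x, k (f x) = f' (k x)) -> (forall x, k (h x) = h' (k x)) ->
  (forall x, k (g x) = g' (k x)) ->
  tmap k (insert f h g t) = insert f' h' g' (tmap k t).
Proof.
move=> kf kh kg; move: t.
apply: (@talg_ind _ _ _ (tmap k \o insert f h g) (insert f' h' g' \o tmap k)) => [|x s] /=.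
  by rewrite ins_nil linear0 tmap_word ins_nil.
move=> IH; rewrite ins_cons linearD /= !tmap_cat IH [tmap k (word (x :: s))]tmap_cons ins_tcat1.
rewrite !tmap_comp !(tmap_word k [:: _]) /= kh kf; congr (tcat _ _ + _).
by apply: eq_tmap => y /=.
Qed.

Lemma ins_opp C (f h g : {linear C -> C}) t :
  insert f (\- h) g t = - insert f h g t.
Proof.
move: t; apply: (@talg_ind _ _ _ (insert f (\- h) g) (\- insert f h g)) => [|x s] /=.
  by rewrite !ins_nil oppr0.
move=> IH; rewrite !ins_cons IH /= linearN opprD; congr (_ + _).
rewrite -tcatNl; congr tcat.
have := word_multilinear [::] [::] (-1) (h x) 0.
by rewrite /= addr0 (word0 [::]) addr0 !scaleN1r.
Qed.



Lemma tmap_ins_anti C (k f h g : {linear C -> C}) t :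
  (forall x, k (f x) = f (k x)) -> (forall x, k (h x) = - h (k x)) ->
  (forall x, k (g x) = g (k x)) ->
  tmap k (insert f h g t) = - insert f h g (tmap k t).
Proof.
move=> kf kh kg; rewrite -ins_opp.
exact: (tmap_ins (h' := \- h)).
Qed.

Variables (C H : lmodType R) (s d h : {linear C -> C}).
Variables (Pi : {linear C -> H}) (I : {linear H -> C}).
Hypotheses (ss : forall x, s (s x) = x) (sd : forall x, s (d x) = - d (s x)).
Hypotheses (sh : forall x, s (h x) = - h (s x)).
Hypotheses (sP : forall x, s (I (Pi x)) = I (Pi (s x))).
Hypotheses (Pid : forall x, Pi (d x) = 0) (dI : forall y, d (I y) = 0).
Hypotheses (dh : forall x, d (h x) + h (d x) = I (Pi x) - x).
Hypotheses (hh : forall x, h (h x) = 0) (Pih : forall x, Pi (h x) = 0).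
Hypotheses (hI : forall y, h (I y) = 0).
Local Notation P := (I \o Pi).
Local Notation hhat := (insert s h P).
Local Notation dhat := (insert s d idfun).

(** By induction on the word: in the two mixed terms h meets a letter in the image
    of I, or Pi a letter in the image of h. *)
Lemma insert_sq0 t : hhat (hhat t) = 0.
Proof.
move: t; apply: (@talg_ind _ _ _ (hhat \o hhat) \0) => [|x w /= IH] /=.
  by rewrite ins_nil linear0.
rewrite ins_cons linearD /= !ins_tcat1 hh IH.
rewrite (word0 [::]) tcat0l linear0 !add0r addr0.
rewrite (ins_tmap0 (k := I \o Pi)) => [|y /=]; last exact: hI.
rewrite (tmap_ins0 (k := I \o Pi)) => [|y /=]; last by rewrite Pih linear0.
by rewrite !linear0 addr0.
Qed.

(** The homotopy identity for C propagates along words: the mixed terms cancel by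
    the signs of d and h, and the remaining ones telescope. *)
Lemma insert_contraction t : dhat (hhat t) + hhat (dhat t) = tmap P t - t.
Proof.
have opw (y : C) (w : tensalg C) : tcat (word [:: - y]) w = - tcat (word [:: y]) w.
  have := word_multilinear [::] [::] (-1) y 0.
  by rewrite /= addr0 (word0 [::]) addr0 !scaleN1r => ->; rewrite tcatNl.
have idw (w : tensalg C) : tmap idfun w = w by exact: tmap_id.
move: t; apply: (@talg_ind _ _ _ ((dhat \o hhat) \+ (hhat \o dhat))
  (tmap P \- idfun)) => [|x w /= IH] /=.
  by rewrite !ins_nil !linear0 addr0 tmap_word subrr.
rewrite !ins_cons !idw !linearD /= !ins_tcat1 !idw !ss sd sh !opw.
rewrite (ins_tmap0 (k := I \o Pi)) => [|y /=]; last exact: dI.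
rewrite (tmap_ins0 (k := I \o Pi)) => [|y /=]; last by rewrite Pid linear0.
rewrite !linear0 addr0 add0r.
have IH' : dhat (hhat (word w)) = tmap P (word w) - word w - hhat (dhat (word w)).
  by rewrite -IH /= addrK.
rewrite IH' tmap_cons (word_cons x) /=.
set A := tmap P (word w); set B := hhat (dhat (word w)).
(* Here the homotopy identity of C enters. *)
have -> : word [:: d (h x)] = word [:: P x] - word [:: x] - word [:: h (d x)].
  have -> : d (h x) = P x - x - h (d x) by rewrite /= -dh addrK.
  have w2 (y z : C) : word [:: y - z] = word [:: y] - word [:: z].
    have := word_multilinear [::] [::] (-1) z y.
    by rewrite /= !scaleN1r [- z + y]addrC [- word _ + _]addrC.
  by rewrite !w2.
rewrite !tcatDl !tcatNl !linearB /=.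
by rewrite (AC (3*(1*3)*3) (1*6*(5*2)*(8*3)*(4*9)*(10*7))) /= !subrr !addr0.
Qed.
End Contraction.

(** * Words with a marked letter *)

Section Sandwich.
Variable R : comNzRingType.
Implicit Types C H : lmodType R.

Lemma tmap_sand C H (f : {linear C -> H}) e z :
  tmap f (sand (word [:: e]) z) = sand (word [:: f e]) (tensmap (tmap f) (tmap f) z).
Proof.
move: z; apply: (@tens_ext _ _ _ _ (tmap f \o sand (word [:: e]))
  (sand (word [:: f e]) \o tensmap (tmap f) (tmap f))) => u v /=.
by rewrite tensmap_ten !sand_ten !tmap_cat (tmap_word f [:: e]).
Qed.

(** An entry annihilated by h can only be passed over by an insertion of h. *)
Lemma ins_sand C (f h g : {linear C -> C}) e z : h e = 0 ->
  insert f h g (sand (word [:: e]) z) =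
    sand (word [:: g e]) (tensmap (insert f h g) (tmap g) z) +
    sand (word [:: f e]) (tensmap (tmap f) (insert f h g) z).
Proof.
move=> he; move: z; apply: (@tens_ext _ _ _ _ (insert f h g \o sand (word [:: e]))
  ((sand (word [:: g e]) \o tensmap (insert f h g) (tmap g)) \+
   (sand (word [:: f e]) \o tensmap (tmap f) (insert f h g)))) => u v /=.
rewrite !tensmap_ten !sand_ten /= ins_cat ins_tcat1 he (word0 [::]) tcat0l add0r.
by rewrite tmap_cat (tmap_word g [:: e]).
Qed.

Lemma sand_opp C (e : C) z : sand (word [:: - e]) z = - sand (word [:: e]) z.
Proof.
move: z; apply: (@tens_ext _ _ _ _ (sand (word [:: - e])) (\- sand (word [:: e]))) => u v /=.
rewrite !sand_ten -linearN; congr tcat; rewrite -tcatNl; congr tcat.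
have := word_multilinear [::] [::] (-1) e 0.
by rewrite /= addr0 (word0 [::]) addr0 !scaleN1r.
Qed.

Lemma pr0P C a (x y : tensalg C) :
  (pr0 (a *: x + y) : R) = a * (pr0 x : R) + (pr0 y : R).
Proof. exact: (linearP (@pr0 R C)). Qed.

(** A word with a marked letter has length one only if nothing surrounds this
    letter. *)
Lemma pr1_sand C (e : C) u v :
  pr1 (sand (word [:: e]) (ten u v)) = (pr0 u * pr0 v : R) *: e.
Proof.
rewrite sand_ten; move: u.
have lin : linear (fun u : tensalg C => (pr0 u * pr0 v : R) *: e).
  by move=> a x y; rewrite pr0P mulrDl scalerDl scalerA mulrA.
apply: (@talg_ext _ _ _ (@pr1 R C \o tcatl (tcat (word [:: e]) v))
  (mk_linear lin)) => s /=; rewrite /tcatl.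
have lin' : linear (fun v : tensalg C => (pr0 (word s) * pr0 v : R) *: e).
  by move=> a x y; rewrite pr0P mulrDr scalerDl scalerA mulrCA.
clear lin; move: v; apply: (@talg_ext _ _ _
  (@pr1 R C \o (tcat (word s) \o tcat (word [:: e]))) (mk_linear lin')) => s' /=.
rewrite !tcat_word pr1_word !pr0_word.
by clear lin'; case: s => [|x [|y s]]; case: s' => [|y' s'] /=;
  rewrite ?mul0r ?mulr0 ?mulr1 ?scale1r ?scale0r.
Qed.

Definition counl C (z : tens (tensalg C) (tensalg C)) : tensalg C :=
  blift (fun p => (pr0 p.1 : R) *: p.2) z.
Definition counr C (z : tens (tensalg C) (tensalg C)) : tensalg C :=
  blift (fun p => (pr0 p.2 : R) *: p.1) z.
Lemma counl_bilinear C :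
  bilinear2 (fun p : tensalg C * tensalg C => (pr0 p.1 : R) *: p.2).
Proof.
split=> a x x' y /=; first by rewrite pr0P scalerDl scalerA.
by rewrite scalerDr !scalerA mulrC.
Qed.
Lemma counr_bilinear C :
  bilinear2 (fun p : tensalg C * tensalg C => (pr0 p.2 : R) *: p.1).
Proof.
split=> a x x' y /=; last by rewrite pr0P scalerDl scalerA.
by rewrite scalerDr !scalerA mulrC.
Qed.
HB.instance Definition _ C :=
  GRing.isLinear.Build R _ _ _ (@counl C) (ulift_linear (@counl_bilinear C)).
HB.instance Definition _ C :=
  GRing.isLinear.Build R _ _ _ (@counr C) (ulift_linear (@counr_bilinear C)).
Lemma counl_ten C (u v : tensalg C) : counl (ten u v) = (pr0 u : R) *: v.
Proof. exact/blift_ten/counl_bilinear. Qed.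
Lemma counr_ten C (u v : tensalg C) : counr (ten u v) = (pr0 v : R) *: u.
Proof. exact/blift_ten/counr_bilinear. Qed.

Lemma lin_counl C C' (k : {linear tensalg C -> tensalg C'}) (f : {linear C -> C'}) z :
  k (counl z) = counl (tensmap (tmap f) k z).
Proof.
move: z; apply: (@tens_ext _ _ _ _ (k \o @counl C) (@counl C' \o tensmap (tmap f) k)) => u v /=.
by rewrite tensmap_ten !counl_ten linearZ /= pr0_tmap.
Qed.
Lemma lin_counr C C' (k : {linear tensalg C -> tensalg C'}) (f : {linear C -> C'}) z :
  k (counr z) = counr (tensmap k (tmap f) z).
Proof.
move: z; apply: (@tens_ext _ _ _ _ (k \o @counr C) (@counr C' \o tensmap k (tmap f))) => u v /=.
by rewrite tensmap_ten !counr_ten linearZ /= pr0_tmap.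
Qed.
End Sandwich.

(** * Coderivations of the tensor algebra *)

Section Coderivation.
Variables (R : comNzRingType) (C : lmodType R).
Variables (s : {linear C -> C}) (F : {linear tensalg C -> tensalg C}).
Hypothesis F0 : forall t, pr0 (F t) = 0.
Hypothesis FD : forall t, deconc (F t) =
  tensmap F idfun (deconc t) + tensmap (tmap s) F (deconc t).

Definition headpart (w : seq C) : tensalg C :=
  \sum_(j < (size w).+1) word (pr1 (F (word (take j w))) :: drop j w).

Lemma coder_nil : F (word [::]) = headpart [::].
Proof.
rewrite [LHS]headmul_deconc F0 scale0r add0r FD deconc_nil linearD /= !tensmap_ten.
rewrite !headmul_ten /= /headpart big_ord1 /= tcat_word.
by rewrite tmap_word pr1_word (word0 [::]) tcat0l addr0.
Qed.

(** F acts either on a beginning of the word, or past its first letter. *)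
Lemma coder_cons x w : F (word (x :: w)) =
  headpart (x :: w) + tcat (word [:: s x]) (F (word w)).
Proof.
rewrite [LHS]headmul_deconc F0 scale0r add0r FD linearD /= deconc_word.
rewrite (linear_sum (tensmap F idfun)) (linear_sum (tensmap (tmap s) F)) /=.
rewrite !(linear_sum (@headmul R C)) -big_split /=.
under eq_bigr => i _ do
  rewrite /= /cutw !tensmap_ten !headmul_ten /= tcat_word tmap_word pr1_word.
rewrite big_split; congr (_ + _).
rewrite big_ord_recl big_ord_recl /= (word0 [::]) tcat0l add0r take0 drop0.
rewrite big1 ?addr0 // => i _.
by case: w i => [[]|y w i] //=; rewrite (word0 [::]) tcat0l.
Qed.

(** The same sum with F applied to p followed by a beginning of w; keeping p as an
    accumulator makes induction along w possible. *)
Fixpoint headfrom (p w : seq C) : tensalg C :=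
  word (pr1 (F (word p)) :: w) +
  if w is x :: w' then headfrom (rcons p x) w' else 0.

Lemma headfromE p w : headfrom p w =
  \sum_(j < (size w).+1) word (pr1 (F (word (p ++ take j w))) :: drop j w).
Proof.
elim: w p => [|x w IH] p; first by rewrite big_ord1 /= cats0 addr0.
rewrite big_ord_recl /= cats0 IH; congr (_ + _).
by apply: eq_bigr => j _; rewrite cat_rcons.
Qed.

Lemma headpartE w : headpart w = headfrom [::] w.
Proof. by rewrite headfromE. Qed.

Variables (e : C) (c : R).
Hypothesis se : s e = - e.
Hypothesis Fex : forall x, pr1 (F (word [:: e; x])) = c *: x.
Hypothesis Fxe : forall x, pr1 (F (word [:: x; e])) = - c *: s x.
Hypothesis Fe0 : forall s1 s2, (size s1 + size s2 != 1)%N ->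
  pr1 (F (word (s1 ++ e :: s2))) = 0.

(** F is always applied to at least three letters, one of them e. *)
Lemma headfrom_unit0 s1 s2 w : (1 < size s1 + size s2)%N ->
  headfrom (s1 ++ e :: s2) w = 0.
Proof.
elim: w s2 => [|x w IH] s2 sz /=; rewrite Fe0 ?(word0 [::]) ?add0r //.
- by case: (_ + _)%N sz => [|[]].
- by rewrite rcons_cat rcons_cons IH // size_rcons addnS ltnS ltnW.
by case: (_ + _)%N sz => [|[]].
Qed.

(** The terms are separated according to whether F reaches the letter e. *)
Lemma headfrom_cat p u v : headfrom p (u ++ e :: v) =
  tcat (headfrom p u) (word (e :: v)) + headfrom (p ++ u ++ [:: e]) v.
Proof.
elim: u p => [|x u IH] p /=.
  by rewrite addr0 tcat_word cats1.
by rewrite IH cat_rcons tcatDl tcat_word addrA.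
Qed.

Lemma wordZ (a : R) x w : word (a *: x :: w) = a *: word (x :: w) :> tensalg C.
Proof.
have := word_multilinear [::] w a x 0.
by rewrite /= addr0 (word0 [::]) addr0.
Qed.

(** By induction on u. The letter e is absorbed by F only together with one of its
    neighbours, and for a letter between two others these two terms cancel. *)
Lemma coder_unit_word u v : F (word (u ++ e :: v)) =
  tcat (F (word u)) (word (e :: v)) -
  tcat (word [seq s x | x <- u]) (tcat (word [:: e]) (F (word v))) +
  c *: ((u == [::])%:R *: word v - (v == [::])%:R *: word [seq s x | x <- u]).
Proof.
have opw (w : tensalg C) : tcat (word [:: - e]) w = - tcat (word [:: e]) w.
  have := word_multilinear [::] [::] (-1) e 0.
  by rewrite /= addr0 (word0 [::]) addr0 !scaleN1r => ->; rewrite tcatNl.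
elim: u => [|x u IH].
  have -> : F (word ([::] ++ e :: v)) = headfrom [::] (e :: v) - tcat (word [:: e]) (F (word v)).
    by rewrite coder_cons se opw headpartE.
  have -> : headfrom [::] (e :: v) = tcat (F (word [::])) (word (e :: v)) + headfrom [:: e] v.
    by rewrite coder_nil headpartE -(headfrom_cat [::] [::]).
  rewrite addrAC tcat1l scale1r; congr (_ + _).
  case: v => [|y v] /=; rewrite (Fe0 (s1 := [::]) (s2 := [::])) // (word0 [::]) add0r.
    by rewrite scale1r subrr scaler0.
  rewrite scale0r subr0 -wordZ -Fex.
  case: v => [|z v] /=; first by rewrite addr0.
  by rewrite (headfrom_unit0 (s1 := [::]) (s2 := [:: y; z])) // addr0.
have -> : F (word ((x :: u) ++ e :: v)) =
    headfrom [::] ((x :: u) ++ e :: v) + tcat (word [:: s x]) (F (word (u ++ e :: v))).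
  by rewrite coder_cons headpartE.
rewrite headfrom_cat IH coder_cons headpartE tcatDl /= scale0r add0r.
rewrite !linearD /=.
(* F takes in e: only F applied to the two letters x, e contributes. *)
have -> : headfrom (x :: u ++ [:: e]) v =
    - c *: ((u == [::])%:R *: word (s x :: v)).
  case: u {IH} => [|y u] /=; last first.
    by rewrite scale0r scaler0 (headfrom_unit0 (s1 := [:: x, y & u]) (s2 := [::])).
  rewrite scale1r -wordZ -Fxe.
  case: v => [|z v] /=; first by rewrite addr0.
  by rewrite (headfrom_unit0 (s1 := [:: x]) (s2 := [:: z])) // addr0.
rewrite !(linearN (tcat _)) !(linearZ_LR (tcat _)) /= !scaleN1r.
rewrite !tcatA !tcat_word /= scaleNr.
by rewrite (AC (2*(2*2)) (((2*5)*(1*3*4))*6)) /= addNr add0r.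
Qed.

(** The coefficients of a coderivation of the bar coalgebra with strict unit e
    satisfy the hypotheses with c = 1 at energy zero, and c = 0 otherwise. *)
Lemma coder_unit z : F (sand (word [:: e]) z) =
  sand (word [:: e]) (tensmap F idfun z) - sand (word [:: e]) (tensmap (tmap s) F z) +
  c *: (counl z - tmap s (counr z)).
Proof.
move: z; apply: (@tens_word_ext _ _ _ _ (F \o sand (word [:: e]))
  (((sand (word [:: e]) \o tensmap F idfun) \- (sand (word [:: e]) \o tensmap (tmap s) F))
   \+ (c \*: (@counl R C \- (tmap s \o @counr R C))))) => u v /=.
rewrite !tensmap_ten !sand_ten /= counl_ten counr_ten !tcat_word linearZ /= tmap_word !pr0_word.
exact: coder_unit_word.
Qed.
End Coderivation.

(** * Tensor products over the Novikov ring *)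

Section TensorFamilies.
Variables (K : realType) (R : comNzRingType) (G : dmonoid K).
Implicit Types M N L : lmodType R.

(** No Koszul signs for the formal variable appear here; this agrees with the signed
    product on all maps of interest, by odd_coef0. *)
Definition tenU M N (x : fam G M) (y : fam G N) : fam G (tens M N) :=
  fun g => \sum_(q \in [set q : gelt G * gelt G | q.1 + q.2 = g]) ten (x q.1) (y q.2).

Lemma tenU_symbol M N (x : fam G M) :
  linear (fun (v : N) => (fun g => ten (x g) v) : fam G (tens M N)).
Proof. by move=> a v v'; apply/funext => g; rewrite famD famZ ten_linearr. Qed.

(** As the product is linear over the Novikov ring in each variable, it can be
    compared with other maps on constant families. *)
Definition tenUr M N (x : fam G M) : lop G N (tens M N) :=
  lextr (mk_linear (@tenU_symbol M N x)).
Arguments tenUr {M N}.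
Lemma tenUrE M N (x : fam G M) (y : fam G N) : tenUr x y = tenU x y.
Proof. by []. Qed.

Lemma tenUl_symbol M N (y : fam G N) :
  linear (fun (u : M) => (fun g => ten u (y g)) : fam G (tens M N)).
Proof. by move=> a v v'; apply/funext => g; rewrite famD famZ ten_linearl. Qed.
Definition tenUl M N (y : fam G N) : lop G M (tens M N) :=
  lextr (mk_linear (@tenUl_symbol M N y)).
Arguments tenUl {M N}.
Lemma tenUlE M N (x : fam G M) (y : fam G N) : tenUl y x = tenU x y.
Proof.
apply/funext => g; rewrite /tenU /=/extr.
rewrite (reindex_fsbig (fun q : gelt G * gelt G => (q.2, q.1))
  [set q : gelt G * gelt G | q.1 + q.2 = g]) //.
split=> [q /=|[a b] [a' b'] _ _ [-> ->]|[a b] /= abg] //; first by rewrite addrC.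
by exists (b, a) => //=; rewrite addrC.
Qed.

Lemma tenU_mono M N (u : M) (v : N) : tenU (mono 0 u) (mono 0 v) = mono (0 : gelt G) (ten u v).
Proof.
rewrite -tenUrE [LHS]extr_mono; apply/funext => g /=.
by rewrite /mono; case: ifP; rewrite ?ten0l.
Qed.

(** Constant families of pure tensors generate the completed tensor product. *)
Lemma lop_tens_ext M N L (f g : lop G (tens M N) L) :
  (forall u v, f (tenU (mono 0 u) (mono 0 v)) = g (tenU (mono 0 u) (mono 0 v))) ->
  forall x, f x = g x.
Proof.
move=> fg; apply: lop_ext => w; have [r ->] := ten_span w.
rewrite linear_sum /= !linear_sum; apply: eq_bigr => p _ /=.
by rewrite !linearZ /= -tenU_mono fg.
Qed.

Section Lten.
Variables (M N M' N' : lmodType R) (f : lop G M M') (g : lop G N N').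

Lemma lten_bilinear : bilinear2 (fun p : M * N => tenU (f (mono 0 p.1)) (g (mono 0 p.2))).
Proof.
split=> a x x' y /=.
  by rewrite -!tenUlE !linearP.
by rewrite -!tenUrE !linearP.
Qed.

Definition lten : lop G (tens M N) (tens M' N') :=
  lextr (mk_linear (ulift_linear lten_bilinear)).

Lemma lten_tenU x y : lten (tenU x y) = tenU (f x) (g y).
Proof.
rewrite -tenUlE -[RHS]tenUlE; move: x.
apply: (lop_ext (f := lcomp lten (tenUl y)) (g := lcomp (tenUl (g y)) f)) => u.
rewrite !lcompE !tenUlE -!tenUrE; move: y.
apply: (lop_ext (f := lcomp lten (tenUr (mono 0 u)))
                (g := lcomp (tenUr (f (mono 0 u))) g)) => v.
rewrite !lcompE !tenUrE tenU_mono [LHS]extr_mono /=.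
exact: (blift_ten lten_bilinear).
Qed.
End Lten.

Lemma lten_comp M N M' N' M'' N'' (f : lop G M' M'') (g : lop G N' N'')
    (f' : lop G M M') (g' : lop G N N') x :
  lten f g (lten f' g' x) = lten (lcomp f f') (lcomp g g') x.
Proof.
move: x; apply: (lop_tens_ext (f := lcomp (lten f g) (lten f' g'))) => u v.
by rewrite ?lcompE ?laddE ?loppE !lten_tenU ?lidE ?lcompE ?laddE ?loppE.
Qed.

Lemma lten_ext M N M' N' (f1 f2 : lop G M M') (g1 g2 : lop G N N') x :
  (forall x, f1 x = f2 x) -> (forall x, g1 x = g2 x) -> lten f1 g1 x = lten f2 g2 x.
Proof.
move=> ff gg; move: x; apply: lop_tens_ext => u v.
by rewrite ?lcompE ?laddE ?loppE !lten_tenU ?lidE ?lcompE ?laddE ?loppE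
  ff gg.
Qed.

Lemma lten_id M N x : lten (@lid _ _ G M) (@lid _ _ G N) x = x.
Proof. by move: x; apply: (lop_tens_ext (g := lid G _)) => u v; rewrite lten_tenU !lidE. Qed.

Lemma lten_addl M N M' N' (f1 f2 : lop G M M') (g : lop G N N') x :
  lten (ladd f1 f2) g x = lten f1 g x + lten f2 g x.
Proof.
move: x; apply: (lop_tens_ext (g := ladd (lten f1 g) (lten f2 g))) => u v.
by rewrite ?lcompE ?laddE ?loppE !lten_tenU ?lidE ?lcompE ?laddE ?loppE
  -!tenUlE linearD.
Qed.
Lemma lten_addr M N M' N' (f : lop G M M') (g1 g2 : lop G N N') x :
  lten f (ladd g1 g2) x = lten f g1 x + lten f g2 x.
Proof.
move: x; apply: (lop_tens_ext (g := ladd (lten f g1) (lten f g2))) => u v.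
by rewrite ?lcompE ?laddE ?loppE !lten_tenU ?lidE ?lcompE ?laddE ?loppE
  -!tenUrE linearD.
Qed.
Lemma lten_oppl M N M' N' (f : lop G M M') (g : lop G N N') x :
  lten (lopp f) g x = - lten f g x.
Proof.
move: x; apply: (lop_tens_ext (g := lopp (lten f g))) => u v.
by rewrite ?lcompE ?laddE ?loppE !lten_tenU ?lidE ?lcompE ?laddE ?loppE
  -!tenUlE linearN.
Qed.
Lemma lten_oppr M N M' N' (f : lop G M M') (g : lop G N N') x :
  lten f (lopp g) x = - lten f g x.
Proof.
move: x; apply: (lop_tens_ext (g := lopp (lten f g))) => u v.
by rewrite ?lcompE ?laddE ?loppE !lten_tenU ?lidE ?lcompE ?laddE ?loppE
  -!tenUrE linearN.
Qed.
Lemma lten0l M N M' N' (f : lop G M M') (g : lop G N N') x :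
  (forall x, f x = 0) -> lten f g x = 0.
Proof.
move=> f0; rewrite -[RHS](subrr (lten f g x)); move: x.
apply: (lop_tens_ext (g := ladd (lten f g) (lopp (lten f g)))) => u v.
by rewrite laddE loppE subrr lten_tenU f0 -tenUlE linear0.
Qed.
Lemma lten0r M N M' N' (f : lop G M M') (g : lop G N N') x :
  (forall x, g x = 0) -> lten f g x = 0.
Proof.
move=> g0; rewrite -[RHS](subrr (lten f g x)); move: x.
apply: (lop_tens_ext (g := ladd (lten f g) (lopp (lten f g)))) => u v.
by rewrite laddE loppE subrr lten_tenU g0 -tenUrE linear0.
Qed.
Lemma lten_fuse M N M' N' M'' N'' (f : lop G M' M'') (g : lop G N' N'')
    (f' : lop G M M') (g' : lop G N N') (F : lop G M M'') (H : lop G N N'') x :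
  (forall y, f (f' y) = F y) -> (forall y, g (g' y) = H y) ->
  lten f g (lten f' g' x) = lten F H x.
Proof. by move=> fF gH; rewrite lten_comp; exact: lten_ext. Qed.
(** For composites whose factors are only known pointwise. *)
Lemma lten_fuse3 M N M1 N1 M2 N2 M3 N3 (f : lop G M2 M3) (g : lop G N2 N3)
    (f' : lop G M1 M2) (g' : lop G N1 N2) (f'' : lop G M M1) (g'' : lop G N N1)
    (F : lop G M M3) (H : lop G N N3) x :
  (forall y, f (f' (f'' y)) = F y) -> (forall y, g (g' (g'' y)) = H y) ->
  lten f g (lten f' g' (lten f'' g'' x)) = lten F H x.
Proof. by move=> fF gH; rewrite !lten_comp; exact: lten_ext. Qed.
Lemma lten_fuse3_0l M N M1 N1 M2 N2 M3 N3 (f : lop G M2 M3) (g : lop G N2 N3)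
    (f' : lop G M1 M2) (g' : lop G N1 N2) (f'' : lop G M M1) (g'' : lop G N N1) x :
  (forall y, f (f' (f'' y)) = 0) ->
  lten f g (lten f' g' (lten f'' g'' x)) = 0.
Proof. by move=> f0; rewrite !lten_comp; exact: lten0l. Qed.
Lemma lten_fuse3_0r M N M1 N1 M2 N2 M3 N3 (f : lop G M2 M3) (g : lop G N2 N3)
    (f' : lop G M1 M2) (g' : lop G N1 N2) (f'' : lop G M M1) (g'' : lop G N N1) x :
  (forall y, g (g' (g'' y)) = 0) ->
  lten f g (lten f' g' (lten f'' g'' x)) = 0.
Proof. by move=> g0; rewrite !lten_comp; exact: lten0r. Qed.
Lemma lten_lext M N M' N' (f : {linear M -> M'}) (g : {linear N -> N'}) x :
  lten (lext G f) (lext G g) x = lext G (tensmap f g) x.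
Proof.
move: x; apply: lop_tens_ext => u v.
by rewrite lten_tenU !lext_mono !tenU_mono lext_mono /= tensmap_ten.
Qed.
End TensorFamilies.

(** * Limits and geometric series *)

Section Limits.
Variables (K : realType) (R : comNzRingType) (G : dmonoid K).
Implicit Types M N L : lmodType R.

(** Convergence for the energy filtration. *)
Definition flim M (u : nat -> fam G M) (x : fam G M) : Prop :=
  forall e, exists N : nat, forall n, (N <= n)%N -> fil e (x - u n).

Lemma flim_unique M u (x y : fam G M) : flim u x -> flim u y -> x = y.
Proof.
move=> ux uy; apply/eqP; rewrite -subr_eq0; apply/eqP/fil_all => e.
have [n1 xn] := ux e; have [n2 yn] := uy e.
have /xn x1 := leq_maxl n1 n2; have /yn y1 := leq_maxr n1 n2.
have := filD x1 (filN y1); rewrite opprB addrA subrK.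
exact.
Qed.

Lemma flim_lin M N (f : {linear fam G M -> fam G N}) u x :
  (forall e x, fil e x -> fil e (f x)) -> flim u x -> flim (f \o u) (f x).
Proof.
move=> ff ux e; have [n0 xn] := ux e; exists n0 => n /xn /ff.
by rewrite linearB.
Qed.

Lemma flimP M a u v (x y : fam G M) : flim u x -> flim v y ->
  flim (fun n => a *: u n + v n) (a *: x + y).
Proof.
move=> ux vy e; have [n1 xn] := ux e; have [n2 yn] := vy e.
exists (maxn n1 n2) => n; rewrite geq_max => /andP[/xn x1 /yn y1].
have := filD (filZ a x1) y1; rewrite scalerBr opprD addrACA.
exact.
Qed.

Lemma flim_ext M u v (x : fam G M) : (forall n, u n = v n) -> flim u x -> flim v x.
Proof. by move=> uv ux e; have [n0 xn] := ux e; exists n0 => n /xn; rewrite uv. Qed.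

Lemma flim_shift M u (x : fam G M) : flim u x -> flim (fun n => u n.+1) x.
Proof. by move=> ux e; have [n0 xn] := ux e; exists n0 => n nn; apply: xn; exact: ltnW. Qed.

Lemma flim_cst M (x : fam G M) : flim (fun=> x) x.
Proof. by move=> e; exists 0%N => n _; rewrite subrr. Qed.

Lemma flim_fil M e u (x : fam G M) : (forall n, fil e (u n)) -> flim u x -> fil e x.
Proof.
move=> eu ux; have [n xn] := ux e; have := filD (xn n (leqnn n)) (eu n).
by rewrite subrK.
Qed.

Lemma flim_coef M u (x : fam G M) g : flim u x -> exists n, x g = u n g.
Proof.
move=> ux; have [n xn] := ux (en g + 1); exists n; apply/eqP; rewrite -subr_eq0.
by apply/eqP; apply: (xn n (leqnn n)); lra.
Qed.

Definition topnil M (T : fam G M -> fam G M) : Prop := forall x e,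
  exists N : nat, forall n, (N <= n)%N -> fil e (iter n T x).

(** Such an x is T^n x for all n. *)
Lemma topnil_fix M (T : fam G M -> fam G M) x : topnil T -> x = T x -> x = 0.
Proof.
move=> Tn Tx; apply: fil_all => e; have [n0 xn] := Tn x e.
have <- : iter n0 T x = x by elim: n0 {xn} => //= n ->.
exact: xn.
Qed.

(** D x = D (T^n x) has arbitrarily large energy. *)
Lemma topnil_fix_comp M N (T : fam G M -> fam G M) (D : fam G M -> fam G N) :
  topnil T -> (forall e x, fil e x -> fil e (D x)) ->
  (forall x, D x = D (T x)) -> forall x, D x = 0.
Proof.
move=> Tn Df DT x; apply: fil_all => e; have [n0 xn] := Tn x e.
have -> : D x = D (iter n0 T x) by elim: n0 {xn} => //= n ->.
exact/Df/xn.
Qed.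

Section Neumann.
Variables (M : lmodType R) (T : lop G M M).
Hypothesis Tn : topnil T.

Definition psums n x := \sum_(a < n) iter a T x.

Lemma psums_stable g k m x : (k <= m)%N ->
  (forall i, (k <= i)%N -> iter i T x g = 0) -> psums m x g = psums k x g.
Proof.
move=> km vanish; rewrite /psums !fam_sum [RHS](big_ord_widen m (fun i => iter i T x g)) //.
rewrite [LHS](bigID (fun i : 'I_m => (i < k)%N)) /= [X in _ + X]big1 ?addr0 // => i.
by rewrite -leqNgt => /vanish.
Qed.

(** At each exponent the partial sums are eventually constant. *)
Lemma neum_ex x : exists y, flim (psums ^~ x) y.
Proof.
have [N Nx] := choice (Tn x).
exists (fun g => psums (N (en g + 1)) x g) => e.
exists (N e) => n Nen g ge; rewrite famD famN; apply/eqP; rewrite subr_eq0; apply/eqP.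
have g1 : en g < en g + 1 by lra.
case/orP: (leq_total n (N (en g + 1))) => nN; last first.
  by apply/esym/psums_stable => // i /Nx /(_ g g1).
by apply: psums_stable => // i ni; exact: (Nx e i (leq_trans Nen ni) g ge).
Qed.

Definition neum_fun x := sval (cid (neum_ex x)).
Lemma neum_funP x : flim (psums ^~ x) (neum_fun x).
Proof. exact: svalP (cid (neum_ex x)). Qed.

Lemma iter_linear n : linear (iter n T).
Proof. by elim: n => [|n IH] a x y /=; rewrite ?(IH a x y) ?linearP. Qed.

Lemma psums_linear n : linear (psums n).
Proof.
move=> a x y; rewrite /psums scaler_sumr -big_split; apply: eq_bigr => i _.
exact: iter_linear.
Qed.

Lemma psumsS n x : psums n.+1 x = x + T (psums n x).
Proof. by rewrite /psums big_ord_recl linear_sum. Qed.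

Lemma psumsSr n x : psums n.+1 x = x + psums n (T x).
Proof.
rewrite /psums big_ord_recl; congr (_ + _); apply: eq_bigr => i _.
by rewrite -iterSr.
Qed.

Lemma psums_comm (f : {linear fam G M -> fam G M}) n x :
  (forall x, T (f x) = f (T x)) -> psums n (f x) = f (psums n x).
Proof.
move=> Tf; rewrite /psums linear_sum; apply: eq_bigr => i _ /=.
by elim: (nat_of_ord i) => //= k ->.
Qed.

Lemma neum_comm (f : {linear fam G M -> fam G M}) x :
  (forall e x, fil e x -> fil e (f x)) -> (forall x, T (f x) = f (T x)) ->
  neum_fun (f x) = f (neum_fun x).
Proof.
move=> ff Tf; apply: (flim_unique (neum_funP _)).
apply: (flim_ext _ (flim_lin ff (neum_funP x))) => n /=.
by rewrite psums_comm.
Qed.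

(** The geometric series of T; the limit inherits the properties of the partial
    sums, which commute with multiplication by monomials. *)
Definition neum : lop G M M.
Proof.
exists neum_fun.
- move=> a x y; apply: (flim_unique (neum_funP _)).
  apply: (flim_ext _ (flimP a (neum_funP x) (neum_funP y))) => n /=.
  by rewrite psums_linear.
- move=> e x ex; apply: (flim_fil _ (neum_funP x)) => n.
  elim: n => [|n IH]; first by rewrite /psums big_ord0.
  by rewrite psumsS; apply: filD => //; apply: lop_fil.
- move=> b x; apply: (neum_comm (f := shift b)) => [e y|y]; first exact: shift_fil.
  exact: lop_shift.
Defined.

Lemma neumP x : flim (psums ^~ x) (neum x). Proof. exact: neum_funP. Qed.

Lemma neum_fixl x : neum x = x + T (neum x).
Proof.
apply: (flim_unique (flim_shift (neumP x))).
have := flimP 1 (flim_cst x) (flim_lin (@lop_fil _ _ _ _ _ T) (neumP x)).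
by rewrite scale1r; apply: flim_ext => n /=; rewrite psumsS.
Qed.

Lemma neum_fixr x : neum x = x + neum (T x).
Proof.
apply: (flim_unique (flim_shift (neumP x))).
have := flimP 1 (flim_cst x) (neumP (T x)).
by rewrite scale1r; apply: flim_ext => n /=; rewrite psumsSr.
Qed.
End Neumann.
End Limits.

(** * Length and weight *)

Section Length.
Variables (K : realType) (R : comNzRingType).
Implicit Types M N : lmodType R.

(** A module with generators which have a length; for words and for pairs of
    words. *)
Record lgen M := LGen {
  lg_type : Type;
  lg_gen :> lg_type -> M;
  lg_size : lg_type -> nat;
  lg_span : forall z, exists u : seq (R * lg_type),
    z = \sum_(p <- u) p.1 *: lg_gen p.2 }.

(** The bound is a real number, since it is compared with energies; for negative t
    only zero remains. *)
Inductive inlen M (A : lgen M) (t : K) : M -> Prop :=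
| inlen0 : inlen A t 0
| inlenD a w z : (lg_size w)%:R <= t -> inlen A t z -> inlen A t (a *: A w + z).

Section OneModule.
Variables (M : lmodType R) (A : lgen M).

Lemma inlen_gen t w : (lg_size w)%:R <= t -> inlen A t (A w).
Proof.
move=> wt; rewrite -[A w]scale1r -[_ *: _]addr0; apply: inlenD => //.
exact: inlen0.
Qed.

Lemma inlen_add t x y : inlen A t x -> inlen A t y -> inlen A t (x + y).
Proof.
move=> xt yt; elim: xt => [|a w z wt _ IH]; first by rewrite add0r.
by rewrite -addrA; apply: inlenD.
Qed.

Lemma inlen_scale t a x : inlen A t x -> inlen A t (a *: x).
Proof.
elim=> [|b w z wt _ IH]; first by rewrite scaler0; apply: inlen0.
by rewrite scalerDr scalerA; apply: inlenD.
Qed.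

Lemma inlen_le t t' x : t <= t' -> inlen A t x -> inlen A t' x.
Proof.
move=> tt; elim=> [|b w z wt _ IH]; first exact: inlen0.
by apply: inlenD => //; apply: le_trans tt.
Qed.

Lemma inlen_sum t I (r : seq I) (P : pred I) (F : I -> M) :
  (forall i, P i -> inlen A t (F i)) -> inlen A t (\sum_(i <- r | P i) F i).
Proof.
by move=> Ft; apply: big_ind => //; [exact: inlen0 | exact: inlen_add].
Qed.

Lemma inlen_lt0 t x : t < 0 -> inlen A t x -> x = 0.
Proof.
move=> t0; case=> // a w z /(le_lt_trans)/(_ t0).
by rewrite ltNge ler0n.
Qed.

Lemma inlen_ex x : exists t, inlen A t x.
Proof.
have [u ->] := lg_span A x; elim: u => [|p u [t ut]].
  by exists 0; rewrite big_nil; apply: inlen0.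
exists ((lg_size p.2)%:R + `|t|); rewrite big_cons; apply: inlen_add.
  by apply/inlen_scale/inlen_gen; rewrite lerDl.
by apply: inlen_le ut; rewrite (le_trans (ler_norm t)) // lerDr.
Qed.
End OneModule.

Lemma inlen_lin M N (A : lgen M) (B : lgen N) (f : {linear M -> N}) r t x :
  (forall w, inlen B ((lg_size w)%:R + r) (f (A w))) ->
  inlen A t x -> inlen B (t + r) (f x).
Proof.
move=> fr; elim=> [|a w z wt _ IH]; first by rewrite linear0; apply: inlen0.
rewrite linearP; apply: inlen_add => //; apply: inlen_scale.
by apply: inlen_le (fr w); rewrite lerD2r.
Qed.

Lemma lgwords_span C (z : tensalg C) : exists u : seq (R * seq C),
    z = \sum_(p <- u) p.1 *: word p.2.
Proof. exact: word_span. Qed.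
Definition lgwords (C : lmodType R) : lgen (tensalg C) :=
  @LGen (tensalg C) (seq C) (@word R C) size (@lgwords_span C).

Section TensorLength.
Variables (M N : lmodType R) (A : lgen M) (B : lgen N).

Lemma lgtens_span z : exists u : seq (R * (lg_type A * lg_type B)),
  z = \sum_(p <- u) p.1 *: ten (A p.2.1) (B p.2.2).
Proof.
have [u ->] := ten_span z; elim: u => [|[a [x y]] u [v Ev]].
  by exists [::]; rewrite !big_nil.
suff [v' E] : exists v' : seq (R * (lg_type A * lg_type B)),
    ten x y = \sum_(p <- v') p.1 *: ten (A p.2.1) (B p.2.2).
  exists ([seq (a * p.1, p.2) | p <- v'] ++ v).
  rewrite big_cons Ev big_cat big_map /= E scaler_sumr; congr (_ + _).
  by apply: eq_bigr => p _; rewrite scalerA.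
have [ux ->] := lg_span A x; have [uy ->] := lg_span B y.
exists [seq (p.1 * q.1, (p.2, q.2)) | p <- ux, q <- uy].
rewrite big_allpairs_dep /= -[LHS]/(tenl M _ _) linear_sum; apply: eq_bigr => p _.
rewrite linearZ /= -[ten _ _]/(tenr N _ _) linear_sum scaler_sumr; apply: eq_bigr => q _.
by rewrite linearZ scalerA.
Qed.

Definition lgtens : lgen (tens M N) := @LGen (tens M N) (lg_type A * lg_type B)%type
  (fun p => ten (A p.1) (B p.2)) (fun p => (lg_size p.1 + lg_size p.2)%N) lgtens_span.

Lemma inlen_ten t t' x y : inlen A t x -> inlen B t' y -> inlen lgtens (t + t') (ten x y).
Proof.
elim=> [|a w z wt _ IH] yt; first by rewrite ten0l; apply: inlen0.
rewrite ten_linearl; apply: inlen_add; last exact: IH.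
apply: inlen_scale; elim: yt => [|b w' z' wt' _ IH']; first by rewrite ten0r; apply: inlen0.
rewrite ten_linearr; apply: inlen_add => //; apply: inlen_scale.
by apply: (@inlen_gen _ lgtens _ (w, w')) => /=; rewrite natrD lerD.
Qed.
End TensorLength.
End Length.

Section Weight.
Variables (K : realType) (R : comNzRingType) (G : dmonoid K) (c : K).
Hypothesis c0 : 0 < c.
Implicit Types M N : lmodType R.

(** Length minus (2 / c) energy is at most l. An operation which shortens words,
    or makes them longer by at most one letter and raises the energy by at least c,
    lowers this weight by one. *)
Definition wt M (A : lgen M) (l : K) (x : fam G M) : Prop :=
  forall b, inlen A (l + 2 * en b / c) (x b).

(** It suffices to know f on generators, by continuity. *)
Definition lowers M N (A : lgen M) (B : lgen N) (r : K) (f : lop G M N) : Prop :=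
  forall w, wt B ((lg_size w)%:R - r) (f (mono 0 (A w))).

Lemma enc_ge0 (b : gelt G) : 0 <= 2 * en b / c.
Proof. by rewrite divr_ge0 ?mulr_ge0 ?en_ge0 ?ltW. Qed.

Lemma wt_mono M (A : lgen M) l x : inlen A l x -> wt A l (mono 0 x).
Proof.
move=> xl b; rewrite /mono; case: ifP => _; last exact: inlen0.
by apply: inlen_le xl; rewrite lerDl enc_ge0.
Qed.

Lemma wt_add M (A : lgen M) l x y : wt A l x -> wt A l y -> wt A l (x + y).
Proof. by move=> xl yl b; apply: inlen_add. Qed.

Lemma wt_le M (A : lgen M) l l' x : l <= l' -> wt A l x -> wt A l' x.
Proof. by move=> ll xl b; apply: inlen_le (xl b); rewrite lerD2r. Qed.

Lemma lop_extr M N (f : lop G M N) x : f x = extr (fun w => f (mono 0 w)) x.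
Proof.
have lf : linear (fun w => f (mono 0 w)) by move=> a u v; rewrite !linearP.
move: x; apply: (lop_ext (g := lextr (mk_linear lf))) => w.
by rewrite [RHS](extr_mono (mk_linear lf)).
Qed.

Lemma lowers_wt M N (A : lgen M) (B : lgen N) r l (f : lop G M N) x :
  lowers A B r f -> wt A l x -> wt B (l - r) (f x).
Proof.
move=> fr xl g; rewrite lop_extr extrE big_seq_cond; apply: inlen_sum => q.
rewrite andbT in_fset_set; last exact: finite_dec.
move=> /set_mem /= <-; rewrite enD.
elim: (xl q.2) => [|a w z wl _ IH]; first by rewrite !linear0; apply: inlen0.
rewrite (linearP (@mono K R G M 0)) (linearP f) famD /= famZ.
apply: inlen_add => //; apply: inlen_scale.
apply: inlen_le (fr w q.1); lra.
Qed.

Lemma lowers_comp M N L (A : lgen M) (B : lgen N) (D : lgen L) r r'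
    (f : lop G N L) (g : lop G M N) :
  lowers B D r f -> lowers A B r' g -> lowers A D (r + r') (lcomp f g).
Proof.
move=> fr gr w; apply: (wt_le _ (lowers_wt fr (gr w))); lra.
Qed.

Lemma lowers_add M N (A : lgen M) (B : lgen N) r (f g : lop G M N) :
  lowers A B r f -> lowers A B r g -> lowers A B r (ladd f g).
Proof. by move=> fr gr w; apply: wt_add. Qed.

Lemma lowers_lext M N (A : lgen M) (B : lgen N) (F : {linear M -> N}) :
  (forall w, inlen B ((lg_size w)%:R : K) (F (A w))) -> lowers A B 0 (lext G F).
Proof. by move=> FA w; rewrite lext_mono subr0; apply: wt_mono. Qed.

Lemma lowers_lid M (A : lgen M) : lowers A A 0 (lid G M).
Proof. by move=> w; rewrite subr0; apply: wt_mono; apply: inlen_gen. Qed.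

Lemma wt_tenU M N (A : lgen M) (B : lgen N) l l' x y :
  wt A l x -> wt B l' y -> wt (lgtens A B) (l + l') (tenU x y).
Proof.
move=> xl yl g; rewrite /tenU fsbig_finite /=; last exact: finite_dec.
rewrite big_seq_cond; apply: inlen_sum => q.
rewrite andbT in_fset_set; last exact: finite_dec.
move=> /set_mem /= <-; rewrite enD.
apply: inlen_le (inlen_ten (xl q.1) (yl q.2)); lra.
Qed.

Lemma lowers_lten M N M' N' (A : lgen M) (B : lgen N) (A' : lgen M') (B' : lgen N')
    r r' (f : lop G M M') (g : lop G N N') :
  lowers A A' r f -> lowers B B' r' g -> lowers (lgtens A B) (lgtens A' B') (r + r') (lten f g).
Proof.
move=> fr gr [w w']; rewrite -[lgtens A B (w, w')]/(ten (A w) (B w')) -tenU_mono lten_tenU.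
by apply: wt_le (wt_tenU (fr w) (gr w')); rewrite natrD; lra.
Qed.

(** The weight of f^n x tends to minus infinity, while at a given exponent negative
    lengths do not occur. *)
Lemma lowers_topnil M (A : lgen M) (f : lop G M M) : lowers A A 1 f -> topnil f.
Proof.
move=> f1.
have wtn n l x : wt A l x -> wt A (l - n%:R) (iter n f x).
  elim: n => [|n IH] xl; first by rewrite subr0.
  by apply: wt_le (lowers_wt f1 (IH xl)); rewrite -natr1; lra.
have mono_nil w e : exists N : nat, forall n, (N <= n)%N -> fil e (iter n f (mono 0 w)).
  have [l wl] := inlen_ex K A w.
  pose N := (Num.bound `|l + 2 * `|e| / c|).+1.
  exists N => n Nn b be; apply: (inlen_lt0 _ (wtn n _ _ (wt_mono wl) b)).
  have lN : l + 2 * `|e| / c < n%:R.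
    apply: (le_lt_trans (ler_norm _)); apply: (lt_le_trans (archi_boundP (normr_ge0 _))).
    by rewrite ler_nat; apply: leq_trans Nn; exact: leqnSn.
  suff : 2 * en b / c <= 2 * `|e| / c by lra.
  rewrite ler_pM2r ?invr_gt0 // ler_pM2l // ltW //.
  exact: lt_le_trans be (ler_norm e).
move=> x e; have [s xs] := fam_trunc e x.
have [N NP] : exists N : nat, forall n, (N <= n)%N -> forall b, b \in s ->
    fil e (iter n f (mono 0 (x b))).
  elim: {xs} s => [|b s [N NP]]; first by exists 0%N.
  have [N' N'P] := mono_nil (x b) e; exists (maxn N N') => n.
  rewrite geq_max => /andP[nN nN'] b'; rewrite inE => /orP[/eqP ->|]; first exact: N'P.
  exact: NP.
have itfil n y : fil e y -> fil e (iter n f y).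
  by move=> ey; elim: n => //= n IH; apply: lop_fil.
have itsh n b y : iter n f (shift b y) = shift b (iter n f y).
  by elim: n => //= n ->; rewrite lop_shift.
exists N => n Nn; rewrite -[x](subrK (\sum_(b <- s) shift b (mono 0 (x b)))).
pose itL := mk_linear (iter_linear f n).
rewrite -[iter n f _]/(itL _) linearD; apply: filD; first exact: itfil.
rewrite linear_sum big_seq_cond; apply: big_ind => [|y z|b].
- exact: fil0.
- exact: filD.
rewrite andbT => bs; rewrite -[itL _]/(iter n f _) itsh; apply: shift_fil.
exact: NP.
Qed.
End Weight.

(** * Degrees and signs *)

Section Parity.

Lemma oddzD (i j : int) : oddz (i + j) = oddz i (+) oddz j.
Proof. rewrite /oddz; lia. Qed.
Lemma oddzN (i : int) : oddz (- i) = oddz i.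
Proof. by rewrite /oddz abszN. Qed.
Lemma Z2D (i j : 'Z_2) : (i + j != 0) = (i != 0) (+) (j != 0).
Proof. by case: i => [[|[|i]] ilt] //; case: j => [[|[|j]] jlt] //. Qed.
End Parity.

Section Graded.
Variables (K : realType) (R : gring K).
Implicit Types C : gmod R.

Lemma homog_proj C i (x : C) : homog i (gproj C i x).
Proof. by rewrite /homog gproj_proj eqxx. Qed.

Lemma homog0 C i : homog i (0 : C). Proof. exact: raddf0. Qed.

(** An element is the sum of its homogeneous components. *)
Lemma gmod_ind C (P : C -> Prop) : P 0 -> (forall x y, P x -> P y -> P (x + y)) ->
  (forall i x, homog i x -> P x) -> forall x, P x.
Proof.
move=> P0 PD Ph x; rewrite (@gproj_supp _ _ C x _ (@subset_refl _ _) (gproj_fin x)).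
rewrite fsbig_finite; last exact: gproj_fin.
by apply: big_ind => // i _; apply: (Ph i); exact: homog_proj.
Qed.

Lemma gring_ind (P : R -> Prop) : P 0 -> (forall x y, P x -> P y -> P (x + y)) ->
  (forall i x, homogR i x -> ~~ oddz i.1 -> i.2 = 0 -> P x) -> forall x, P x.
Proof.
move=> P0 PD Ph x; rewrite (rproj_sum x).
have Af := rproj_fin x; set A := [set i | rproj R i x != 0] in Af.
rewrite -(@fsbig_widen _ _ _ _ A) //; last first.
  by move=> i [_ /= /negP/negPn/eqP].
rewrite fsbig_finite // big_seq_cond; apply: big_ind => // i.
rewrite andbT in_fset_set // => /set_mem /= xi.
have [i1 i2] := rproj_even xi; apply: (Ph i) => //.
by rewrite /homogR rproj_proj eqxx.
Qed.

Section Sgop.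
Variables (C : gmod R) (s : deg -> bool).

Lemma sgop_supp A (x : C) : [set i | gproj C i x != 0] `<=` A -> finite_set A ->
  sgop s x = \sum_(i \in A) (-1) ^+ s i *: gproj C i x.
Proof.
move=> xA Af; apply/esym/fsbig_widen => // i [_ Ai] /=.
rewrite (_ : gproj C i x = 0) ?scaler0 //.
by apply: contrapT => /= /eqP xi; apply: Ai; exact: xA.
Qed.

Lemma sgop_homog i (x : C) : homog i x -> sgop s x = (-1) ^+ s i *: x.
Proof.
move=> xi; have sub : [set j | gproj C j x != 0] `<=` [set i].
  move=> j /= xj; apply: contrapT => /eqP ji; move: xj.
  by rewrite -xi gproj_proj (negbTE ji) eqxx.
by rewrite (sgop_supp sub (finite_set1 _)) fsbig_set1 [gproj C i x]xi.
Qed.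

Lemma sgopD (x y : C) : sgop s (x + y) = sgop s x + sgop s y.
Proof.
pose A := [set i | gproj C i x != 0] `|` [set i | gproj C i y != 0].
have Af : finite_set A by rewrite finite_setU; split; exact: gproj_fin.
rewrite !(@sgop_supp A) //; first last.
- move=> i /=; rewrite raddfD => xy; apply: contrapT => /not_orP[/= /negP/negPn/eqP xi].
  by move=> /negP/negPn/eqP yi; move: xy; rewrite xi yi addr0 eqxx.
- by move=> i xi; left.
- by move=> i yi; right.
rewrite !fsbig_finite //= -big_split; apply: eq_bigr => i _ /=.
by rewrite raddfD scalerDr.
Qed.

Lemma sgop0 : sgop s (0 : C) = 0.
Proof. by rewrite (sgop_homog (homog0 _ 0)) scaler0. Qed.

Hypothesis sE : forall i j : deg, ~~ oddz i.1 -> i.2 = 0 -> s (i + j) = s j.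

(** The scalars have even degree, so that they do not affect the sign. *)
Lemma sgop_linear : linear (@sgop _ _ C s).
Proof.
move=> a x y; rewrite sgopD; congr (_ + _); move: a x.
apply: gring_ind => [x|a b IHa IHb x|i a ai i1 i2].
- by rewrite !scale0r sgop0.
- by rewrite !scalerDl sgopD IHa IHb.
apply: gmod_ind => [|x y' IHx IHy|j x xj].
- by rewrite scaler0 sgop0 scaler0.
- by rewrite scalerDr !sgopD IHx IHy scalerDr.
rewrite (sgop_homog xj) (@sgop_homog (i + j)); last exact: gprojZ.
by rewrite sE // !scalerA mulrC.
Qed.
End Sgop.

Lemma sgop_deg C C' (f : {linear C -> C'}) k (s s' : deg -> bool) x :
  has_deg k f -> (forall i, s' (i + k) = s i) -> f (sgop s x) = sgop s' (f x).
Proof.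
move=> fk ss; move: x; apply: gmod_ind => [|x y IHx IHy|i x xi].
- by rewrite sgop0 !linear0 sgop0.
- by rewrite sgopD !linearD sgopD IHx IHy.
by rewrite (sgop_homog _ xi) (sgop_homog _ (fk _ _ xi)) linearZ /= ss.
Qed.

Lemma sgop_sgop C s s' (x : C) : sgop s (sgop s' x) = sgop (fun i => s i (+) s' i) x.
Proof.
move: x; apply: gmod_ind => [|x y IHx IHy|i x xi].
- by rewrite !sgop0.
- by rewrite !sgopD IHx IHy.
rewrite (sgop_homog s' xi) (sgop_homog (fun i => s i (+) s' i) xi).
rewrite (@sgop_homog _ s i) ?scalerA ?signr_addb //.
rewrite /homog; case: (s' i); rewrite ?scale1r // ?scaleN1r ?raddfN.
by congr (- _).
Qed.

Lemma sgop_id C s (x : C) : (forall i, s i = false) -> sgop s x = x.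
Proof.
move=> s0; move: x; apply: gmod_ind => [|x y IHx IHy|i x xi].
- by rewrite sgop0.
- by rewrite sgopD IHx IHy.
by rewrite (sgop_homog s xi) s0 scale1r.
Qed.

Lemma shsgn_linear C : linear (@shsgn _ _ C).
Proof. by apply: sgop_linear => i j i1 i2; rewrite oddzD (negbTE i1). Qed.
Lemma cdsgn_linear C : linear (@cdsgn _ _ C).
Proof. by apply: sgop_linear => i j i1 i2; rewrite oddzD (negbTE i1). Qed.
Lemma parsgn_linear C : linear (@parsgn _ _ C).
Proof.
by apply: sgop_linear => i j i1 i2; rewrite oddzD (negbTE i1) [(i + j).2]/= i2 add0r.
Qed.
HB.instance Definition _ C := GRing.isLinear.Build R C C _ (@shsgn _ _ C) (@shsgn_linear C).
HB.instance Definition _ C := GRing.isLinear.Build R C C _ (@cdsgn _ _ C) (@cdsgn_linear C).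
HB.instance Definition _ C := GRing.isLinear.Build R C C _ (@parsgn _ _ C) (@parsgn_linear C).

Lemma shsgnK C (x : C) : shsgn (shsgn x) = x.
Proof. by rewrite [LHS]sgop_sgop sgop_id // => i; rewrite addbb. Qed.
Lemma cdsgnK C (x : C) : cdsgn (cdsgn x) = x.
Proof. by rewrite [LHS]sgop_sgop sgop_id // => i; rewrite addbb. Qed.
Lemma parsgnK C (x : C) : parsgn (parsgn x) = x.
Proof. by rewrite [LHS]sgop_sgop sgop_id // => i; rewrite addbb. Qed.
Lemma sgop_neg C s s' (x : C) : (forall i, s i = ~~ s' i) -> sgop s x = - sgop s' x.
Proof.
move=> ss; move: x; apply: gmod_ind => [|x y IHx IHy|i x xi].
- by rewrite !sgop0 oppr0.
- by rewrite !sgopD IHx IHy opprD.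
rewrite !(sgop_homog _ xi) ss.
by case: (s' i); rewrite ?expr0 ?expr1 ?scaleN1r ?scale1r ?opprK.
Qed.

Lemma shsgnE C (x : C) : shsgn x = - cdsgn x.
Proof. exact: sgop_neg. Qed.
Lemma par_shsgn C (x : C) : parsgn (shsgn x) = shsgn (parsgn x).
Proof.
rewrite /parsgn /shsgn !sgop_sgop; congr (sgop _ x).
by apply/funext => i; rewrite addbC.
Qed.

Lemma sgn_even C C' (f : {linear C -> C'}) x : has_deg (0 : deg) f ->
  [/\ shsgn (f x) = f (shsgn x), cdsgn (f x) = f (cdsgn x) &
      parsgn (f x) = f (parsgn x)].
Proof.
move=> f0; split; apply/esym/(sgop_deg (k := 0)) => // i; by rewrite addr0.
Qed.

Lemma sgn_odd C C' (k : deg) (f : {linear C -> C'}) x :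
  has_deg k f -> oddz k.1 -> k.2 = 0 ->
  [/\ shsgn (f x) = - f (shsgn x), cdsgn (f x) = - f (cdsgn x) &
      parsgn (f x) = - f (parsgn x)].
Proof.
move=> fk k1 k2.
have H (s : deg -> bool) : (forall i, s (i + k) = ~~ s i) -> sgop s (f x) = - f (sgop s x).
  move=> sk; rewrite (sgop_deg (s' := fun i => ~~ s i) x fk) => [|i]; last first.
    by rewrite sk negbK.
  by apply: sgop_neg => i; rewrite negbK.
split; apply: H => i; rewrite oddzD k1 /= ?addbT // k2 addr0.
by case: (oddz _); case: (_ != _).
Qed.
End Graded.

(** * Degrees of tensors *)

Section TensorDegrees.
Variables (K : realType) (R : gring K).
Implicit Types C : gmod R.

Lemma homogT0 C i : homogT i (0 : tensalg C).
Proof. by exists [::]; rewrite ?big_nil. Qed.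

Lemma homogTD C i (x y : tensalg C) : homogT i x -> homogT i y -> homogT i (x + y).
Proof.
move=> [u ui ->] [v vi ->]; exists (u ++ v); last by rewrite big_cat.
by move=> p; rewrite mem_cat => /orP[/ui|/vi].
Qed.


Lemma homogTZ C i j a (x : tensalg C) : homogR j a -> homogT i x -> homogT (j + i) (a *: x).
Proof.
move=> aj [u ui ->]; exists [seq (a * p.1, p.2) | p <- u]; last first.
  by rewrite big_map scaler_sumr; apply: eq_bigr => p _; rewrite scalerA.
move=> _ /mapP[p /ui [k pk wk] ->] /=; exists (j + k); first exact: rprojM.
by rewrite opprD addrACA subrr add0r.
Qed.

Lemma homogT_word C i (w : seq C) : homogw i w -> homogT i (word w).
Proof.
move=> wi; exists [:: (1, w)]; last by rewrite big_seq1 scale1r.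
by move=> p; rewrite inE => /eqP -> /=; exists 0; [exact: rproj1 | rewrite subr0].
Qed.

Lemma homogTN C i (x : tensalg C) : homogT i x -> homogT i (- x).
Proof.
move=> xi; rewrite -scaleN1r -[i]add0r; apply: homogTZ xi.
by rewrite /homogR linearN /= rproj1.
Qed.

Lemma homogT_sum C i I (r : seq I) (P : pred I) (F : I -> tensalg C) :
  (forall k, P k -> homogT i (F k)) -> homogT i (\sum_(k <- r | P k) F k).
Proof. by move=> Fi; apply: big_ind => //; [exact: homogT0 | exact: homogTD]. Qed.

Definition degT C C' (k : deg) (F : tensalg C -> tensalg C') : Prop :=
  forall i t, homogT i t -> homogT (i + k) (F t).

Lemma degT_words C C' k (F : {linear tensalg C -> tensalg C'}) :
  (forall i w, homogw i w -> homogT (i + k) (F (word w))) -> degT k F.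
Proof.
move=> Fk i _ [u ui ->]; rewrite linear_sum big_seq; apply: homogT_sum => p /ui.
move=> [j pj wj]; rewrite linearZ /=.
rewrite (_ : i + k = j + (i - j + k)); last by rewrite addrA addrCA subrr addr0.
by apply: homogTZ => //; apply: Fk.
Qed.

Lemma homogw_map C C' (f : {linear C -> C'}) i w :
  has_deg (0 : deg) f -> homogw i w -> homogw i (map f w).
Proof.
move=> f0; elim: w i => //= x w IH i [j xj wj]; exists j; last exact: IH.
by have := f0 _ _ xj; rewrite addr0.
Qed.

Lemma degT_tmap C C' (f : {linear C -> C'}) : has_deg (0 : deg) f -> degT 0 (tmap f).
Proof.
move=> f0; apply: degT_words => i w wi; rewrite addr0 /= tmap_word.
exact/homogT_word/homogw_map.
Qed.

Lemma degT_cat1 C j (x : C) : homog j x -> degT (j - (1, 0)) (tcat (word [:: x])).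
Proof.
move=> xj; apply: degT_words => i w wi; rewrite /= tcat_word; apply: homogT_word => /=.
by exists j => //; rewrite addrK.
Qed.

Lemma degT_ins C (k : deg) (f h g : {linear C -> C}) :
  has_deg (0 : deg) f -> has_deg k h -> has_deg (0 : deg) g -> degT k (insert f h g).
Proof.
move=> f0 hk g0; apply: degT_words => i w; elim: w i => [|x w IH] i.
  by rewrite /= ins_nil => _; apply: homogT0.
move=> [j xj wj]; rewrite /= ins_cons; apply: homogTD.
  rewrite tmap_word tcat_word; apply: homogT_word => /=; exists (j + k); first exact: hk.
  suff -> : i + k - (j + k - (1, 0)) = i - (j - (1, 0)) by exact: homogw_map.
  by rewrite [j + k - _]addrAC opprD addrACA subrr addr0.
have := degT_cat1 (f0 _ _ xj) (IH _ wj).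
by rewrite addr0 addrAC subrK.
Qed.

(** Each letter is a sum of homogeneous ones, and F is multilinear in the
    letters. *)
Lemma homog_words_ext C (M : lmodType R) (F : {linear tensalg C -> M}) :
  (forall i w, homogw i w -> F (word w) = 0) -> forall t, F t = 0.
Proof.
move=> F0; suff Fw p w : (exists i, homogw i p) -> F (word (p ++ w)) = 0.
  move=> t; apply: (@talg_ext _ _ _ F \0) => w; apply: (Fw [::]).
  by exists 0.
elim: w p => [|x w IH] p pi; first by case: pi => i; rewrite cats0; apply: F0.
have lin : linear (fun x => F (word (p ++ x :: w))).
  by move=> a y z; rewrite word_multilinear linearP.
move: x; apply: gmod_ind => [|x y Fx Fy|j x xj].
- exact: (linear0 (mk_linear lin)).
- by rewrite -[LHS]/(mk_linear lin _) linearD /= Fx Fy addr0.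
rewrite -cat_rcons; apply: IH; case: pi => i pi.
exists (i + (j - (1, 0))).
elim: p i pi {lin} => [|y p IH'] i /=.
  by move=> ->; exists j => //; rewrite add0r subrr.
move=> [l yl pl]; exists l => //.
by have := IH' _ pl; rewrite addrAC.
Qed.

Lemma tparsgn_word C i (w : seq C) : homogw i w ->
  tparsgn (word w) = (-1) ^+ (oddz i.1 (+) (i.2 != 0)) *: word w.
Proof.
rewrite [tparsgn _]tmap_word; elim: w i => [|x w IH] i /=.
  by move=> ->; rewrite scale1r.
move=> [j xj wj]; rewrite word_cons (IH _ wj) [parsgn x](sgop_homog _ xj).
rewrite wordZ tcatZl linearZ /= tcat_word scalerA -signr_addb; congr (_ ^+ _ *: _).
move Ek : (i - (j - (1, 0))) => k; have ik : i = k + (j - (1, 0)) by rewrite -Ek subrK.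
have e1 : oddz i.1 = oddz k.1 (+) (oddz j.1 (+) true).
  by rewrite [in LHS]ik [(k + _).1]/= !oddzD.
have e2 : (i.2 != 0) = (k.2 != 0) (+) (j.2 != 0).
  by rewrite [in LHS]ik [(k + _).2]/= oppr0 addr0 Z2D.
rewrite e1 e2 (congr1 fst Ek : i.1 - (j.1 - 1) = k.1) (congr1 snd Ek : i.2 - (j.2 - 0) = k.2).
by case: (oddz j.1); case: (j.2 != 0); case: (oddz k.1); case: (k.2 != 0).
Qed.

Lemma tparsgn_homog C i (t : tensalg C) : homogT i t ->
  tparsgn t = (-1) ^+ (oddz i.1 (+) (i.2 != 0)) *: t.
Proof.
move=> [u ui ->]; rewrite [tparsgn _]linear_sum scaler_sumr big_seq [RHS]big_seq.
apply: eq_bigr => p /ui [j pj]; rewrite linearZ /= -[tmap _ _]/(tparsgn _).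
move Ek : (i - j) => k wj; have {Ek} ik : i = k + j by rewrite -Ek subrK.
have [->|p0] := eqVneq p.1 0; first by rewrite !scale0r scaler0.
rewrite (tparsgn_word wj) !scalerA mulrC; congr (_ ^+ _ * _ *: _).
have [] := @rproj_even _ R j p.1; first by rewrite [rproj _ _ _]pj.
move=> j1 j2; rewrite ik [(k + j).1]/= [(k + j).2]/= oddzD (negbTE j1) addbF.
by rewrite Z2D j2 eqxx addbF.
Qed.

End TensorDegrees.

(** * Maps of bar coalgebras *)

Section BarMaps.
Variables (K : realType) (R : gring K) (G : dmonoid K).
Implicit Types C : gmod R.
Local Notation lp C C' := (lop G (tensalg C) (tensalg C')).

Definition lsgn C : lp C C := lext G (tmap (@shsgn _ _ C)).
Definition lpar C : lp C C := lext G (tmap (@parsgn _ _ C)).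
Definition ldelta C : lop G (tensalg C) (tens (tensalg C) (tensalg C)) :=
  lext G (@deconc R C).
Definition lcounit C : lop G (tensalg C) R^o := lext G (@pr0 R C).

(** Moving a monomial to the right costs a sign only if its degree is odd. *)
Lemma lactE C b (x : bar G C) : lact b x = shift b (if oddz (mu b) then lpar C x else x).
Proof.
apply/funext => g; rewrite /lact /shift.
rewrite (_ : [set a | b + a = g] = [set a | a + b = g]); last first.
  by apply/funext => a; rewrite /= addrC.
by apply: eq_fsbigr => a _; rewrite /epssgn; case: ifP.
Qed.

Lemma shift_inj (M : lmodType R) (b : gelt G) : injective (@shift _ R G M b).
Proof. by move=> x y xy; apply/funext => a; rewrite -(shiftE b x) xy shiftE. Qed.

Definition degB C C' (k : deg) (f : bar G C -> bar G C') : Prop :=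
  forall i x, homogB i x -> homogB (i + k) (f x).

(** Compatibility with the left action: only odd powers of the formal variable
    produce signs, and there may be none. *)
Definition parB C C' (s : bool) (f : lp C C') : Prop :=
  (exists b : gelt G, oddz (mu b)) ->
  forall x, f (lpar C x) = (-1) ^+ s *: lpar C' (f x).

Definition lop_of C C' k (f : {linear bar G C -> bar G C'}) (fk : bimod_map k f) : lp C C' :=
  Lop (fun a x y => linearP f a x y) (bm_fil fk) (bm_ract fk).

Lemma bimod_par C C' k (f : {linear bar G C -> bar G C'}) (fk : bimod_map k f) :
  parB (odd k) (lop_of fk).
Proof.
move=> [b bo] x; apply: (@shift_inj _ b).
have := bm_lact fk b x; rewrite !lactE bo muln1 signr_odd => E.
have -> : shift b (lop_of fk (lpar C x)) = f (shift b (lpar C x)).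
  exact/esym/(lop_shift (lop_of fk)).
by rewrite E linearZ.
Qed.

Lemma lop_bimod C C' k (f : lp C C') :
  degB ((k%:Z, 0) : deg) f -> parB (odd k) f -> bimod_map k f.
Proof.
move=> fd fp; split.
- exact: lop_fil.
- exact: fd.
- exact: (lop_shift f).
move=> b x; rewrite !lactE lop_shift.
case: (boolP (oddz (mu b))) => bo; last by rewrite muln0 scale1r.
by rewrite fp ?muln1 ?signr_odd; [exact: linearZ | exists b].
Qed.

Lemma homogB_word C i (w : seq C) : homogw i w -> homogB i (mono (0 : gelt G) (word w)).
Proof.
move=> wi b; rewrite /mono; case: eqP => [->|_]; last exact: homogT0.
by rewrite mu0 -[(0, 0)]/(0 : deg) subr0; apply: homogT_word.
Qed.

(** The coefficient at an odd exponent shifts degrees by an odd amount more than f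
    does, so that its commutation with the parity operator holds with both signs;
    as 2 is invertible, it vanishes. *)
Lemma odd_coef0 C C' k (f : lp C C') t a :
  degB ((k%:Z, 0) : deg) f -> parB (odd k) f ->
  oddz (mu a) -> f (mono 0 t) a = 0.
Proof.
move=> fd fp ao; have lin : linear (fun t => f (mono 0 t) a).
  by move=> r u v; rewrite (linearP (@mono K R G _ 0)) (linearP f).
move: t; apply: (@homog_words_ext _ _ _ _ (mk_linear lin)) => i w wi /=.
have fwa := fd _ _ (homogB_word wi) a.
have := congr1 (fun z : bar G C' => z a) (fp (ex_intro _ a ao) (mono 0 (word w))).
have -> : lpar C (mono 0 (word w)) = mono 0 (tparsgn (word w)) by exact: lext_mono.
rewrite (tparsgn_word wi).
rewrite (linearZ_LR (@mono K R G _ 0)) (linearZ_LR f) /= !famZ.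
rewrite -[ext _ _ a]/(tparsgn (f (mono 0 (word w)) a)) (tparsgn_homog fwa) scalerA.
rewrite [(_ + _ - _).1]/= [(_ + _ - _).2]/= subr0 addr0 !oddzD oddzN ao.
rewrite -signr_addb (_ : oddz k%:Z = odd k) //.
have -> : odd k (+) (oddz i.1 (+) odd k (+) true (+) (i.2 != 0)) =
   ~~ (oddz i.1 (+) (i.2 != 0)).
  by case: (odd k); case: (oddz _); case: (_ != _).
set z := f _ a => E; have {E} z2 : z + z = 0.
  move: E; case: (_ (+) _) => /=; rewrite ?expr1 ?expr0 ?scale1r ?scaleN1r => E.
    by rewrite -{1}E addNr.
  by rewrite {1}E addNr.
have R2 : (2%:R^-1 : K)%:A *+ 2 = 1 :> R.
  by rewrite -scaler_nat scalerA mulfV ?scale1r // pnatr_eq0.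
by rewrite -[z]scale1r -R2 mulr2n scalerDl -scalerDr z2 scaler0.
Qed.

Lemma degB_comp C C' C'' k l f g : @degB C' C'' k f -> @degB C C' l g ->
  degB (l + k) (f \o g).
Proof. by move=> fk gl i x /gl /fk; rewrite addrA. Qed.

Lemma degB_lext C C' k (F : {linear tensalg C -> tensalg C'}) :
  degT k F -> degB k (lext G F).
Proof. by move=> Fk i x xi b; rewrite addrAC; apply/Fk/xi. Qed.


Lemma degB_add C C' k (f g : lp C C') : degB k f -> degB k g -> degB k (ladd f g).
Proof. by move=> fk gk i x xi b; apply: homogTD; [exact: fk | exact: gk]. Qed.

Lemma degB_opp C C' k (f : lp C C') : degB k f -> degB k (lopp f).
Proof. by move=> fk i x xi b; apply: homogTN; exact: fk. Qed.

Lemma degB_neum C (T : lp C C) (Tn : topnil T) : degB 0 T -> degB 0 (neum Tn).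
Proof.
move=> T0 i x xi b; rewrite addr0; have [n ->] := flim_coef b (neumP Tn x).
rewrite /psums fam_sum; apply: homogT_sum => a _.
suff : homogB i (iter a T x) by [].
elim: (nat_of_ord a) => //= m IH.
by have := T0 _ _ IH; rewrite addr0.
Qed.

Lemma parB_comp C C' C'' s t (f : lp C' C'') (g : lp C C') :
  parB s f -> parB t g -> parB (s (+) t) (lcomp f g).
Proof.
move=> fs gt od x; rewrite lcompE gt // linearZ /= fs // scalerA -signr_addb.
by rewrite addbC.
Qed.


Lemma parB_add C C' s (f g : lp C C') : parB s f -> parB s g -> parB s (ladd f g).
Proof. by move=> fs gs od x; rewrite !laddE fs // gs // linearD scalerDr. Qed.

Lemma parB_opp C C' s (f : lp C C') : parB s f -> parB s (lopp f).
Proof. by move=> fs od x; rewrite !loppE fs // linearN scalerN. Qed.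

Lemma parB_neum C (T : lp C C) (Tn : topnil T) : parB false T -> parB false (neum Tn).
Proof.
move=> T0 od x; rewrite scale1r; apply: (neum_comm Tn (f := lpar C)).
  by move=> e y; apply: lop_fil.
by move=> y; rewrite T0 // scale1r.
Qed.

Lemma parB_tmap C C' (f : {linear C -> C'}) : has_deg (0 : deg) f ->
  parB false (lext G (tmap f)).
Proof.
move=> f0 _ x; rewrite scale1r; apply/funext => g; rewrite /= /ext !tmap_comp.
by apply: eq_tmap => y /=; have [_ _ ->] := sgn_even y f0.
Qed.

Lemma shsgn_deg C : has_deg (0 : deg) (@shsgn _ _ C).
Proof.
move=> i x xi; rewrite addr0 [shsgn x](sgop_homog _ xi).
by case: (~~ _); rewrite ?scale1r // scaleN1r /homog raddfN [gproj _ _ _]xi.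
Qed.

Lemma parB_ins C (k : deg) (h g : {linear C -> C}) :
  has_deg k h -> oddz k.1 -> k.2 = 0 -> has_deg (0 : deg) g ->
  parB true (lext G (insert (@shsgn _ _ C) h g)).
Proof.
move=> hk k1 k2 g0 _ x; rewrite expr1 scaleN1r; apply/funext => b.
rewrite famN /= /ext (tmap_ins_anti (k := @parsgn _ _ C)) ?opprK // => y /=.
- exact: par_shsgn.
- by have [_ _ /= ->] := sgn_odd y hk k1 k2.
- by have [_ _ /= ->] := sgn_even y g0.
Qed.

Lemma tenB_mono C (x : tensalg C) (y : bar G C) : tenB (mono 0 x) y = tenU (mono 0 x) y.
Proof.
apply/funext => g; apply: eq_fsbigr => q _; rewrite /mono /epssgn.
by case: eqP => [->|_]; [rewrite mu0 | rewrite !ten0l].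
Qed.

Lemma tenB_even C (x y : bar G C) : (forall a, oddz (mu a) -> x a = 0) ->
  tenB x y = tenU x y.
Proof.
move=> x0; apply/funext => g; apply: eq_fsbigr => q _; rewrite /epssgn.
by case: ifP => // /x0 ->; rewrite !ten0l.
Qed.

(** The map on the completed tensor product is determined by F, so that it can be
    computed as any map of families with these values. *)
Lemma on_tensE C (M : lmodType R) (F : tensalg C -> tensalg C -> fam G M)
    (L : lop G (tens (tensalg C) (tensalg C)) M) :
  (forall u v, F u v = L (mono 0 (ten u v))) -> forall x, on_tens F x = L x.
Proof.
move=> FL; have bil : bilinear2 (fun p => F p.1 p.2).
  split=> a x x' y /=; rewrite !FL.
    by rewrite ten_linearl (linearP (@mono K R G _ 0)) (linearP L).
  by rewrite ten_linearr (linearP (@mono K R G _ 0)) (linearP L).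
apply: (lop_tens_ext (f := lextr (mk_linear (ulift_linear bil)))) => u v.
rewrite tenU_mono [LHS]extr_mono -FL; exact: (blift_ten bil).
Qed.

(** The properties defining coderivations of degree one and coalgebra morphisms,
    apart from degrees, with unsigned tensor products. *)
Definition lcoder C (f : lp C C) : Prop :=
  (forall x, lcounit C (f x) = 0) /\
  (forall x, ldelta C (f x) =
     lten f (lid G _) (ldelta C x) + lten (lsgn C) f (ldelta C x)).

Definition lcomor C C' (f : lp C C') : Prop :=
  (forall x, lcounit C' (f x) = lcounit C x) /\
  (forall x, ldelta C' (f x) = lten f f (ldelta C x)).

Lemma on_tens_coder C (f : lp C C) : degB ((1, 0) : deg) f -> parB true f ->
  forall z, on_tens (fun u v => tenB (f (mono 0 u)) (mono 0 v) +
      tenB (mono 0 (iter 1 (@tcdsgn _ _ C) u)) (f (mono 0 v))) z =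
    lten f (lid G _) z + lten (lsgn C) f z.
Proof.
move=> fd fp; apply: (on_tensE (L := ladd (lten f (lid G _)) (lten (lsgn C) f))) => u v.
rewrite laddE -tenU_mono !lten_tenU lidE tenB_mono tenB_even => [|a ao].
  by rewrite [lsgn C _]lext_mono.
exact: (odd_coef0 (k := 1)).
Qed.

Lemma on_tens_comor C C' (f : lp C C') : degB (0 : deg) f -> parB false f ->
  forall z, on_tens (fun u v => tenB (f (mono 0 u)) (f (mono 0 v))) z = lten f f z.
Proof.
move=> fd fp; apply: on_tensE => u v.
rewrite -tenU_mono lten_tenU tenB_even // => a ao.
exact: (odd_coef0 (k := 0)).
Qed.

Lemma lcoderP C (f : lp C C) : degB ((1, 0) : deg) f -> parB true f ->
  lcoder f -> coderivation 1 f.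
Proof.
move=> fd fp [f0 fD]; split; [exact: lop_bimod | exact: f0 |].
by move=> x; rewrite -[deltaB (f x)]/(ldelta C (f x)) fD -(on_tens_coder fd fp).
Qed.

Lemma lcomorP C C' (f : lp C C') : degB (0 : deg) f -> parB false f ->
  lcomor f -> coalg_mor f.
Proof.
move=> fd fp [f0 fD]; split; [exact: lop_bimod | exact: f0 |].
by move=> x; rewrite -[deltaB (f x)]/(ldelta C' (f x)) fD -(on_tens_comor fd fp).
Qed.

Lemma coder_lcoder C (f : {linear bar G C -> bar G C}) (fk : bimod_map 1 f) :
  coderivation 1 f -> lcoder (lop_of fk).
Proof.
move=> [_ f0 fD]; split; first exact: f0.
move=> x; rewrite -(on_tens_coder (f := lop_of fk) (bm_deg fk) (bimod_par fk)).
exact: fD.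
Qed.
End BarMaps.

(** * The homological perturbation lemma *)

Section PerturbationLemma.
Variables (K : realType) (R : comNzRingType) (G : dmonoid K).
Variables (A B : lmodType R) (dd dl h : lop G A A) (p : lop G A B) (i : lop G B A).
Hypotheses (pi : forall y, p (i y) = y) (hh : forall x, h (h x) = 0).
Hypotheses (dh : forall x, dd (h x) + h (dd x) = i (p x) - x).
Hypotheses (ph : forall x, p (h x) = 0) (hi : forall y, h (i y) = 0).
Hypotheses (pd : forall x, p (dd x) = 0) (di : forall y, dd (i y) = 0).
Local Notation m := (ladd dd dl).
Hypothesis mm : forall x, m (m x) = 0.
Hypotheses (hn : topnil (lcomp h dl)) (dn : topnil (lcomp dl h)).

Definition hplI : lop G B A := lcomp (neum hn) i.
Definition hplPi : lop G A B := lcomp p (neum dn).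
Definition hplm : lop G B B := lcomp p (lcomp dl hplI).

Lemma hplIE y : hplI y = i y + h (dl (hplI y)).
Proof. by rewrite !lcompE [LHS]neum_fixl. Qed.

Lemma hplPiE x : hplPi x = p x + hplPi (dl (h x)).
Proof. by rewrite !lcompE neum_fixr lopD. Qed.

Lemma h_hplI y : h (hplI y) = 0.
Proof. by rewrite hplIE lopD hi hh addr0. Qed.

Lemma p_hplI y : p (hplI y) = y.
Proof. by rewrite hplIE lopD pi ph addr0. Qed.

Lemma hplPi_h x : hplPi (h x) = 0.
Proof. by rewrite hplPiE ph hh !lop0 addr0. Qed.

Lemma hplPi_i y : hplPi (i y) = y.
Proof. by rewrite hplPiE pi hi !lop0 addr0. Qed.

(** The series for mcan can be summed on either side of dl. *)
Lemma hplmE y : hplm y = hplPi (dl (i y)).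
Proof.
rewrite !lcompE; congr (p _); apply/eqP; rewrite -subr_eq0; apply/eqP.
have e1 : dl (neum hn (i y)) = dl (i y) + dl (h (dl (neum hn (i y)))).
  by rewrite {1}neum_fixl lopD.
have e2 : neum dn (dl (i y)) = dl (i y) + dl (h (neum dn (dl (i y)))) by exact: neum_fixl.
apply: (topnil_fix dn); rewrite lcompE !lopB [in LHS]e1 [in LHS]e2.
by rewrite opprD addrACA subrr add0r.
Qed.

(** h d I = (i p - 1 - d h) I and h dl I = I - i cancel, as p I = 1. *)
Lemma h_m_hplI y : h (m (hplI y)) = 0.
Proof.
rewrite laddE lopD.
have -> : h (dd (hplI y)) = i y - hplI y.
  by have := dh (hplI y); rewrite h_hplI lop0 add0r p_hplI.
have -> : h (dl (hplI y)) = hplI y - i y by rewrite [in RHS]hplIE addrAC subrr add0r.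
by rewrite addrA subrK subrr.
Qed.

(** The difference X of the two sides is killed by h, by p and by h m, so that
    X = - h d X = h dl X. *)
Lemma hplI_chain y : m (hplI y) = hplI (hplm y).
Proof.
pose X := m (hplI y) - hplI (hplm y).
suff : X = 0 by move/eqP; rewrite subr_eq0 => /eqP.
have hX : h X = 0 by rewrite lopB h_m_hplI h_hplI subrr.
have pX : p X = 0.
  by rewrite lopB p_hplI laddE lopD pd add0r lcompE lcompE subrr.
have hmX : h (m X) = 0 by rewrite [m X]lopB mm sub0r lopN h_m_hplI oppr0.
apply: (topnil_fix hn); rewrite lcompE.
have hddX : h (dd X) = - X by have := dh X; rewrite hX pX !lop0 add0r sub0r.
by move: hmX; rewrite laddE lopD hddX => /eqP; rewrite addr_eq0 eqr_opp => /eqP.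
Qed.


(** Dual to h_m_hplI. *)
Lemma hplPi_m_h x : hplPi (m (h x)) = 0.
Proof.
rewrite laddE lopD.
have -> : dd (h x) = i (p x) - x - h (dd x) by rewrite -dh addrK.
rewrite !lopB hplPi_i hplPi_h subr0.
have -> : hplPi (dl (h x)) = hplPi x - p x by rewrite [in RHS]hplPiE addrAC subrr add0r.
by rewrite addrA subrK subrr.
Qed.

(** The difference D of the two sides kills the images of i, h and m h, so that
    D = - D d h = D dl h. *)
Lemma hplPi_chain x : hplPi (m x) = hplm (hplPi x).
Proof.
pose D := ladd (lcomp hplPi m) (lopp (lcomp hplm hplPi)).
have DE z : D z = hplPi (m z) - hplm (hplPi z) by [].
suff : D x = 0 by rewrite DE => /eqP; rewrite subr_eq0 => /eqP.
move: x; apply: (topnil_fix_comp dn) => [e x|x]; first exact: lop_fil.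
rewrite lcompE.
have Dh z : D (h z) = 0 by rewrite DE hplPi_m_h hplPi_h lop0 subrr.
have Di z : D (i z) = 0 by rewrite DE laddE di add0r -hplmE hplPi_i subrr.
have Dm z : hplPi (m z) = 0 -> D (m z) = 0.
  by move=> z0; rewrite DE mm z0 !lop0 subrr.
have := Dm _ (hplPi_m_h x); rewrite laddE lopD.
have {1}-> : dd (h x) = i (p x) - x - h (dd x) by rewrite -dh addrK.
rewrite !lopB Di Dh subr0 sub0r addrC => /eqP; rewrite subr_eq0 => /eqP ->.
by [].
Qed.

Section Coalgebra.
Variables (DA : lop G A (tens A A)) (DB : lop G B (tens B B)) (s : lop G A A) (s' : lop G B B).
Local Notation P := (lcomp i p).
Local Notation "1" := (lid G _).
Hypotheses (ss : forall x, s (s x) = x) (sh : forall x, s (h x) = - h (s x)).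
Hypothesis ps : forall x, p (s x) = s' (p x).
Hypotheses (Di : forall y, DA (i y) = lten i i (DB y)).
Hypotheses (Dp : forall x, DB (p x) = lten p p (DA x)).
Hypothesis Dh : forall x, DA (h x) = lten h P (DA x) + lten s h (DA x).
Hypothesis Ddl : forall x, DA (dl x) = lten dl 1 (DA x) + lten s dl (DA x).
Local Notation hdtwo := (lcomp (ladd (lten h P) (lten s h)) (ladd (lten dl 1) (lten s dl))).
Hypothesis Wn : topnil hdtwo.

Lemma hs x : h (s x) = - s (h x). Proof. by rewrite sh opprK. Qed.

(** Both sides solve Y = (i (x) i) DB + W Y, where W is the operator lowering
    weights: for (I (x) I) DB the terms of W containing h I vanish, and the others
    telescope to I (x) I - i (x) i. *)
Lemma hplI_comor y : DA (hplI y) = lten hplI hplI (DB y).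
Proof.
have hdl x : h (dl (hplI x)) = ladd hplI (lopp i) x.
  by rewrite laddE loppE [in RHS]hplIE addrAC subrr add0r.
have WI z : hdtwo (lten hplI hplI z) = lten hplI hplI z - lten i i z.
  have e1 : lten h P (lten dl 1 (lten hplI hplI z)) = lten hplI i z - lten i i z.
    rewrite -lten_oppl -lten_addl; apply: lten_fuse3 => x; first exact: hdl.
    by rewrite lidE lcompE p_hplI.
  have e2 : lten h P (lten s dl (lten hplI hplI z)) = 0.
    by apply: lten_fuse3_0l => x; rewrite hs h_hplI lop0 oppr0.
  have e3 : lten s h (lten dl 1 (lten hplI hplI z)) = 0.
    by apply: lten_fuse3_0r => x; rewrite lidE h_hplI.
  have e4 : lten s h (lten s dl (lten hplI hplI z)) = lten hplI hplI z - lten hplI i z.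
    rewrite -lten_oppr -lten_addr; apply: lten_fuse3 => x; last exact: hdl.
    exact: ss.
  rewrite lcompE !laddE !lopD e1 e2 e3 e4 addr0 add0r.
  by rewrite addrC addrA subrK.
apply/eqP; rewrite -subr_eq0; apply/eqP; apply: (topnil_fix Wn).
rewrite [hdtwo _]lopB WI [in LHS]hplIE lopD Di Dh Ddl.
by rewrite lcompE !laddE opprB [RHS]addrA [X in _ = X - _]addrC.
Qed.

(** Both sides solve Y = (p (x) p) DA + Y dl h; for (Pi (x) Pi) DA the terms
    containing Pi h vanish, and the others telescope. *)
Lemma hplPi_comor x : DB (hplPi x) = lten hplPi hplPi (DA x).
Proof.
pose D := ladd (lcomp DB hplPi) (lopp (lcomp (lten hplPi hplPi) DA)).
have DE z : D z = DB (hplPi z) - lten hplPi hplPi (DA z) by [].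
suff : D x = 0 by rewrite DE => /eqP; rewrite subr_eq0 => /eqP.
have dlh z : hplPi (dl (h z)) = ladd hplPi (lopp p) z.
  by rewrite laddE loppE [in RHS]hplPiE addrAC subrr add0r.
move: x; apply: (topnil_fix_comp dn) => [e x|x]; first exact: lop_fil.
have e1 : lten hplPi hplPi (lten dl 1 (lten h P (DA x))) =
    lten hplPi p (DA x) - lten p p (DA x).
  rewrite -lten_oppl -lten_addl; apply: lten_fuse3 => y; first exact: dlh.
  by rewrite lidE lcompE hplPi_i.
have e2 : lten hplPi hplPi (lten s dl (lten h P (DA x))) = 0.
  by apply: lten_fuse3_0l => y; rewrite sh lopN hplPi_h oppr0.
have e3 : lten hplPi hplPi (lten dl 1 (lten s h (DA x))) = 0.
  by apply: lten_fuse3_0r => y; rewrite lidE hplPi_h.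
have e4 : lten hplPi hplPi (lten s dl (lten s h (DA x))) =
    lten hplPi hplPi (DA x) - lten hplPi p (DA x).
  rewrite -lten_oppr -lten_addr; apply: lten_fuse3 => y; last exact: dlh.
  by rewrite ss.
have e : lten hplPi hplPi (DA (dl (h x))) = lten hplPi hplPi (DA x) - lten p p (DA x).
  rewrite Ddl Dh !lopD e1 e2 e3 e4 addr0 add0r.
  by rewrite addrC addrA subrK.
rewrite lcompE !DE e [in LHS]hplPiE lopD Dp opprB addrA.
by rewrite [X in X - _]addrC.
Qed.

Lemma hplm_coder y :
  DB (hplm y) = lten hplm 1 (DB y) + lten s' hplm (DB y).
Proof.
rewrite !lcompE Dp Ddl lopD.
have -> : DA (neum hn (i y)) = lten hplI hplI (DB y) by exact: hplI_comor.
congr (_ + _); apply: lten_fuse3 => z //; first by rewrite !lidE p_hplI.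
by rewrite ps p_hplI.
Qed.

Variables (eA : lop G A R^o) (eB : lop G B R^o).
Hypotheses (ei : forall y, eA (i y) = eB y) (ep : forall x, eB (p x) = eA x).
Hypotheses (eh : forall x, eA (h x) = 0) (edl : forall x, eA (dl x) = 0).

Lemma hplI_counit y : eA (hplI y) = eB y.
Proof. by rewrite hplIE lopD ei eh addr0. Qed.

Lemma hplm_counit y : eB (hplm y) = 0.
Proof. by rewrite !lcompE ep edl. Qed.

(** The difference D satisfies D = D dl h. *)
Lemma hplPi_counit x : eB (hplPi x) = eA x.
Proof.
pose D := ladd (lcomp eB hplPi) (lopp eA).
have DE z : D z = eB (hplPi z) - eA z by [].
suff : D x = 0 by rewrite DE => /eqP; rewrite subr_eq0 => /eqP.
move: x; apply: (topnil_fix_comp dn) => [e x|x]; first exact: lop_fil.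
by rewrite !DE lcompE edl subr0 [in LHS]hplPiE lopD ep addrAC subrr add0r.
Qed.
End Coalgebra.
End PerturbationLemma.

(** * Perturbation of twisted algebras *)

Section CoderivationLength.
Variables (K : realType) (R : comNzRingType) (C : lmodType R).
Variables (s : {linear C -> C}) (F : {linear tensalg C -> tensalg C}).
Hypothesis F0 : forall t, pr0 (F t) = 0.
Hypothesis FD : forall t, deconc (F t) =
  tensmap F idfun (deconc t) + tensmap (tmap s) F (deconc t).
Local Notation A := (lgwords C).

Lemma inlen_cat1 x (t : K) z : inlen A t z -> inlen A (t + 1) (tcat (word [:: x]) z).
Proof.
apply: inlen_lin => w /=; rewrite tcat_word.
by apply: (inlen_gen (A := A)); rewrite /= -natr1.
Qed.

(** F replaces a part of a word, possibly empty, by one letter. *)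
Lemma coder_len w : inlen A ((size w)%:R + 1 : K) (F (word w)).
Proof.
have hd v : inlen A ((size v)%:R + 1 : K) (headpart F v).
  apply: inlen_sum => j _; apply: (inlen_gen (A := A)) => /=.
  by rewrite size_drop natr1 ler_nat ltnS leq_subr.
elim: w => [|x w IH]; first by rewrite (coder_nil F0 FD); exact: hd.
rewrite (coder_cons F0 FD); apply: inlen_add; first exact: hd.
by rewrite /= -natr1; apply: inlen_cat1.
Qed.

(** The part of the word replaced by one letter has at least two letters. *)
Lemma coder_len_lt w : (forall v, (size v <= 1)%N -> pr1 (F (word v)) = 0) ->
  inlen A ((size w)%:R - 1 : K) (F (word w)).
Proof.
move=> Fv; have hd v : inlen A ((size v)%:R - 1 : K) (headpart F v).
  apply: inlen_sum => j _; have [j1|j1] := leqP j 1.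
    rewrite Fv; first by rewrite (word0 [::]); exact: inlen0.
    by rewrite size_take; case: ltnP => // /leq_trans; apply.
  apply: (inlen_gen (A := A)); rewrite /= size_drop.
  have : ((size v - j).+2 <= size v)%N by have := ltn_ord j; lia.
  by rewrite -(ler_nat K) -!natr1; lra.
elim: w => [|x w IH]; first by rewrite (coder_nil F0 FD); exact: hd.
rewrite (coder_cons F0 FD); apply: inlen_add; first exact: hd.
rewrite /= -natr1 addrK; have := inlen_cat1 (s x) IH.
by rewrite subrK.
Qed.

Lemma coder_low w : (forall v, (size v <= 1)%N -> pr1 (F (word v)) = 0) ->
  (size w <= 1)%N -> F (word w) = 0.
Proof.
move=> Fv; have hd v : (size v <= 1)%N -> headpart F v = 0.
  move=> v1; rewrite /headpart big1 // => j _; rewrite Fv ?(word0 [::]) //.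
  by apply: leq_trans v1; rewrite size_take_min geq_minr.
case: w => [|x [|y w]] // w1; first by rewrite (coder_nil F0 FD) hd.
by rewrite (coder_cons F0 FD) (coder_nil F0 FD) !hd // linear0 addr0.
Qed.
End CoderivationLength.

Section Coefficients.
Variables (K : realType) (R : comNzRingType) (G : dmonoid K).
Implicit Types M N L : lmodType R.

Lemma coef_linear M N (f : lop G M N) b : linear (fun t => f (mono 0 t) b).
Proof. by move=> a u v; rewrite (linearP (@mono K R G _ 0)) (linearP f). Qed.
Definition coefl M N (f : lop G M N) b : {linear M -> N} := mk_linear (coef_linear f b).

Lemma tenU_monor M N (x : fam G M) (v : N) b : tenU x (mono 0 v) b = ten (x b) v.
Proof.
exact: (congr1 (fun z => z b) (extr_mono (mk_linear (@tenU_symbol K R G M N x)) v)).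
Qed.
Lemma tenU_monol M N (u : M) (y : fam G N) b : tenU (mono 0 u) y b = ten u (y b).
Proof.
rewrite -tenUlE.
exact: (congr1 (fun z => z b) (extr_mono (mk_linear (@tenUl_symbol K R G M N y)) u)).
Qed.

Lemma lten_coefl M N L (f : lop G M N) b z :
  lten f (lid G L) (mono 0 z) b = tensmap (coefl f b) idfun z.
Proof.
move: z; apply: (@tens_ext _ _ _ _ (coefl (lten f (lid G L)) b)
  (tensmap (coefl f b) idfun)) => u v.
rewrite [RHS](tensmap_ten (coefl f b) idfun).
rewrite -[LHS]/(lten f (lid G L) (mono 0 (ten u v)) b).
by rewrite -tenU_mono lten_tenU lidE tenU_monor.
Qed.
Lemma lten_coefr M N L L' (f : lop G M N) (s : {linear L -> L'}) b z :
  lten (lext G s) f (mono 0 z) b = tensmap s (coefl f b) z.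
Proof.
move: z; apply: (@tens_ext _ _ _ _ (coefl (lten (lext G s) f) b)
  (tensmap s (coefl f b))) => u v.
rewrite [RHS](tensmap_ten s (coefl f b)).
rewrite -[LHS]/(lten (lext G s) f (mono 0 (ten u v)) b).
by rewrite -tenU_mono lten_tenU lext_mono tenU_monol.
Qed.
End Coefficients.

Lemma lsgn_tmap (K : realType) (R : gring K) (G : dmonoid K) (C C' : gmod R)
    (f : {linear C -> C'}) : has_deg (0 : deg) f ->
  forall x, lext G (tmap f) (lsgn G C x) = lsgn G C' (lext G (tmap f) x).
Proof.
move=> f0 x; apply/funext => g; rewrite /= /ext !tmap_comp; apply: eq_tmap => y /=.
by have [-> _ _] := sgn_even y f0.
Qed.

Lemma lcoder_sub (K : realType) (R : gring K) (G : dmonoid K) (C : gmod R)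
    (f g : lop G (tensalg C) (tensalg C)) :
  lcoder f -> lcoder g -> lcoder (ladd f (lopp g)).
Proof.
move=> [f0 fD] [g0 gD]; split=> x; rewrite laddE loppE lopB.
  by rewrite f0 g0 subrr.
by rewrite fD gD lten_addl lten_addr lten_oppl lten_oppr opprD addrACA.
Qed.

Section Perturb.
Variables (K : realType) (R : gring K) (G : dmonoid K) (C : dgmod R).
Variables (r : retraction C) (m : {linear bar G C -> bar G C}).
Hypotheses (mA : twisted_Ainf m) (mp : is_perturbation m).
Local Notation H := (HC C).
Local Notation sg := (@shsgn _ _ C).
Local Notation P := (rI r \o rPi r).

Lemma m_bimod : bimod_map 1 m. Proof. by case: mA => -[]. Qed.
Definition lm := lop_of m_bimod.
Lemma lm_coder : lcoder lm. Proof. by apply: coder_lcoder; case: mA. Qed.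

Definition ld := lext G (insert sg (comp10 m) idfun).
Definition ldl := ladd lm (lopp ld).
Definition lh := lext G (insert sg (rh r) P).
Definition lp := lext G (tmap (rPi r)).
Definition li := lext G (tmap (rI r)).

Lemma comp10_deg : has_deg ((1, 0) : deg) (comp10 m).
Proof.
move=> i x xi; rewrite mp; apply: dg_deg.
rewrite [cdsgn x](sgop_homog _ xi).
by case: (oddz _); rewrite ?scale1r // scaleN1r /homog raddfN [gproj _ _ _]xi.
Qed.

Lemma P_deg : has_deg (0 : deg) P.
Proof.
move=> i x xi; rewrite addr0 /=.
by have := @rI_deg _ _ _ r _ _ (@rPi_deg _ _ _ r _ _ xi); rewrite !addr0.
Qed.

Lemma id_deg (C' : gmod R) : has_deg (0 : deg) (@idfun C').
Proof. by move=> i x; rewrite addr0. Qed.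

Lemma sh_r x : sg (rh r x) = - rh r (sg x).
Proof. by have [] := sgn_odd x (@rh_deg _ _ _ r). Qed.
Lemma sd_m x : sg (comp10 m x) = - comp10 m (sg x).
Proof. by have [] := sgn_odd x comp10_deg. Qed.

Lemma lsgnK x : lsgn G C (lsgn G C x) = x.
Proof.
apply/funext => g; rewrite /= /ext tmap_comp -[RHS]tmap_id.
by apply: eq_tmap => y /=; rewrite shsgnK.
Qed.
Lemma lsgn_h x : lsgn G C (lh x) = - lh (lsgn G C x).
Proof.
apply/funext => g; rewrite famN /= /ext tmap_ins_anti // => y /=; first exact: sh_r.
by have [-> _ _] := sgn_even y P_deg.
Qed.
Lemma lp_lsgn x : lp (lsgn G C x) = lsgn G H (lp x).
Proof. exact: lsgn_tmap (@rPi_deg _ _ _ r) x. Qed.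

Lemma lp_li y : lp (li y) = y.
Proof.
apply/funext => g; rewrite /= /ext !tmap_comp -[RHS]tmap_id.
by apply: eq_tmap => z /=; rewrite rPiI.
Qed.
Lemma lh_lh x : lh (lh x) = 0.
Proof.
apply/funext => g; apply: insert_sq0 => y.
- exact: rhh.
- exact: rPih.
- exact: rhI.
Qed.
Lemma lp_lh x : lp (lh x) = 0.
Proof. by apply/funext => g; apply: tmap_ins0; exact: rPih. Qed.
Lemma lh_li y : lh (li y) = 0.
Proof. by apply/funext => g; apply: ins_tmap0; exact: rhI. Qed.
Lemma lp_ld x : lp (ld x) = 0.
Proof. by apply/funext => g; apply: tmap_ins0 => y /=; rewrite mp rPid. Qed.
Lemma ld_li y : ld (li y) = 0.
Proof. by apply/funext => g; apply: ins_tmap0 => z /=; rewrite mp rdI. Qed.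
Lemma ld_lh x : ld (lh x) + lh (ld x) = li (lp x) - x.
Proof.
apply/funext => g; rewrite !famD famN /= /ext tmap_comp.
apply: insert_contraction => y /=.
- exact: shsgnK.
- exact: sd_m.
- exact: sh_r.
- by rewrite mp rPid.
- by rewrite mp rdI.
- by rewrite !mp rdh.
Qed.

Lemma lmE x : ladd ld ldl x = m x.
Proof. by rewrite !laddE loppE addrC subrK. Qed.

Lemma lm_sq x : ladd ld ldl (ladd ld ldl x) = 0.
Proof. by rewrite !lmE; case: mA. Qed.

Lemma ld_coder : lcoder ld.
Proof.
split=> x.
  by apply/funext => g; apply: pr0_ins.
have idt : lext G (tmap (@idfun C)) =1 lid G _ .
  by move=> y; apply/funext => g; apply: tmap_id.
rewrite [X in _ = X + _](lten_ext (f2 := ld) (g2 := lext G (tmap (@idfun C)))) //.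
rewrite [lten ld _ _](lten_lext (insert _ _ _)) [lten _ _ _](lten_lext (tmap _)).
by apply/funext => g; apply: deconc_ins.
Qed.

Lemma ldl_coder : lcoder ldl.
Proof. exact: lcoder_sub lm_coder ld_coder. Qed.

Lemma ldl_deg : degB ((1, 0) : deg) ldl.
Proof.
apply: degB_add; first exact: (bm_deg m_bimod).
apply: degB_opp; apply: degB_lext; apply: degT_ins; first exact: shsgn_deg.
  exact: comp10_deg.
exact: id_deg.
Qed.
Lemma ldl_par : parB true ldl.
Proof.
apply: parB_add; first exact: (bimod_par m_bimod).
apply: parB_opp; apply: (parB_ins comp10_deg) => //; exact: id_deg.
Qed.
End Perturb.

Section CoefficientCoderivation.
Variables (K : realType) (R : gring K) (G : dmonoid K) (C : gmod R).
Variable f : lop G (tensalg C) (tensalg C).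
Hypothesis fc : lcoder f.

Lemma coefl_pr0 b t : pr0 (coefl f b t) = 0.
Proof. by have [f0 _] := fc; exact: (congr1 (fun z => z b) (f0 (mono 0 t))). Qed.

(** As the comultiplication does not involve exponents, the coefficients of a
    coderivation are coderivations of the tensor algebra. *)
Lemma coefl_deconc b t : deconc (coefl f b t) =
  tensmap (coefl f b) idfun (deconc t) +
  tensmap (tmap (@shsgn _ _ C)) (coefl f b) (deconc t).
Proof.
have [_ fD] := fc; have := congr1 (fun z => z b) (fD (mono 0 t)).
have -> : ldelta G C (mono 0 t) = mono 0 (deconc t) by exact: lext_mono.
by rewrite famD lten_coefl [X in _ + X]lten_coefr.
Qed.

(** At energy zero a word is shortened; at positive energy, which is at least c, it
    gets longer by at most one letter. *)
Lemma coder_lowers (c : K) : 0 < c -> (forall b : gelt G, en b < c -> b = 0) ->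
  (forall v : seq C, (size v <= 1)%N -> pr1 (f (barw v) 0) = 0) ->
  lowers c (lgwords C) (lgwords C) 1 f.
Proof.
move=> c0 cP fv w b; have -> : f (mono 0 (lgwords C w)) b = coefl f b (word w) by [].
have [bc|cb] := ltP (en b) c.
  rewrite (cP _ bc) en0 mulr0 mul0r addr0.
  apply: (@coder_len_lt K R C _ (coefl f 0) (coefl_pr0 0) (coefl_deconc 0)); exact: fv.
apply: inlen_le (@coder_len K R C _ (coefl f b) (coefl_pr0 b) (coefl_deconc b) w).
have : 2 <= 2 * en b / c by rewrite -mulrA ler_pMr // ler_pdivlMr // mul1r.
by rewrite /=; lra.
Qed.
End CoefficientCoderivation.

Lemma inlen_tmap (K : realType) (R : gring K) (C1 C2 : gmod R) (f : {linear C1 -> C2}) w :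
  inlen (lgwords C2) ((size w)%:R : K) (tmap f (word w)).
Proof. by rewrite tmap_word; apply: (inlen_gen (A := lgwords C2)); rewrite /= size_map. Qed.

Lemma inlen_ins (K : realType) (R : gring K) (C1 : gmod R) (f k g : {linear C1 -> C1}) w :
  inlen (lgwords C1) ((size w)%:R : K) (insert f k g (word w)).
Proof.
rewrite ins_word; apply: inlen_sum => j _; apply: (inlen_gen (A := lgwords C1)) => /=.
have jw := ltn_ord j.
rewrite size_cat /= !size_map size_take size_drop jw ler_nat; lia.
Qed.

Lemma lowers_pair (K : realType) (R : gring K) (G : dmonoid K) c (A : gmod R)
    (f f' g s : lop G (tensalg A) (tensalg A)) :
  0 < c ->
  lowers c (lgwords A) (lgwords A) 0 f -> lowers c (lgwords A) (lgwords A) 0 f' ->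
  lowers c (lgwords A) (lgwords A) 0 s -> lowers c (lgwords A) (lgwords A) 1 g ->
  topnil (lcomp (ladd (lten f f') (lten s f)) (ladd (lten g (lid G _)) (lten s g))).
Proof.
move=> c0 f0 f'0 s0 g1; apply: (lowers_topnil c0 (A := lgtens (lgwords A) (lgwords A))).
rewrite -[1]add0r; apply: (lowers_comp (B := lgtens (lgwords A) (lgwords A))) => //.
  by rewrite -[0]addr0; apply: lowers_add; apply: lowers_lten.
apply: lowers_add; first by rewrite -[1]addr0; apply: lowers_lten => //; exact: lowers_lid.
by rewrite -[1]add0r; apply: lowers_lten.
Qed.

Lemma comp10E (K : realType) (R : gring K) (G : dmonoid K) (C : gmod R)
  (m : bar G C -> bar G C) x : comp10 m x = pr1 (m (barw [:: x]) 0).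
Proof. by rewrite /comp10 /Defs.comp mu0. Qed.

Section PerturbConclusions.
Variables (K : realType) (R : gring K) (G : dmonoid K) (C : dgmod R).
Variables (r : retraction C) (m : {linear bar G C -> bar G C}).
Hypotheses (mA : twisted_Ainf m) (mp : is_perturbation m).
Local Notation H := (HC C).
Local Notation sg := (@shsgn _ _ C).
Local Notation dl := (ldl mA).
Local Notation h := (lh G r).
Local Notation p := (lp G r).
Local Notation i := (li G r).
Local Notation ld := (ld m).

Lemma m0_at0 : pr1 (m (barw [::]) 0) = 0.
Proof. by have [_ _ [e e0 me]] := mA; apply: (me 0); rewrite en0. Qed.

Lemma dlE x : dl x = m x - ld x. Proof. by []. Qed.

(** Tameness removes the component without arguments, and d the linear one. *)
Lemma dl_low (v : seq C) : (size v <= 1)%N -> pr1 (dl (barw v) 0) = 0.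
Proof.
have ldE : ld (barw v) 0 = insert sg (comp10 m) idfun (word v).
  by rewrite /barw [ld _]lext_mono /mono eqxx.
rewrite dlE famD famN ldE linearB /= pr1_ins pr1_word.
case: v {ldE} => [|x [|y v]] //= _; first by rewrite m0_at0 linear0 subrr.
by rewrite comp10E subrr.
Qed.

Lemma dl_lowers c : 0 < c -> (forall b : gelt G, en b < c -> b = 0) ->
  lowers c (lgwords C) (lgwords C) 1 dl.
Proof. by move=> c0 cP; apply: coder_lowers => //; [exact: ldl_coder | exact: dl_low]. Qed.

Lemma h_lowers c : 0 < c -> lowers c (lgwords C) (lgwords C) 0 h.
Proof. by move=> c0; apply: lowers_lext => // w; apply: inlen_ins. Qed.
Lemma P_lowers c : 0 < c -> lowers c (lgwords C) (lgwords C) 0 (lcomp i p).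
Proof.
move=> c0; rewrite -[0]addr0; apply: (lowers_comp (B := lgwords (HC C))) => //.
  by apply: lowers_lext => // w; apply: inlen_tmap.
by apply: lowers_lext => // w; apply: inlen_tmap.
Qed.
Lemma sgn_lowers c : 0 < c -> lowers c (lgwords C) (lgwords C) 0 (lsgn G C).
Proof. by move=> c0; apply: lowers_lext => // w; apply: inlen_tmap. Qed.

Lemma hdl_nil : topnil (lcomp h dl).
Proof.
have [c c0 cP] := en_gap G; apply: (lowers_topnil c0 (A := lgwords C) (f := lcomp h dl)).
rewrite -[1]add0r; apply: lowers_comp (dl_lowers c0 cP) => //; exact: h_lowers.
Qed.
Lemma dlh_nil : topnil (lcomp dl h).
Proof.
have [c c0 cP] := en_gap G; apply: (lowers_topnil c0 (A := lgwords C) (f := lcomp dl h)).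
rewrite -[1]addr0; apply: lowers_comp (h_lowers c0) => //; exact: dl_lowers.
Qed.

Lemma lten_hdl_nil : topnil (lcomp (ladd (lten h (lcomp i p)) (lten (lsgn G C) h))
  (ladd (lten dl (lid G _)) (lten (lsgn G C) dl))).
Proof.
have [c c0 cP] := en_gap G; apply: (@lowers_pair _ _ _ c C h (lcomp i p) dl (lsgn G C) c0).
- exact: h_lowers.
- exact: P_lowers.
- exact: sgn_lowers.
- exact: dl_lowers.
Qed.

Definition pert_I : lop G (tensalg H) (tensalg C) := hplI i hdl_nil.
Definition pert_Pi : lop G (tensalg C) (tensalg H) := hplPi p dlh_nil.
Definition pert_m : lop G (tensalg H) (tensalg H) := hplm p i hdl_nil.

Lemma pert_I_fix y : pert_I y = i y + h (dl (pert_I y)).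
Proof. exact: hplIE. Qed.
Lemma h_pert_I y : h (pert_I y) = 0.
Proof. exact: (h_hplI (lh_lh r) (lh_li r) hdl_nil y). Qed.
End PerturbConclusions.

Section TensorMapComorphism.
Variables (K : realType) (R : gring K) (G : dmonoid K).

Lemma ldelta_tmap (C C' : gmod R) (f : {linear C -> C'}) x :
  ldelta G C' (lext G (tmap f) x) =
  lten (lext G (tmap f)) (lext G (tmap f)) (ldelta G C x).
Proof. by rewrite [RHS]lten_lext; apply/funext => g; apply: deconc_tmap. Qed.

Lemma ldelta_ins (C : gmod R) (f h g : {linear C -> C}) x :
  ldelta G C (lext G (insert f h g) x) =
  lten (lext G (insert f h g)) (lext G (tmap g)) (ldelta G C x) +
  lten (lext G (tmap f)) (lext G (insert f h g)) (ldelta G C x).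
Proof.
rewrite [X in _ = X + _]lten_lext [X in _ = _ + X]lten_lext.
by apply/funext => b; apply: deconc_ins.
Qed.

Lemma barw_nil_fil_pos (C : gmod R) (x : bar G C) :
  (exists2 c : K, 0 < c & fil c (x - barw [::])) -> fil_pos (pi1B x).
Proof.
move=> [c c0 xc]; exists c => // b bc; rewrite /pi1B /ext.
have := xc b bc; rewrite famD famN => /eqP; rewrite subr_eq0 => /eqP ->.
rewrite /barw /mono; case: eqP => _; last exact: linear0.
by rewrite pr1_word.
Qed.
End TensorMapComorphism.

Section PerturbedStructure.
Variables (K : realType) (R : gring K) (G : dmonoid K) (C : dgmod R).
Variables (r : retraction C) (m : {linear bar G C -> bar G C}).
Hypotheses (mA : twisted_Ainf m) (mp : is_perturbation m).
Local Notation H := (HC C).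
Local Notation dl := (ldl mA).
Local Notation ld := (ld m).
Local Notation h := (lh G r).
Local Notation p := (lp G r).
Local Notation i := (li G r).
Local Notation pert_I := (pert_I r mA).
Local Notation pert_Pi := (pert_Pi r mA).
Local Notation pert_m := (pert_m r mA).
Local Notation hn := (hdl_nil r mA).
Local Notation dn := (dlh_nil r mA).

Lemma p_pert_I y : p (pert_I y) = y.
Proof. exact: (p_hplI (lp_li r) (lp_lh r) hn y). Qed.
Lemma pert_mE y : pert_m y = pert_Pi (dl (i y)).
Proof. exact: hplmE. Qed.

Lemma m_pert_I y : m (pert_I y) = pert_I (pert_m y).
Proof.
rewrite -(lmE mA); apply: (hplI_chain (dd := ld)).
- exact: lp_li.
- exact: lh_lh.
- exact: ld_lh.
- exact: lp_lh.
- exact: lh_li.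
- exact: lp_ld.
- exact: lm_sq.
Qed.

Lemma pert_m_sq y : pert_m (pert_m y) = 0.
Proof. by rewrite -[LHS]p_pert_I -!m_pert_I; have [_ -> _] := mA; apply: lop0. Qed.

Lemma pert_Pi_m x : pert_Pi (m x) = pert_m (pert_Pi x).
Proof.
rewrite -(lmE mA); apply: (hplPi_chain (dd := ld)).
- exact: lp_li.
- exact: lh_lh.
- exact: ld_lh.
- exact: lp_lh.
- exact: lh_li.
- exact: ld_li.
- exact: lm_sq.
Qed.

Lemma ldelta_h x : ldelta G C (h x) =
  lten h (lcomp i p) (ldelta G C x) + lten (lsgn G C) h (ldelta G C x).
Proof.
rewrite [LHS]ldelta_ins; congr (_ + _); apply: lten_ext => // y.
by apply/funext => b; rewrite /= /ext tmap_comp.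
Qed.

Lemma counit_tmap (C1 C2 : gmod R) (f : {linear C1 -> C2}) x :
  lcounit G C2 (lext G (tmap f) x) = lcounit G C1 x.
Proof. by apply/funext => b; apply: pr0_tmap. Qed.
Lemma counit_h x : lcounit G C (h x) = 0.
Proof. by apply/funext => b; apply: pr0_ins. Qed.
Lemma counit_dl x : lcounit G C (dl x) = 0.
Proof. by have [] := ldl_coder mA. Qed.
Lemma ldelta_dl x : ldelta G C (dl x) =
  lten dl (lid G _) (ldelta G C x) + lten (lsgn G C) dl (ldelta G C x).
Proof. by have [_] := ldl_coder mA; apply. Qed.

Lemma pert_I_lcomor : lcomor pert_I.
Proof.
split; first by apply: hplI_counit; [exact: counit_tmap | exact: counit_h].
exact: (hplI_comor (lp_li r) (lh_lh r) (lp_lh r) (lh_li r) hn (@lsgnK _ _ G C)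
  (lsgn_h r) (ldelta_tmap (rI r)) ldelta_h ldelta_dl (lten_hdl_nil r mA)).
Qed.

Lemma pert_Pi_lcomor : lcomor pert_Pi.
Proof.
split; first by apply: hplPi_counit; [exact: counit_tmap | exact: counit_dl].
exact: (hplPi_comor (lp_li r) (lh_lh r) (lp_lh r) (lh_li r) dn (@lsgnK _ _ G C)
  (lsgn_h r) (ldelta_tmap (rPi r)) ldelta_h ldelta_dl).
Qed.

Lemma pert_m_lcoder : lcoder pert_m.
Proof.
split; first by apply: hplm_counit; [exact: counit_tmap | exact: counit_dl].
exact: (hplm_coder (lp_li r) (lh_lh r) (lp_lh r) (lh_li r) hn (@lsgnK _ _ G C)
  (lsgn_h r) (lp_lsgn r) (ldelta_tmap (rI r)) (ldelta_tmap (rPi r)) ldelta_h ldelta_dl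
  (lten_hdl_nil r mA)).
Qed.

Lemma i_deg : degB 0 i.
Proof. by apply: degB_lext; apply: degT_tmap; exact: rI_deg. Qed.
Lemma p_deg : degB 0 p.
Proof. by apply: degB_lext; apply: degT_tmap; exact: rPi_deg. Qed.
Lemma h_deg : degB ((-1, 0) : deg) h.
Proof.
apply: degB_lext; apply: degT_ins; first exact: shsgn_deg.
  exact: rh_deg.
exact: P_deg.
Qed.
Lemma h_par : parB true h.
Proof. by apply: (parB_ins (@rh_deg _ _ _ r)) => //; exact: P_deg. Qed.

Lemma pert_I_deg : degB 0 pert_I.
Proof.
rewrite -[0]addr0; apply: degB_comp; last exact: i_deg.
apply: degB_neum.
have -> : (0 : deg) = ((1, 0) : deg) + ((-1, 0) : deg) by apply/eqP.
exact: (degB_comp h_deg (ldl_deg mA mp)).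
Qed.
Lemma pert_I_par : parB false pert_I.
Proof.
apply: (parB_comp (s := false) (t := false)); last exact: parB_tmap (@rI_deg _ _ _ r).
apply: parB_neum; exact: (parB_comp h_par (ldl_par mA mp)).
Qed.
Lemma pert_Pi_deg : degB 0 pert_Pi.
Proof.
rewrite -[0]addr0; apply: degB_comp; first exact: p_deg.
apply: degB_neum.
have -> : (0 : deg) = ((-1, 0) : deg) + ((1, 0) : deg) by apply/eqP.
exact: (degB_comp (ldl_deg mA mp) h_deg).
Qed.
Lemma pert_Pi_par : parB false pert_Pi.
Proof.
apply: (parB_comp (s := false) (t := false)); first exact: parB_tmap (@rPi_deg _ _ _ r).
apply: parB_neum; exact: (parB_comp (ldl_par mA mp) h_par).
Qed.
Lemma pert_m_deg : degB ((1, 0) : deg) pert_m.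
Proof.
have := degB_comp (degB_comp p_deg (ldl_deg mA mp)) pert_I_deg.
by rewrite addr0 add0r.
Qed.
Lemma pert_m_par : parB true pert_m.
Proof.
apply: (parB_comp (s := false) (t := true)); first exact: parB_tmap (@rPi_deg _ _ _ r).
exact: (parB_comp (s := true) (t := false) (ldl_par mA mp) pert_I_par).
Qed.

(** A word of at most one letter leaves only components with at most one argument,
    which have positive energy. *)
Lemma dl_word1 c (v : seq C) : 0 < c -> (forall b : gelt G, en b < c -> b = 0) ->
  (size v <= 1)%N -> fil c (dl (barw v)).
Proof.
move=> c0 cP v1 b /cP ->.
exact: (coder_low (coefl_pr0 (ldl_coder mA) 0) (coefl_deconc (ldl_coder mA) 0)
  (dl_low mA) v1).
Qed.

Lemma i_word v : i (barw v) = barw (map (rI r) v).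
Proof. by rewrite [LHS]lext_mono /= tmap_word. Qed.
Lemma p_word v : p (barw v) = barw (map (rPi r) v).
Proof. by rewrite [LHS]lext_mono /= tmap_word. Qed.

Lemma pert_I_word1 c v : 0 < c -> (forall b : gelt G, en b < c -> b = 0) ->
  (size v <= 1)%N -> fil c (pert_I (barw v) - barw (map (rI r) v)).
Proof.
move=> c0 cP v1; rewrite -i_word; have -> : pert_I (barw v) = neum hn (i (barw v)) by [].
rewrite neum_fixr addrAC subrr add0r i_word; apply: lop_fil.
rewrite lcompE; apply: lop_fil; apply: dl_word1 => //.
by rewrite size_map.
Qed.

Lemma pert_m_word1 c v : 0 < c -> (forall b : gelt G, en b < c -> b = 0) ->
  (size v <= 1)%N -> fil c (pert_m (barw v)).
Proof.
move=> c0 cP v1; rewrite pert_mE i_word; apply: lop_fil; apply: dl_word1 => //.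
by rewrite size_map.
Qed.

Lemma pert_Pi_hker x : h x = 0 -> pert_Pi x = p x.
Proof. by move=> hx; rewrite [LHS]hplPiE hx !lop0 addr0. Qed.

Lemma h_word0 : h (barw [::]) = 0.
Proof. by rewrite [LHS]lext_mono /= ins_nil linear0. Qed.

Lemma pert_Pi_nil : pert_Pi (barw [::]) = barw [::].
Proof. by rewrite pert_Pi_hker ?h_word0 // p_word. Qed.

Lemma pert_m_twisted : twisted_Ainf pert_m.
Proof.
split; first exact: lcoderP pert_m_deg pert_m_par pert_m_lcoder.
  exact: pert_m_sq.
have [c c0 cP] := en_gap G; exists c => // b bc.
exact: etrans (congr1 (@pr1 R H) (pert_m_word1 (v := [::]) c0 cP isT bc)) (linear0 _).
Qed.

Lemma pert_I_twisted : twisted_mor pert_m m pert_I.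
Proof.
split; first exact: lcomorP pert_I_deg pert_I_par pert_I_lcomor.
  apply: barw_nil_fil_pos; have [c c0 cP] := en_gap G; exists c => //.
  exact: (pert_I_word1 (v := [::]) c0 cP).
by move=> y; exact: esym (m_pert_I y).
Qed.

Lemma pert_Pi_twisted : twisted_mor m pert_m pert_Pi.
Proof.
split; first exact: lcomorP pert_Pi_deg pert_Pi_par pert_Pi_lcomor.
  apply: barw_nil_fil_pos; exists 1 => //.
  move=> b _; rewrite (_ : _ - _ = 0) //; apply/eqP.
  by rewrite subr_eq0; apply/eqP; exact: pert_Pi_nil.
exact: pert_Pi_m.
Qed.

(** The partial sums of the formulas are the images of those of the geometric
    series. *)
Lemma pert_formulas : perturbation_formulas r m pert_m pert_Pi pert_I.
Proof.
split.
- move=> x; apply: (flim_ext _ (flim_lin (f := lcomp p dl) _ (neumP hn (i x)))) => [n|e y ey].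
    exact: (linear_sum (lcomp p dl)).
  exact: (lop_fil (lcomp p dl)).
- move=> x; apply: (flim_ext _ (flim_lin (f := p) _ (neumP dn x))) => [n|e y ey].
    exact: (linear_sum p).
  exact: lop_fil.
exact: (fun x => neumP hn (i x)).
Qed.
End PerturbedStructure.

(** * Cyclic structures *)

Section Pairing.
Variables (K : realType) (R : gring K) (C : gmod R) (P : C -> C -> R).
Hypothesis PL : forall a x x' y, P (a *: x + x') y = a * P x y + P x' y.
Hypothesis PR : forall a x y y', P x (a *: y + y') = a * P x y + P x y'.

Lemma pairing0l y : P 0 y = 0.
Proof. by have := PL (-1) 0 0 y; rewrite scaler0 addr0 mulN1r addNr. Qed.
Lemma pairing0r x : P x 0 = 0.
Proof. by have := PR (-1) x 0 0; rewrite scaler0 addr0 mulN1r addNr. Qed.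
Lemma pairingDl x x' y : P (x + x') y = P x y + P x' y.
Proof. by have := PL 1 x x' y; rewrite scale1r mul1r. Qed.
Lemma pairingDr x y y' : P x (y + y') = P x y + P x y'.
Proof. by have := PR 1 x y y'; rewrite scale1r mul1r. Qed.
Lemma pairingNl x y : P (- x) y = - P x y.
Proof. by have := PL (-1) x 0 y; rewrite addr0 pairing0l addr0 scaleN1r mulN1r. Qed.

Definition ell (s : seq C) : R^o := if s is [:: x; y] then P x y : R^o else 0.

Lemma ell_multilinear : multilinear ell.
Proof.
move=> [|z [|z' [|z'' s1]]] [|y [|y' s2]] a x x' //=; rewrite ?scaler0 ?addr0 //.
Qed.
Definition ellL : {linear tensalg C -> R^o} := mk_linear (ulift_linear ell_multilinear).
Lemma ell_word s : ellL (word s) = ell s.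
Proof. exact/tlift_word/ell_multilinear. Qed.

Lemma pair_bilinear :
  bilinear2 (fun p : tensalg C * tensalg C => P (pr1 p.1) (pr1 p.2) : R^o).
Proof. by split=> a x x' y /=; rewrite linearP; [exact: PL | exact: PR]. Qed.
Definition pairL : {linear tens (tensalg C) (tensalg C) -> R^o} :=
  mk_linear (ulift_linear pair_bilinear).
Lemma pair_ten u v : pairL (ten u v) = P (pr1 u) (pr1 v).
Proof. exact/blift_ten/pair_bilinear. Qed.

Lemma pair_tensmap (f g : {linear tensalg C -> tensalg C}) u v :
  pairL (tensmap f g (ten u v)) = P (pr1 (f u)) (pr1 (g v)).
Proof. by rewrite tensmap_ten pair_ten. Qed.

(** Among the cuts of a word only the middle one of a word of two letters has
    parts of length one on both sides. *)
Lemma ell_deconc t : ellL t = pairL (deconc t).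
Proof.
move: t; apply: (@talg_ext _ _ _ ellL (pairL \o @deconc R C)) => s.
rewrite [LHS]ell_word -[RHS]/(pairL (deconc (word s))) deconc_word (linear_sum pairL).
under eq_bigr => j _ do rewrite /cutw pair_ten !pr1_word.
case: s => [|x [|y [|z s]]].
- by rewrite !big_ord_recl big_ord0 /= ?(pairing0l, pairing0r) ?(addr0, add0r).
- by rewrite !big_ord_recl big_ord0 /= ?(pairing0l, pairing0r) ?(addr0, add0r).
- by rewrite !big_ord_recl big_ord0 /= ?(pairing0l, pairing0r) ?(addr0, add0r).
rewrite big1 // => j _; case: j => -[|[|[|j]]] jlt /=; rewrite ?pairing0l ?pairing0r //.
Qed.

Lemma ell_len1 t : inlen (lgwords C) (1 : K) t -> ellL t = 0.
Proof.
elim=> [|a w z w1 _ IH]; first exact: linear0.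
rewrite linearP IH addr0 [ellL _]ell_word.
move: w1; rewrite -[1]/(1%:R) ler_nat /=.
by case: w => [|x [|y w]] //= _; rewrite scaler0.
Qed.
End Pairing.

Section CyclicPerturbation.
Variables (K : realType) (R : gring K) (G : dmonoid K) (C : dgmod R).
Variables (r : retraction C) (m : {linear bar G C -> bar G C}).
Hypotheses (mA : twisted_Ainf m) (mp : is_perturbation m).
Variable P : C -> C -> R.
Hypothesis PL : forall a x x' y, P (a *: x + x') y = a * P x y + P x' y.
Hypothesis PR : forall a x y y', P x (a *: y + y') = a * P x y + P x y'.
Hypothesis Pm : forall x : bar G C, lozenge P (m x) = 0.
Hypothesis Ph : cyclic_retraction r P.
Local Notation H := (HC C).
Local Notation sg := (@shsgn _ _ C).
Local Notation dl := (ldl mA).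
Local Notation h := (lh G r).
Local Notation i := (li G r).
Local Notation p := (lp G r).
Local Notation pert_I := (pert_I r mA).
Local Notation lloz := (lext G (ellL PL PR)).
Local Notation lpair := (lext G (pairL PL PR)).

Lemma lloz_delta x : lloz x = lpair (ldelta G C x).
Proof. by apply/funext => g; apply: ell_deconc. Qed.

Lemma pairing_h_I x y : P (rh r x) (rI r y) = 0.
Proof. by have := Ph x (rI r y); rewrite rhI (pairing0r PR) addr0. Qed.

Lemma pairing_sg_h x y : P (sg x) (rh r y) = P (rh r x) y.
Proof.
by rewrite shsgnE (pairingNl PL); apply/eqP; rewrite eq_sym -addr_eq0 Ph.
Qed.

(** By cyclicity h can be moved to the second factor, where it meets I. *)
Lemma lpair_h_P z : lpair (lten h (lcomp i p) z) = 0.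
Proof.
have -> : lten h (lcomp i p) z = lten h (lext G (tmap (rI r \o rPi r))) z.
  by apply: lten_ext => // y; apply/funext => b; rewrite /= /ext tmap_comp.
rewrite lten_lext; apply/funext => b; rewrite fam0 /= /ext; move: (z b).
apply: (@tens_ext _ _ _ _ (pairL PL PR \o tensmap (insert sg (rh r) (rI r \o rPi r))
  (tmap (rI r \o rPi r))) \0) => u v.
rewrite [LHS](pair_tensmap PL PR) /=.
by rewrite pr1_ins pr1_tmap pairing_h_I.
Qed.

Lemma lpair_sg_h z : lpair (lten (lsgn G C) h z) = lpair (lten h (lid G _) z).
Proof.
have -> : lten h (lid G _) z = lten h (lext G idfun) z by exact: lten_ext.
rewrite !lten_lext; apply/funext => b; rewrite /= /ext; move: (z b).
apply: (@tens_ext _ _ _ _ (pairL PL PR \o tensmap (tmap sg) (insert sg (rh r) (rI r \o rPi r)))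
  (pairL PL PR \o tensmap (insert sg (rh r) (rI r \o rPi r)) idfun)) => u v.
rewrite [LHS](pair_tensmap PL PR) [RHS](pair_tensmap PL PR) /=.
by rewrite !pr1_ins pr1_tmap pairing_sg_h.
Qed.

Lemma lloz_h x : lloz (h x) = lpair (lten h (lid G _) (ldelta G C x)).
Proof.
rewrite lloz_delta ldelta_h lopD.
by rewrite [X in X + _]lpair_h_P add0r; exact: lpair_sg_h.
Qed.

(** In each term of (dl (x) 1 + s (x) dl)(I (x) I) one factor is I or s I, and h can
    be moved to it. *)
Lemma lloz_h_dl_pert_I y : lloz (h (dl (pert_I y))) = 0.
Proof.
rewrite lloz_h ldelta_dl; have [_ ->] := pert_I_lcomor r mA.
move: (ldelta G H y) => z; rewrite !lopD.
have -> : lten h (lid G _) (lten (lsgn G C) dl (lten pert_I pert_I z)) = 0.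
  apply: lten_fuse3_0l => x.
  have := lsgn_h r (pert_I x); rewrite h_pert_I lop0 => /esym/eqP; rewrite oppr_eq0.
  by move/eqP.
rewrite lop0 addr0 -lpair_sg_h.
rewrite (_ : lten (lsgn G C) h _ = 0) ?lop0 //.
by apply: lten_fuse3_0r => x; exact: h_pert_I.
Qed.

Lemma lloz_pert_I y : lloz (pert_I y) = lloz (i y).
Proof. by rewrite [in LHS]pert_I_fix lopD lloz_h_dl_pert_I addr0. Qed.

(** The part of lozenge m = 0 at energy zero: there dl shortens words, and only
    d preserves the words of two letters. *)
Lemma pairing_d x y : P (comp10 m x) y + P (sg x) (comp10 m y) = 0.
Proof.
have E : ellL PL PR (ld m (barw [:: x; y]) 0 + dl (barw [:: x; y]) 0) = 0.
  have := congr1 (fun z : fam G R^o => z 0) (Pm (barw [:: x; y])).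
  by rewrite -(lmE mA).
have [c c0 cP] := en_gap G.
have dl0 : ellL PL PR (dl (barw [:: x; y]) 0) = 0.
  apply: ell_len1; have := dl_lowers mA c0 cP [:: x; y] 0.
  rewrite en0 mulr0 mul0r addr0.
  by rewrite [(lg_size _)%:R - 1](_ : _ = 1) //= -[2%:R]natr1 addrK.
have ldE : ld m (barw [:: x; y]) 0 = word [:: comp10 m x; y] + word [:: sg x; comp10 m y].
  have -> : ld m (barw [:: x; y]) 0 = insert sg (comp10 m) idfun (word [:: x; y]).
    by rewrite /barw [ld m _]lext_mono /mono eqxx.
  by rewrite !ins_cons ins_nil linear0 addr0 !tmap_word !tcat_word.
have eD (u v : tensalg C) : ellL PL PR (u + v) = ellL PL PR u + ellL PL PR v by exact: linearD.
by move: E; rewrite eD dl0 addr0 ldE eD [X in X + _]ell_word [X in _ + X]ell_word.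
Qed.

Lemma pairing_cycle_bnd z u : comp10 m z = 0 -> P z (comp10 m u) = 0.
Proof.
move=> dz; have := pairing_d (sg z) u; rewrite shsgnK.
have -> : comp10 m (sg z) = 0.
  by have := sd_m mp z; rewrite dz linear0 => /esym/eqP; rewrite oppr_eq0 => /eqP.
by rewrite (pairing0l PL) add0r.
Qed.
Lemma pairing_bnd_cycle z u : comp10 m z = 0 -> P (comp10 m u) z = 0.
Proof. by move=> dz; have := pairing_d u z; rewrite dz (pairing0r PR) addr0. Qed.

Lemma cycle_d x : comp10 m x = 0 -> dg_d C x = 0.
Proof.
rewrite mp /dprime => dx; have := (sgn_odd x (@dg_deg _ _ C)).
case=> // _ + _; rewrite dx oppr0 => /(congr1 (@cdsgn _ _ C)).
by rewrite cdsgnK linear0.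
Qed.

Lemma d_I y : comp10 m (rI r y) = 0. Proof. by rewrite mp rdI. Qed.

(** The class is taken for the differential of C, and the boundary expressed by
    its signed version. *)
Lemma repr_hclass x : comp10 m x = 0 ->
  exists u, cyc_val (repr (hclass (dg_d C) x)) = x + comp10 m u.
Proof.
move=> dx; have xc : x \in cyc_pred (dg_d C).
  by rewrite unfold_in /cyc_pred (cycle_d dx) eqxx.
rewrite /hclass (insubT (fun x => x \in cyc_pred (dg_d C)) xc) /=.
set z : cycles (dg_d C) := Sub x xc.
have /hcl_eq[u zu] : hcl (repr (hcl z)) = hcl z by rewrite hcl_repr.
exists (cdsgn u); rewrite mp /dprime cdsgnK -zu addrC.
by rewrite subrK.
Qed.

(** The pairing vanishes between cycles and boundaries. *)
Lemma inducedE y y' : induced_pairing r P y y' = P (rI r y) (rI r y').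
Proof.
rewrite /induced_pairing /hpair.
have [u ->] := repr_hclass (d_I y); have [u' ->] := repr_hclass (d_I y').
have dd v : comp10 m (comp10 m v) = 0.
  rewrite !mp /dprime.
  have [_ -> _] := sgn_odd (cdsgn v) (@dg_deg _ _ C) isT erefl.
  by rewrite cdsgnK linearN dg_sq oppr0.
rewrite (pairingDl PL) !(pairingDr PR) (pairing_cycle_bnd _ (d_I y)).
rewrite (pairing_bnd_cycle _ (d_I y')).
by rewrite (pairing_cycle_bnd _ (dd u)) !addr0.
Qed.

Local Notation PH := (induced_pairing r P).
Local Notation pert_m := (pert_m r mA).

Lemma induced_linl a x x' y : PH (a *: x + x') y = a * PH x y + PH x' y.
Proof. by rewrite !inducedE linearP PL. Qed.
Lemma induced_linr a x y y' : PH x (a *: y + y') = a * PH x y + PH x y'.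
Proof. by rewrite !inducedE linearP PR. Qed.

Lemma lozenge_induced (y : bar G H) : lozenge PH y = lloz (i y).
Proof.
apply/funext => b; rewrite /lozenge /= /ext; move: (y b).
apply: (@talg_ext _ _ _ (ellL induced_linl induced_linr) (ellL PL PR \o tmap (rI r))) => s.
rewrite [LHS]ell_word -[RHS]/(ellL PL PR (tmap (rI r) (word s))) tmap_word ell_word.
by case: s => [|x [|z [|w s]]] //=; exact: inducedE.
Qed.

Lemma lozenge_pert_I y : lozenge P (pert_I y) = lozenge PH y.
Proof. by rewrite lozenge_induced; exact: lloz_pert_I. Qed.

Lemma lozenge_pert_m y : lozenge PH (pert_m y) = 0.
Proof. by rewrite -lozenge_pert_I -m_pert_I // Pm. Qed.

Lemma homog_I j y : homog j y -> homog j (rI r y).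
Proof. by move=> yj; have := @rI_deg _ _ _ r _ _ yj; rewrite addr0. Qed.
Lemma homog_Pi j x : homog j x -> homog j (rPi r x).
Proof. by move=> xj; have := @rPi_deg _ _ _ r _ _ xj; rewrite addr0. Qed.

(** So the homology of HC for the perturbed structure is HC itself. *)
Lemma comp10_pert_m y : comp10 pert_m y = 0.
Proof.
have [c c0 cP] := en_gap G; rewrite comp10E.
have y0 : en (0 : gelt G) < c by rewrite en0.
exact: etrans (congr1 (@pr1 R H) (pert_m_word1 r mA (v := [:: y]) c0 cP isT y0)) (linear0 _).
Qed.

(** x and I (Pi x) differ by a boundary. *)
Lemma pairing_contract z x : comp10 m z = 0 -> comp10 m x = 0 -> P z (rI r (rPi r x)) = P z x.
Proof.
move=> dz dx; have := rdh r x; rewrite -!mp dx linear0 addr0 => E.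
have -> : rI r (rPi r x) = x + comp10 m (rh r x) by rewrite E addrC subrK.
by rewrite (pairingDr PR) (pairing_cycle_bnd _ dz) addr0.
Qed.

Section Homology.
Variables (p : int) (q : 'Z_2).
Hypotheses (Pp : is_pairing p q P) (Pa : antisym P) (Pf : perfect (comp10 m) p q P).

Definition mk_cycle (D : gmod R) (d : {linear D -> D}) x (dx : d x = 0) : cycles d :=
  Cycle (introT eqP dx : x \in cyc_pred d).

Lemma repr_hcl (D : gmod R) (d : {linear D -> D}) (z : cycles d) :
  exists u, cyc_val (repr (hcl z)) = cyc_val z + d u.
Proof.
have /hcl_eq[u zu] : hcl (repr (hcl z)) = hcl z by rewrite hcl_repr.
by exists u; rewrite -zu addrC subrK.
Qed.

Lemma repr_hcl_m (z : cycles (comp10 m)) :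
  exists u, cyc_val (repr (hcl z)) = cyc_val z + dprime u.
Proof. by have [u E] := repr_hcl z; exists u; rewrite -mp. Qed.

Lemma cycleP (D : gmod R) (d : {linear D -> D}) (z : cycles d) : d (cyc_val z) = 0.
Proof. by case: z => x xc; exact: eqP xc. Qed.

Lemma comp10_sq0 v : comp10 m (comp10 m v) = 0.
Proof.
rewrite !mp /dprime; have [_ -> _] := sgn_odd (cdsgn v) (@dg_deg _ _ C) isT erefl.
by rewrite cdsgnK linearN dg_sq oppr0.
Qed.

Lemma hpair_hcl (z z' : cycles (comp10 m)) :
  hpair P (hcl z) (hcl z') = P (cyc_val z) (cyc_val z').
Proof.
rewrite /hpair; have [u ->] := repr_hcl z; have [u' ->] := repr_hcl z'.
rewrite (pairingDl PL) !(pairingDr PR) (pairing_cycle_bnd _ (cycleP z)).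
rewrite (pairing_bnd_cycle _ (cycleP z')).
by rewrite (pairing_cycle_bnd _ (comp10_sq0 u)) !addr0.
Qed.

Lemma hpair_pert_m (a b : homology (comp10 pert_m)) y y' :
  cyc_val (repr a) = y -> cyc_val (repr b) = y' -> hpair PH a b = P (rI r y) (rI r y').
Proof. by move=> <- <-; rewrite /hpair inducedE. Qed.

Lemma repr_pert_m y : cyc_val (repr (hcl (mk_cycle (comp10_pert_m y)))) = y.
Proof.
have [u ->] := repr_hcl (mk_cycle (comp10_pert_m y)).
exact: etrans (congr1 (fun z => y + z) (comp10_pert_m u)) (addr0 _).
Qed.

(** If y is orthogonal to HC, then I y is orthogonal to all cycles; perfectness
    makes it a boundary, and Pi maps boundaries to zero. *)
Lemma induced_nondeg : nondeg PH.
Proof.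
move=> y y0; apply: contrapT => Hn; apply: y0.
have PI0 y' : P (rI r y) (rI r y') = 0.
  by apply: contrapT => yy; apply: Hn; exists y'; rewrite inducedE.
have : hcl (mk_cycle (d_I y)) = 0.
  apply: (proj1 Pf) => b; rewrite -(hcl_repr b) hpair_hcl /=.
  by rewrite -(pairing_contract (d_I y) (cycleP _)) PI0.
rewrite -(subrr (hcl (mk_cycle (d_I y)))) -hclB subrr => /hcl_eq[u /= yu].
by rewrite -[y](rPiI r) -[rI r y]subr0 yu mp rPid.
Qed.

Lemma induced_is_pairing : is_pairing p q PH.
Proof.
have [_ _ Pd] := Pp; split; [exact: induced_linl | exact: induced_linr |].
by move=> j k x y /homog_I xj /homog_I yk; rewrite inducedE; apply: Pd.
Qed.

Lemma induced_antisym : antisym PH.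
Proof. by move=> j k x y /homog_I xj /homog_I yk; rewrite !inducedE; apply: Pa. Qed.

(** A functional phi on HC is pulled back along Pi to the homology of C, where it
    is represented by a cycle z; then Pi z represents phi. *)
Lemma induced_perfect : perfect (comp10 pert_m) p q PH.
Proof.
split=> [a Ha|k phi phik].
  rewrite -(hcl_repr a); set y := repr a.
  have y0 : cyc_val y = 0.
    apply: contrapT => /induced_nondeg[y' []].
    rewrite inducedE -(Ha (hcl (mk_cycle (comp10_pert_m y')))).
    by rewrite (hpair_pert_m (erefl : cyc_val (repr a) = cyc_val y) (repr_pert_m y')).
  rewrite (_ : y = 0); last exact: val_inj.
  by rewrite -(subrr 0) hclB subrr.
have [cyc cycE] : exists cyc : {linear H -> homology (comp10 pert_m)},
    forall y, cyc y = hcl (mk_cycle (comp10_pert_m y)).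
  have cycL : linear (fun y => hcl (mk_cycle (comp10_pert_m y))).
    move=> a y y'; rewrite -[a *: hcl _]/(hscale a _) hscale_cl -hclD.
    by congr hcl; apply: val_inj.
  by exists (mk_linear cycL).
have [psi psiE] : exists psi : {linear homology (comp10 m) -> R^o},
    forall z, psi (hcl z) = phi (cyc (rPi r (cyc_val z))).
  have psi_cl (z : cycles (comp10 m)) :
      phi (cyc (rPi r (cyc_val (repr (hcl z))))) = phi (cyc (rPi r (cyc_val z))).
    have [u ->] := repr_hcl_m z.
    by rewrite (linearD (rPi r)) rPid addr0.
  have psiL : linear (fun b : homology (comp10 m) => phi (cyc (rPi r (cyc_val (repr b))))).
    move=> a b b'; rewrite -(hcl_repr b) -(hcl_repr b').
    rewrite -[a *: hcl _]/(hscale a _) hscale_cl -hclD !psi_cl.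
    rewrite -[cyc_val (_ + _)]/(a *: cyc_val (repr b) + cyc_val (repr b')).
    by rewrite (linearP (rPi r)) (linearP cyc) (linearP phi).
  by exists (mk_linear psiL).
have homc j y : homog j y -> homogH j (cyc y).
  by move=> yj; exists (mk_cycle (comp10_pert_m y)).
have [j b [z zj ->]|_ [z zk ->] Ea] := proj2 Pf k psi.
  by rewrite psiE; apply: phik; apply: homc; exact: homog_Pi.
exists (cyc (rPi r (cyc_val z))) => [|b]; first exact/homc/homog_Pi.
set y := cyc_val (repr b).
have by_ : b = cyc y by rewrite cycE -[LHS]hcl_repr; congr hcl; exact: val_inj.
have -> : hpair PH (cyc (rPi r (cyc_val z))) b = P (rI r (rPi r (cyc_val z))) (rI r y).
  by rewrite cycE; apply: hpair_pert_m => //; exact: repr_pert_m.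
have := Ea (hcl (mk_cycle (d_I y))); rewrite psiE hpair_hcl.
have -> : cyc_val (mk_cycle (d_I y)) = rI r y by [].
rewrite rPiI -by_ => ->.
have -> : rI r (rPi r (cyc_val z)) = cyc_val z + comp10 m (rh r (cyc_val z)).
  have := rdh r (cyc_val z); rewrite -!mp; have -> : comp10 m (cyc_val z) = 0 by exact: cycleP.
  by rewrite linear0 addr0 => ->; rewrite addrC subrK.
by rewrite (pairingDl PL) (pairing_bnd_cycle _ (d_I y)) addr0.
Qed.

Lemma cyclic_perturbation :
  cyclic_Ainf p q pert_m PH /\ cyclic_mor pert_m PH m P pert_I.
Proof.
split; split.
- exact: pert_m_twisted.
- exact: induced_is_pairing.
- by split; [exact: induced_antisym | exact: induced_nondeg].
- exact: induced_perfect.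
- exact: lozenge_pert_m.
- exact: pert_I_twisted.
- exact: lozenge_pert_I.
Qed.
End Homology.
End CyclicPerturbation.

(** * Units *)

Section PerturbedUnit.
Variables (K : realType) (R : comNzRingType) (G : dmonoid K).
Variables (A B : lmodType R) (dl h s : lop G A A) (p : lop G A B) (i : lop G B A).
Variable s' : lop G B B.
Local Notation P := (lcomp i p).
Local Notation "1" := (lid G _).
Hypotheses (pi : forall y, p (i y) = y) (hh : forall x, h (h x) = 0).
Hypotheses (ph : forall x, p (h x) = 0) (hi : forall y, h (i y) = 0).
Hypotheses (ss : forall x, s (s x) = x) (sh : forall x, s (h x) = - h (s x)).
Hypothesis ps : forall x, p (s x) = s' (p x).
Hypothesis hn : topnil (lcomp h dl).
Variables (EA : lop G (tens A A) A) (EB : lop G (tens B B) B).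
Variables (cl cr : lop G (tens A A) A) (cl' cr' : lop G (tens B B) B).
Hypothesis dlE : forall z, dl (EA z) =
  EA (lten dl 1 z) - EA (lten s dl z) + (cl z - s (cr z)).
Hypothesis hE : forall z, h (EA z) = EA (lten h P z) - EA (lten s h z).
Hypothesis iE : forall z, i (EB z) = EA (lten i i z).
Hypothesis pE : forall z, p (EA z) = EB (lten p p z).
Hypotheses (hcl : forall z, h (cl z) = cl (lten 1 h z))
  (hcr : forall z, h (cr z) = cr (lten h 1 z)).
Hypotheses (pcl : forall z, p (cl z) = cl' (lten p p z))
  (pcr : forall z, p (cr z) = cr' (lten p p z)).
Local Notation I := (hplI i hn).
Local Notation mc := (hplm p i hn).

(** The right-hand side solves the fixed point equation defining the left-hand
    side: the terms in which the unit is absorbed are killed by h. *)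
Lemma hplI_sand z : I (EB z) = EA (lten I I z).
Proof.
have hI y : h (I y) = 0 by exact: h_hplI.
have pI y : p (I y) = y by exact: p_hplI.
have hsI y : h (s (I y)) = 0.
  by apply/eqP; rewrite -oppr_eq0 -sh hI lop0.
have hdl y : h (dl (I y)) = ladd I (lopp i) y.
  by rewrite laddE loppE [in RHS]hplIE addrAC subrr add0r.
have e1 : lten h P (lten dl 1 (lten I I z)) = lten I i z - lten i i z.
  rewrite -lten_oppl -lten_addl; apply: lten_fuse3 => x; first exact: hdl.
  by rewrite lidE lcompE pI.
have e2 : lten h P (lten s dl (lten I I z)) = 0.
  by apply: lten_fuse3_0l => x; exact: hsI.
have e3 : lten s h (lten dl 1 (lten I I z)) = 0.
  by apply: lten_fuse3_0r => x; rewrite lidE hI.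
have e4 : lten s h (lten s dl (lten I I z)) = lten I I z - lten I i z.
  rewrite -lten_oppr -lten_addr; apply: lten_fuse3 => x; last exact: hdl.
  exact: ss.
have e5 : lten 1 h (lten I I z) = 0 by rewrite lten_comp; apply: lten0r => x; exact: hI.
have e6 : lten h 1 (lten I I z) = 0 by rewrite lten_comp; apply: lten0l => x; exact: hI.
have e : h (dl (EA (lten I I z))) = EA (lten I I z) - EA (lten i i z).
  have e7 : h (s (cr (lten I I z))) = 0.
    by apply/eqP; rewrite -oppr_eq0 -sh hcr e6 !lop0.
  rewrite dlE !(lopD, lopN) !hE e1 e2 e3 e4 e7 hcl e5 !lop0 !subr0 sub0r opprK addr0.
  by rewrite -lopD -lopB addrC addrA subrK.
apply/eqP; rewrite -subr_eq0; apply/eqP; apply: (topnil_fix hn).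
rewrite lcompE !lopB e [in LHS]hplIE iE opprB addrA.
by rewrite [X in X - _]addrC.
Qed.

(** Apply p dl to the formula for I, with p I = 1. *)
Lemma hplm_sand z : mc (EB z) =
  EB (lten mc 1 z) - EB (lten s' mc z) + (cl' z - s' (cr' z)).
Proof.
have pI y : p (I y) = y by exact: p_hplI.
have -> : mc (EB z) = p (dl (I (EB z))) by [].
rewrite hplI_sand dlE !(lopD, lopN) !pE pcl ps pcr.
have -> : lten p p (lten I I z) = z.
  by rewrite -[RHS]lten_id; apply: lten_fuse => y; rewrite pI.
congr (EB _ - EB _ + _); apply: lten_fuse3 => y //; first by rewrite lidE pI.
by rewrite ps pI.
Qed.
End PerturbedUnit.

Lemma unit_word0 (K : realType) (R : gring K) (D : gmod R) (s1 s2 : seq D) :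
  (size s1 + size s2 <> 1)%N ->
  ((s1 == [::])%:R : R) *: len1 s2 - ((s2 == [::])%:R : R) *: shsgn (len1 s1) = 0.
Proof.
have s0 : shsgn (0 : D) = 0 by exact: linear0.
case: s1 => [|x [|x' s1]]; case: s2 => [|y [|y' s2]] //= _;
  by rewrite ?s0 ?scaler0 ?scale0r ?subr0.
Qed.

Section UnitalPerturbation.
Variables (K : realType) (R : gring K) (G : dmonoid K) (C : dgmod R).
Variables (r : retraction C) (m : {linear bar G C -> bar G C}) (e : C).
Hypotheses (mA : twisted_Ainf m) (mp : is_perturbation m).
Hypotheses (mu1 : is_unit m e) (re : retraction_unit r e).
Local Notation H := (HC C).
Local Notation sg := (@shsgn _ _ C).
Local Notation dl := (ldl mA).
Local Notation h := (lh G r).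
Local Notation i := (li G r).
Local Notation p := (lp G r).
Local Notation pert_I := (pert_I r mA).
Local Notation pert_m := (pert_m r mA).
Local Notation pert_Pi := (pert_Pi r mA).
Local Notation e' := (rPi r e).
Definition lsand (D : gmod R) (x : D) : lop G (tens (tensalg D) (tensalg D)) (tensalg D) :=
  lext G (sand (word [:: x])).
Definition lcounl (D : gmod R) : lop G (tens (tensalg D) (tensalg D)) (tensalg D) :=
  lext G (@counl R D).
Definition lcounr (D : gmod R) : lop G (tens (tensalg D) (tensalg D)) (tensalg D) :=
  lext G (@counr R D).

Lemma unit_deg : homog 0 e. Proof. by case: re. Qed.
Lemma h_unit : rh r e = 0. Proof. by case: re. Qed.

(** The sign in the definition of components is invertible. *)
Lemma comp_pr1 (D : gmod R) (f : bar G D -> bar G D) s b :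
  Defs.comp f s b = 0 <-> pr1 (f (barw s) b) = 0.
Proof.
rewrite /Defs.comp /pi1B /ext /epssgn; case: ifP => // _; split=> [E|->]; last exact: linear0.
by rewrite -[LHS]parsgnK E linear0.
Qed.

Lemma comp_pr1_0 (D : gmod R) (f : bar G D -> bar G D) s :
  Defs.comp f s 0 = pr1 (f (barw s) 0).
Proof. by rewrite /Defs.comp mu0. Qed.

Lemma d_unit : comp10 m e = 0.
Proof. by have [_ _ _ mu0] := mu1; apply: (mu0 [::] [::]) => -[]. Qed.

Lemma sgn_unit : sg e = - e.
Proof. by rewrite [sg e](sgop_homog _ unit_deg) expr1 scaleN1r. Qed.

(** The homotopy identity at e, where h e = 0 and d e = 0. *)
Lemma I_Pi_unit : rI r e' = e.
Proof.
have := rdh r e; rewrite -!mp h_unit d_unit !linear0 addr0 => /esym/eqP.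
by rewrite subr_eq0 => /eqP.
Qed.

Lemma coefl_dl s b : pr1 (coefl dl b (word s)) =
  pr1 (m (barw s) b) - (b == 0)%:R *: comp10 m (len1 s).
Proof.
have -> : coefl dl b (word s) = m (barw s) b - ld m (barw s) b by [].
have -> : ld m (barw s) b = if b == 0 then insert sg (comp10 m) idfun (word s) else 0.
  by rewrite /barw [ld m _]lext_mono.
rewrite linearB; congr (_ - _); case: eqP => _; last by rewrite linear0 scale0r.
by rewrite [LHS]pr1_ins pr1_word scale1r.
Qed.

(** The formula for the coefficients of a coderivation, with c = 1 at exponent
    zero. *)
Lemma dl_sand z : dl (lsand e z) =
  lsand e (lten dl (lid G _) z) - lsand e (lten (lsgn G C) dl z) +
  (lcounl C z - lsgn G C (lcounr C z)).
Proof.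
move: z; apply: (lop_ext (f := lcomp dl (lsand e))
  (g := ladd (ladd (lcomp (lsand e) (lten dl (lid G _)))
                   (lopp (lcomp (lsand e) (lten (lsgn G C) dl))))
             (ladd (lcounl C) (lopp (lcomp (lsgn G C) (lcounr C)))))) => w.
apply/funext => b.
have -> : lcomp dl (lsand e) (mono 0 w) b = coefl dl b (sand (word [:: e]) w).
  by rewrite lcompE; congr (dl _ b); exact: lext_mono.
have [_ me1 me2 me0] := mu1.
rewrite (coder_unit (coefl_pr0 (ldl_coder mA) b) (coefl_deconc (ldl_coder mA) b)
  (e := e) (c := (b == 0)%:R) sgn_unit).
- rewrite !laddE !loppE !famD !famN.
  congr (_ - _ + _).
  + by rewrite -(lten_coefl dl).
  + by rewrite -(lten_coefr dl).
  rewrite !lcompE -[lcounl C]/(lext G _) -[lcounr C]/(lext G _) -[lsgn G C]/(lext G _).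
  rewrite !lext_mono /mono; case: eqP => _; first by rewrite scale1r.
  by rewrite scale0r subrr.
- move=> x; rewrite coefl_dl /= linear0 scaler0 subr0.
  have [->|b0] := eqVneq b 0; first by rewrite scale1r -comp_pr1_0.
  by rewrite scale0r; apply/comp_pr1/(me0 [::] [:: x]) => -[_ /eqP]; rewrite (negbTE b0).
- move=> x; rewrite coefl_dl /= linear0 scaler0 subr0.
  have [->|b0] := eqVneq b 0.
    by rewrite -comp_pr1_0 -[in LHS](cdsgnK x) me2 scaleN1r shsgnE opprK.
  by rewrite oppr0 scale0r; apply/comp_pr1/(me0 [:: x] [::]) => -[_ /eqP]; rewrite (negbTE b0).
move=> s1 s2 sz; rewrite coefl_dl.
rewrite (_ : pr1 _ = 0) ?sub0r; last by apply/comp_pr1/me0 => -[/eqP]; rewrite (negbTE sz).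
rewrite (_ : comp10 m _ = 0) ?scaler0 ?oppr0 //.
case: s1 {sz} => [|x s1]; last by case: s1 => [|? ?] /=; rewrite linear0.
by case: s2 => [|y s2] /=; rewrite ?d_unit ?linear0.
Qed.

(** Of the three positions of h, the one on e itself gives zero; i p fixes e, and
    the sign operator changes its sign. *)
Lemma h_sand z : h (lsand e z) =
  lsand e (lten h (lcomp i p) z) - lsand e (lten (lsgn G C) h z).
Proof.
have -> : lten h (lcomp i p) z = lten h (lext G (tmap (rI r \o rPi r))) z.
  by apply: lten_ext => // y; apply/funext => b; rewrite /= /ext tmap_comp.
rewrite !lten_lext; apply/funext => b; rewrite famD famN.
rewrite -[LHS]/(insert sg (rh r) (rI r \o rPi r) (sand (word [:: e]) (z b))).
rewrite ins_sand ?h_unit //= I_Pi_unit sgn_unit sand_opp.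
by [].
Qed.

Lemma lsand_tmap (D D' : gmod R) (f : {linear D -> D'}) x z :
  lext G (tmap f) (lsand x z) =
  lsand (f x) (lten (lext G (tmap f)) (lext G (tmap f)) z).
Proof. by rewrite lten_lext; apply/funext => b; apply: tmap_sand. Qed.

Lemma lcl_tmap (D D' : gmod R) (f : {linear D -> D'}) z :
  lext G (tmap f) (lcounl D z) = lcounl D' (lten (lext G (tmap f)) (lext G (tmap f)) z).
Proof. by rewrite lten_lext; apply/funext => b; apply: lin_counl. Qed.
Lemma lcr_tmap (D D' : gmod R) (f : {linear D -> D'}) z :
  lext G (tmap f) (lcounr D z) = lcounr D' (lten (lext G (tmap f)) (lext G (tmap f)) z).
Proof. by rewrite lten_lext; apply/funext => b; apply: lin_counr. Qed.

Lemma lext_tmap_id (D : gmod R) x : lext G (tmap (@idfun D)) x = x.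
Proof. by apply/funext => b; apply: tmap_id. Qed.

Lemma lcl_lext (D : gmod R) (k : {linear tensalg D -> tensalg D}) z :
  lext G k (lcounl D z) = lcounl D (lten (lid G _) (lext G k) z).
Proof.
have -> : lten (lid G _) (lext G k) z = lten (lext G (tmap (@idfun D))) (lext G k) z.
  by apply: lten_ext => // y; rewrite lext_tmap_id.
by rewrite lten_lext; apply/funext => b; apply: lin_counl.
Qed.
Lemma lcr_lext (D : gmod R) (k : {linear tensalg D -> tensalg D}) z :
  lext G k (lcounr D z) = lcounr D (lten (lext G k) (lid G _) z).
Proof.
have -> : lten (lext G k) (lid G _) z = lten (lext G k) (lext G (tmap (@idfun D))) z.
  by apply: lten_ext => // y; rewrite lext_tmap_id.
by rewrite lten_lext; apply/funext => b; apply: lin_counr.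
Qed.

Lemma i_sand z : i (lsand e' z) = lsand e (lten i i z).
Proof. by rewrite [LHS]lsand_tmap I_Pi_unit. Qed.

Lemma pert_I_sand z : pert_I (lsand e' z) = lsand e (lten pert_I pert_I z).
Proof.
exact: (hplI_sand (lp_li r) (lh_lh r) (lp_lh r) (lh_li r) (@lsgnK _ _ G C)
  (lsgn_h r) (hdl_nil r mA) dl_sand h_sand i_sand (lcl_lext _) (lcr_lext _)).
Qed.

Lemma pert_m_sand z : pert_m (lsand e' z) =
  lsand e' (lten pert_m (lid G _) z) - lsand e' (lten (lsgn G H) pert_m z) +
  (lcounl H z - lsgn G H (lcounr H z)).
Proof.
exact: (hplm_sand (lp_li r) (lh_lh r) (lp_lh r) (lh_li r) (@lsgnK _ _ G C)
  (lsgn_h r) (lp_lsgn r) (hdl_nil r mA) dl_sand h_sand i_sand (lsand_tmap (rPi r) e)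
  (lcl_lext _) (lcr_lext _) (lcl_tmap (rPi r)) (lcr_tmap (rPi r))).
Qed.

Lemma barw_sand (D : gmod R) (x : D) s1 s2 :
  barw (s1 ++ x :: s2) = lsand x (tenU (barw s1) (barw s2)) :> bar G D.
Proof. by rewrite /barw tenU_mono [RHS]lext_mono /= sand_ten !tcat_word. Qed.

(** Since f has no part of length zero, e cannot stand alone in the first two
    terms. *)
Lemma lsand_comp (D : gmod R) (f : lop G (tensalg D) (tensalg D)) x s1 s2 b :
  (forall s a, pr0 (f (barw s) a) = 0) ->
  let z := tenU (barw s1) (barw s2) in
  pr1 ((lsand x (lten f (lid G _) z) - lsand x (lten (lsgn G D) f z) +
        (lcounl D z - lsgn G D (lcounr D z))) b) =
  (b == 0)%:R *: ((s1 == [::])%:R *: len1 s2 - (s2 == [::])%:R *: shsgn (len1 s1)).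
Proof.
move=> f0 z; rewrite !famD !famN.
have a1 : pr1 (lsand x (lten f (lid G _) z) b) = 0.
  rewrite lten_tenU lidE -[lsand x _ b]/(sand _ (tenU (f (barw s1)) (barw s2) b)).
  by rewrite tenU_monor pr1_sand f0 mul0r scale0r.
have a2 : pr1 (lsand x (lten (lsgn G D) f z) b) = 0.
  rewrite lten_tenU; have -> : lsgn G D (barw s1) = mono 0 (tmap (@shsgn _ _ D) (word s1)).
    exact: lext_mono.
  rewrite -[lsand x _ b]/(sand _ (tenU (mono 0 (tmap _ (word s1))) (f (barw s2)) b)).
  by rewrite tenU_monol pr1_sand f0 mulr0 scale0r.
have zE : z = mono 0 (ten (word s1) (word s2)) by exact: tenU_mono.
have a3 : lcounl D z b = (b == 0)%:R *: ((s1 == [::])%:R *: word s2).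
  rewrite zE [lcounl D _]lext_mono /mono /= counl_ten pr0_word.
  by case: (b == 0); rewrite ?scale1r ?scale0r.
have a4 : lsgn G D (lcounr D z) b =
    (b == 0)%:R *: ((s2 == [::])%:R *: tmap (@shsgn _ _ D) (word s1)).
  rewrite zE [lcounr D _]lext_mono [lsgn G D _]lext_mono /mono /= counr_ten pr0_word linearZ /=.
  by case: (b == 0); rewrite ?scale1r ?scale0r.
have pr1D (u v : tensalg D) : pr1 (u + v) = pr1 u + pr1 v by exact: linearD.
have pr1B (u v : tensalg D) : pr1 (u - v) = pr1 u - pr1 v by exact: linearB.
rewrite pr1D !pr1B a1 a2 a3 a4 !linearZ /= pr1_tmap !pr1_word.
by rewrite subrr add0r scalerDr.
Qed.

Lemma pert_m_unit_comp s1 s2 b : pr1 (pert_m (barw (s1 ++ e' :: s2)) b) =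
  (b == 0)%:R *: ((s1 == [::])%:R *: len1 s2 - (s2 == [::])%:R *: shsgn (len1 s1)).
Proof.
rewrite barw_sand pert_m_sand; apply: lsand_comp => s a.
have [c _] := pert_m_lcoder r mA.
exact: (congr1 (fun z : fam G R^o => z a) (c (barw s))).
Qed.

Lemma Pi_unit_deg : homog 0 e'.
Proof. by have := @rPi_deg _ _ _ r _ _ unit_deg; rewrite addr0. Qed.

Lemma pert_m_unit : is_unit pert_m e'.
Proof.
split; first exact: Pi_unit_deg.
- move=> x; rewrite comp_pr1_0 (pert_m_unit_comp [::] [:: x]) eqxx !scale1r.
  by rewrite scale0r subr0.
- move=> x; rewrite comp_pr1_0 (pert_m_unit_comp [:: cdsgn x] [::]) eqxx !scale1r /=.
  by rewrite scale0r sub0r shsgnE opprK cdsgnK.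
move=> s1 s2 b sb; apply/comp_pr1; rewrite pert_m_unit_comp.
have [b0|_] := eqVneq b 0; last by rewrite scale0r.
have sz : (size s1 + size s2)%N <> 1%N by move=> s12; apply: sb.
by rewrite unit_word0 // scaler0.
Qed.

(** The part of length one only involves the counit of f, so that f can be replaced
    by the empty word. *)
Lemma pr1_sand_counit (D : gmod R) (x : D) (f : bar G D) b :
  (forall a, pr0 (f a) = pr0 ((barw [::] : bar G D) a)) ->
  pr1 (lsand x (tenU f f) b) = mono 0 x b.
Proof.
move=> f0; have tenE (g : bar G D) : pr1 (lsand x (tenU g g) b) =
    \sum_(q \in [set q : gelt G * gelt G | q.1 + q.2 = b])
      (pr0 (g q.1) * pr0 (g q.2) : R) *: x.
  rewrite -[lsand x _ b]/(sand _ (tenU g g b)) /tenU !fsbig_finite /=; try exact: finite_dec.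
  rewrite (linear_sum (sand (word [:: x]))) (linear_sum (@pr1 R D)) /=.
  by apply: eq_bigr => q _; rewrite pr1_sand.
rewrite tenE; under eq_fsbigr => q _ do rewrite !f0.
rewrite -tenE -(barw_sand x [::] [::]) /barw /mono; case: eqP => _; last exact: linear0.
by rewrite pr1_word.
Qed.

(** I (1) is group-like, so that it is the empty word once its part of length one
    vanishes, and I e' = I (1) e I (1). *)
Lemma pert_I_unital : unital_mor pert_m m pert_I e' e.
Proof.
have pI0 a : pr0 (pert_I (barw [::]) a) = pr0 ((barw [::] : bar G H) a).
  have [c _] := pert_I_lcomor r mA.
  exact: (congr1 (fun z : fam G R^o => z a) (c (barw [::]))).
have E : pert_I (barw [:: e']) = lsand e (tenU (pert_I (barw [::])) (pert_I (barw [::]))).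
  by rewrite (barw_sand e' [::] [::]) pert_I_sand lten_tenU.
split.
- exact: pert_I_twisted.
- apply/funext => b; rewrite /pi1B /ext.
  apply: etrans (congr1 (fun z : bar G C => pr1 (z b)) E) _.
  apply: pr1_sand_counit => a; rewrite pI0 /barw /mono.
  by case: eqP => _; rewrite ?linear0 // !pr0_word.
move=> p0; apply: etrans E _.
suff -> : pert_I (barw [::]) = barw [::] by rewrite -barw_sand.
apply/funext => b; rewrite [LHS]headmul_deconc pI0.
have [_ D] := pert_I_lcomor r mA.
have -> : deconc (pert_I (barw [::]) b) = tenU (pert_I (barw [::])) (pert_I (barw [::])) b.
  have := congr1 (fun z => z b) (D (barw [::])).
  have -> : ldelta G H (barw [::]) = tenU (barw [::]) (barw [::]).
    by rewrite /barw tenU_mono [LHS]lext_mono /= deconc_nil.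
  by rewrite lten_tenU.
rewrite /tenU fsbig_finite /=; last exact: finite_dec.
rewrite (linear_sum (@headmul R C)) big1 ?addr0 => [|q _]; last first.
  rewrite /= headmul_ten; have -> : pr1 (pert_I (barw [::]) q.1) = 0.
    exact: (congr1 (fun z : fam G C => z q.1) p0).
  by rewrite (word0 [::]) tcat0l.
by rewrite /barw /mono; case: eqP => _; rewrite ?linear0 ?scale0r // pr0_word scale1r.
Qed.

(** As h e = 0, only the first term of the series for Pi contributes. *)
Lemma pert_Pi_unital : unital_mor m pert_m pert_Pi e e'.
Proof.
have E : pert_Pi (barw [:: e]) = barw [:: e'].
  rewrite pert_Pi_hker ?p_word // /barw [h _]lext_mono /= ins_cons ins_nil h_unit.
  by rewrite (word0 [::]) tcat0l linear0 addr0 linear0.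
split; [exact: pert_Pi_twisted | | by move=> _; exact: E].
apply/funext => b; rewrite /pi1B /ext.
apply: etrans (congr1 (fun z : bar G H => pr1 (z b)) E) _.
by rewrite /barw /mono; case: eqP => _; [rewrite pr1_word | exact: linear0].
Qed.
End UnitalPerturbation.

(** * Cyclicity and unitality of the perturbed structures *)

Theorem proposition27 (K : realType) (G : dmonoid K) (R : gring K)
    (C : dgmod R) :
  (* (a) *)
  (forall (p : int) (q : 'Z_2) (P : C -> C -> R)
      (m : {linear bar G C -> bar G C}),
    cyclic_Ainf p q m P -> is_perturbation m ->
    forall r : retraction C, cyclic_retraction r P -> unital_retraction r ->
    exists (mcan : {linear bar G (HC C) -> bar G (HC C)})
           (Pi : {linear bar G C -> bar G (HC C)})
           (I : {linear bar G (HC C) -> bar G C}),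
      [/\ perturbation_formulas r m mcan Pi I,
          cyclic_Ainf p q mcan (induced_pairing r P) &
          cyclic_mor mcan (induced_pairing r P) m P I])
  /\
  (* (b) *)
  (forall (m : {linear bar G C -> bar G C}) (e : C),
    twisted_Ainf m -> is_unit m e -> is_perturbation m ->
    forall r : retraction C, retraction_unit r e ->
    exists (mcan : {linear bar G (HC C) -> bar G (HC C)})
           (Pi : {linear bar G C -> bar G (HC C)})
           (I : {linear bar G (HC C) -> bar G C}),
      [/\ perturbation_formulas r m mcan Pi I,
          twisted_Ainf mcan,
          is_unit mcan (rPi r e),
          unital_mor mcan m I (rPi r e) e &
          unital_mor m mcan Pi e (rPi r e)]).
Proof.
split=> [p q P m [mA Pp [Pa _] Pf Pm] mp r Ph _|m e mA mu1 mp r re].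
  have [PL PR _] := Pp.
  have [cm cI] := cyclic_perturbation mA mp PL PR Pm Ph Pp Pa Pf.
  exists (pert_m r mA), (pert_Pi r mA), (pert_I r mA); split=> //.
  exact: pert_formulas.
exists (pert_m r mA), (pert_Pi r mA), (pert_I r mA); split.
- exact: pert_formulas.
- exact: pert_m_twisted.
- exact: pert_m_unit.
- exact: pert_I_unital.
- exact: pert_Pi_unital.
Qed.
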